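(* Assume that $\omega$ satisfies the Diophantine condition and that $a\in\mathcal E_\mu$ for some $\mu>0$ with $\mathcal N_\mu(a)\le M$ (precise formulations in the context). Let $c\in(0,1)$, $n\in\mathbb N$ and $0<\varepsilon\le\varepsilon_n$, with $\varepsilon_n$ as given in the context. Then the solutions $(v^{[n]},w^{[n]})$ of the micro-macro problem $$\begin{cases}\partial_t v^{[n]}(t)=A^{[n]}v^{[n]}(t), & v^{[n]}(0)=(\Phi^{[n]}_0)^{-1}u_0,\\ \partial_t w^{[n]}(t)=a_{t/\varepsilon}w^{[n]}(t)-\delta^{[n]}_{t/\varepsilon}v^{[n]}(t), & w^{[n]}(0)=0,\end{cases}$$ are bounded at all times $t\ge0$ by $$|v^{[n]}(t)|\le e^{(1+c)tM}\frac{|u_0|}{1-c},\qquad |w^{[n]}(t)|\le\left(\frac{\varepsilon}{\varepsilon_n}\right)^{n+1}e^{t\|a\|}\left(2e^{(1+c)tM}-1\right)\frac{|u_0|}{1-c}.$$ Thus, for any $T>0$, the micro-macro problem is bounded on $[0,T]$ uniformly with respect to $\varepsilon\in(0,\varepsilon_n]$, with $v^{[n]}$ of size $\mathcal O(1)$ and $w^{[n]}$ of size $\mathcal O(\varepsilon^{n+1})$.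
   Context: $(X,|\cdot|)$ is a Banach space, $u_0\in X$, and $\mathrm{End}(X)$ is the space of (bounded) linear maps $X\to X$ with the induced norm, also denoted $|\cdot|$ (Fourier coefficients are taken in the complexification if $X$ is real). For $\varphi:\mathbb R_+\to\mathrm{End}(X)$, the time average is $\langle\varphi\rangle=\lim_{\tau\to\infty}\frac1\tau\int_0^\tau\varphi_\sigma\,d\sigma$, and $\|\varphi\|=\sup_{\tau\ge0}|\varphi_\tau|$. Fix $r\ge1$ and $\omega\in\mathbb R^r$; $\mathbb T=\mathbb R/(2\pi\mathbb Z)$; for $\alpha\in\mathbb Z^r$, $|\alpha|=|\alpha_1|+\dots+|\alpha_r|$. Diophantine condition: there exist $c_D>0$ and $\nu\ge r-1$ such that $|\alpha\cdot\omega|\ge c_D/|\alpha|^\nu$ for all $\alpha\in\mathbb Z^r\setminus\{0\}$ (if $r=1$, one takes $\nu=0$, $c_D=|\omega|$). For $\kappa\ge0$, $\mathcal T_\kappa$ is the set of $\varphi^\sharp\in C^0(\mathbb T^r,\mathrm{End}(X))$, with Fourier coefficients $\widehat\varphi^\sharp_\alpha$, such that $\|\varphi^\sharp\|_\kappa:=\sum_{\alpha\in\mathbb Z^r}e^{\kappa|\alpha|}|\widehat\varphi^\sharp_\alpha|<\infty$; $\mathcal E^\sharp_\kappa$ is the set of maps $\tau\mapsto\varphi^\sharp_{\omega\tau}$ with $\varphi^\sharp\in\mathcal T_\kappa$. $\mathcal E^\flat$ is the set of $\varphi^\flat\in C^0(\mathbb R_+,\mathrm{End}(X))$ with $\|\varphi^\flat\|_{L^\infty_{\exp}}:=\sup_{\tau\ge0}e^\tau|\varphi^\flat_\tau|<\infty$.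 Under the Diophantine condition, the sum $\mathcal E_\kappa=\mathcal E^\sharp_\kappa\oplus\mathcal E^\flat$ is direct and each $\varphi\in\mathcal E_\kappa$ splits uniquely as $\varphi_\tau=\varphi^\sharp_{\omega\tau}+\varphi^\flat_\tau$; set $\mathcal N_\kappa(\varphi)=\|\varphi^\sharp\|_\kappa+\|\varphi^\flat\|_{L^\infty_{\exp}}$. Assumption on $a$: $\tau\mapsto a_\tau\in\mathrm{End}(X)$ belongs to $\mathcal E_\mu$ for some $\mu>0$, and $M>0$ is a constant with $\|a\|\le\mathcal N_\mu(a)\le M$. For $\varphi$ with $\langle\varphi\rangle=\mathrm{id}$ set $\Lambda\{\varphi\}_\tau=a_\tau\varphi_\tau-\varphi_\tau\langle a\varphi\rangle$. For $\varepsilon>0$ define inductively $\Phi^{[0]}=\mathrm{id}$ and $$A^{[n]}=\langle a\Phi^{[n]}\rangle,\qquad \Phi^{[n+1]}_\tau=\mathrm{id}+\varepsilon\int_0^\tau\Lambda\{\Phi^{[n]}\}_\sigma d\sigma-\varepsilon\Big\langle\int_0^{\bullet}\Lambda\{\Phi^{[n]}\}_\sigma d\sigma\Big\rangle,$$ so that $\langle\Phi^{[n]}\rangle=\mathrm{id}$. The defect is $\delta^{[n]}_\tau=\frac1\varepsilon\partial_\tau\Phi^{[n]}_\tau-\big(a_\tau\Phi^{[n]}_\tau-\Phi^{[n]}_\tau A^{[n]}\big)=\Lambda\{\Phi^{[n-1]}\}_\tau-\Lambda\{\Phi^{[n]}\}_\tau$, with the convention $\Lambda\{\Phi^{[-1]}\}=0$.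 Threshold: $\varepsilon_n=\dfrac{c}{c_I(\mu/(n+1))\,N_c\,M}$ with $N_c=(2+c)(1+c)$ and $c_I(\kappa)=\max\{1,\frac1{c_D}(\frac{\nu}{\kappa e})^\nu\}$ if $\nu\ne0$, $c_I(\kappa)=\max\{1,\frac1{c_D}\}$ if $\nu=0$. For this choice and all $0<\varepsilon\le\varepsilon_n$ one has $\|\Phi^{[n]}-\mathrm{id}\|\le c\,\varepsilon/\varepsilon_n\le c$ (so $(\Phi^{[n]}_0)^{-1}$ exists), $|A^{[n]}|\le(1+c)M$ and $|\varepsilon\int_0^\tau\delta^{[n]}_\sigma d\sigma|\le(\varepsilon/\varepsilon_n)^{n+1}$ for all $\tau\ge0$. *)

(* Defs.v *)
From Stdlib Require Import Reals Lra Lia ZArith List.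
From Stdlib Require Import FunctionalExtensionality PropExtensionality.
From Stdlib Require Import ProofIrrelevance ClassicalEpsilon.
From mathcomp Require Import ssreflect ssrfun ssrbool eqtype ssrnat seq.
From mathcomp Require Import fintype bigop.
From Coquelicot Require Import Coquelicot.

Set Implicit Arguments.
Unset Strict Implicit.
Unset Printing Implicit Defensive.

Local Open Scope R_scope.

Record is_norm (K : AbsRing) (V : ModuleSpace K) (nrm : V -> R) : Prop := {
  is_norm_triangle : forall x y, nrm (plus x y) <= nrm x + nrm y;
  is_norm_scal : forall (l : K) x, nrm (scal l x) <= abs l * nrm x;
  is_norm_eq0 : forall x, nrm x = 0 -> x = zero }.

Lemma is_norm_zero (K : AbsRing) (V : ModuleSpace K) (nrm : V -> R) :
  is_norm nrm -> nrm zero = 0.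
Proof.
move=> [tri sc _].
have h1 := sc zero zero; have h2 := tri zero zero.
rewrite scal_zero_r abs_zero in h1; rewrite plus_zero_r in h2; lra.
Qed.

Lemma is_norm_opp (K : AbsRing) (V : ModuleSpace K) (nrm : V -> R) x :
  is_norm nrm -> nrm (opp x) <= nrm x.
Proof.
move=> [_ sc _]; rewrite -scal_opp_one.
by have := sc (opp one) x; rewrite abs_opp_one Rmult_1_l.
Qed.

Lemma norm_ball_refl (K : AbsRing) (V : ModuleSpace K) (nrm : V -> R) :
  is_norm nrm -> forall x (e : posreal), nrm (minus x x) < e.
Proof.
by move=> h x [e he] /=; rewrite minus_eq_zero (is_norm_zero h).
Qed.

Lemma norm_ball_sym (K : AbsRing) (V : ModuleSpace K) (nrm : V -> R) :
  is_norm nrm ->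
  forall x y (e : R), nrm (minus y x) < e -> nrm (minus x y) < e.
Proof.
move=> h x y e he; apply: Rle_lt_trans he.
by rewrite -opp_minus; exact: is_norm_opp.
Qed.

Lemma norm_ball_triangle (K : AbsRing) (V : ModuleSpace K) (nrm : V -> R) :
  is_norm nrm ->
  forall x y z (e1 e2 : R), nrm (minus y x) < e1 -> nrm (minus z y) < e2 ->
    nrm (minus z x) < e1 + e2.
Proof.
move=> h x y z e1 e2 h1 h2; rewrite (minus_trans y).
apply: (Rle_lt_trans _ _ _ (is_norm_triangle h _ _)).
by rewrite Rplus_comm; exact: Rplus_lt_compat.
Qed.

Definition norm_UniformSpace_mixin (K : AbsRing) (V : ModuleSpace K)
    (nrm : V -> R) (h : is_norm nrm) : UniformSpace.mixin_of V :=
  @UniformSpace.Mixin V zero (fun x e y => nrm (minus y x) < e)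
    (norm_ball_refl h) (norm_ball_sym h) (norm_ball_triangle h).

Definition norm_NormedModuleAux (K : AbsRing) (V : ModuleSpace K)
    (nrm : V -> R) (h : is_norm nrm) : NormedModuleAux K :=
  NormedModuleAux.Pack K V
    (NormedModuleAux.Class K V (ModuleSpace.class K V)
      (norm_UniformSpace_mixin h)) V.

Lemma norm_ball_compat2 (K : AbsRing) (V : ModuleSpace K) (nrm : V -> R)
    (h : is_norm nrm) (x y : norm_NormedModuleAux h) (e : posreal) :
  ball x e y -> nrm (minus y x) < 1 * e.
Proof. by rewrite Rmult_1_l. Qed.

Definition norm_NormedModule_mixin (K : AbsRing) (V : ModuleSpace K)
    (nrm : V -> R) (h : is_norm nrm) :
    NormedModule.mixin_of K (norm_NormedModuleAux h) :=
  @NormedModule.Mixin K (norm_NormedModuleAux h) nrm 1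
    (is_norm_triangle h) (is_norm_scal h) (fun x y e he => he)
    (norm_ball_compat2 (h := h)) (is_norm_eq0 h).

Definition cauchy_complete (T : UniformSpace) : Prop :=
  forall F : (T -> Prop) -> Prop, ProperFilter F -> cauchy F ->
    exists l : T, forall e : posreal, F (ball l e).

Definition choose_lim (T : UniformSpace) (F : (T -> Prop) -> Prop) : T :=
  epsilon (inhabits (UniformSpace.point_of T (UniformSpace.class T)))
    (fun l => forall e : posreal, F (ball l e)).

Lemma choose_lim_complete (T : UniformSpace) (h : cauchy_complete T) :
  forall F : (T -> Prop) -> Prop, ProperFilter F -> cauchy F ->
  forall e : posreal, F (ball (choose_lim F) e).
Proof.
move=> F pF cF.
by apply: (epsilon_spec _ (fun l => forall e : posreal, F (ball l e))); exact: h.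
Qed.

Lemma choose_lim_close (T : UniformSpace) (F1 F2 : (T -> Prop) -> Prop) :
  filter_le F1 F2 -> filter_le F2 F1 ->
  close (choose_lim F1) (choose_lim F2).
Proof.
move=> h1 h2.
have -> : F1 = F2.
  apply: functional_extensionality => P; apply: propositional_extensionality.
  by split; [exact: h2 | exact: h1].
exact: close_refl.
Qed.

Definition choose_CompleteSpace_mixin (T : UniformSpace)
    (h : cauchy_complete T) : CompleteSpace.mixin_of T :=
  @CompleteSpace.Mixin T (@choose_lim T) (choose_lim_complete h)
    (@choose_lim_close T).

Inductive base_field := RealField | ComplexField.

Definition scalars (k : base_field) : AbsRing :=
  match k with RealField => R_AbsRing | ComplexField => C_AbsRing end.

Definition of_R (k : base_field) : R -> scalars k :=
  match k with RealField => fun x => x | ComplexField => RtoC end.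

Lemma scalars_mult_comm k (x y : scalars k) : mult x y = mult y x.
Proof. by case: k x y => x y; [exact: Rmult_comm | exact: Cmult_comm]. Qed.

Lemma of_R_plus k x y : of_R k (x + y) = plus (of_R k x) (of_R k y).
Proof. by case: k => //=; rewrite RtoC_plus. Qed.

Lemma of_R_mult k x y : of_R k (x * y) = mult (of_R k x) (of_R k y).
Proof. by case: k => //=; rewrite RtoC_mult. Qed.

Lemma of_R_one k : of_R k 1 = one.
Proof. by case: k. Qed.

Lemma abs_of_R k x : abs (of_R k x) = Rabs x.
Proof. by case: k => //=; exact: Cmod_R. Qed.

Section Realification.
Context (k : base_field) (X : CompleteNormedModule (scalars k)).

Definition real_scal (r : R) (x : X) : X := scal (of_R k r) x.

Lemma real_scal_assoc (r s : R_Ring) (x : X) :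
  real_scal r (real_scal s x) = real_scal (mult r s) x.
Proof. by rewrite /real_scal scal_assoc -of_R_mult. Qed.

Lemma real_scal_one (x : X) : real_scal one x = x.
Proof. by rewrite /real_scal of_R_one scal_one. Qed.

Lemma real_scal_distr_l (r : R_Ring) (x y : X) :
  real_scal r (plus x y) = plus (real_scal r x) (real_scal r y).
Proof. exact: scal_distr_l. Qed.

Lemma real_scal_distr_r (r s : R_Ring) (x : X) :
  real_scal (plus r s) x = plus (real_scal r x) (real_scal s x).
Proof. by rewrite /real_scal of_R_plus scal_distr_r. Qed.

Definition realify_ModuleSpace_mixin :
    ModuleSpace.mixin_of R_Ring (NormedModule.AbelianGroup _ X) :=
  @ModuleSpace.Mixin R_Ring (NormedModule.AbelianGroup _ X) real_scal
    real_scal_assoc real_scal_one real_scal_distr_l real_scal_distr_r.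

Definition realify_NormedModuleAux : NormedModuleAux R_AbsRing :=
  NormedModuleAux.Pack R_AbsRing X
    (NormedModuleAux.Class R_AbsRing X
      (ModuleSpace.Class R_Ring X
        (AbelianGroup.class (NormedModule.AbelianGroup _ X))
        realify_ModuleSpace_mixin)
      (UniformSpace.class (NormedModule.UniformSpace _ X))) X.

Lemma realify_norm_scal (r : R_AbsRing) (x : realify_NormedModuleAux) :
  norm (scal r x : X) <= abs r * norm (x : X).
Proof. by rewrite -[abs r](abs_of_R k); exact: norm_scal. Qed.

Definition realify_NormedModule_mixin :
    NormedModule.mixin_of R_AbsRing realify_NormedModuleAux :=
  @NormedModule.Mixin R_AbsRing realify_NormedModuleAux (@norm _ X)
    (@norm_factor _ X) (@norm_triangle _ X) realify_norm_scal
    (@norm_compat1 _ X) (@norm_compat2 _ X) (@norm_eq_zero _ X).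

(** [X] as a real Banach space: integrals over, and derivatives with respect
    to, a real variable are taken in it. *)
Definition realify : CompleteNormedModule R_AbsRing :=
  CompleteNormedModule.Pack R_AbsRing X
    (CompleteNormedModule.Class R_AbsRing X
      (NormedModule.Class R_AbsRing X
        (NormedModuleAux.class _ realify_NormedModuleAux)
        realify_NormedModule_mixin)
      (CompleteSpace.mixin _
        (CompleteSpace.class (CompleteNormedModule.CompleteSpace _ X)))) X.
End Realification.

Record bounded_op (k : base_field) (X : CompleteNormedModule (scalars k)) := {
  op_fun :> X -> X;
  op_linear : is_linear op_fun }.

Section BoundedOperators.
Context (k : base_field) (X : CompleteNormedModule (scalars k)).
Implicit Types f g h : bounded_op X.

Lemma bounded_op_eq f g : (forall x, f x = g x) -> f = g.
Proof.
case: f g => [f hf] [g hg] /= /functional_extensionality e; subst g.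
by rewrite (proof_irrelevance _ hf hg).
Qed.

Lemma op_plus_linear f g : is_linear (fun x => plus (f x) (g x)).
Proof.
exact: (is_linear_comp _ _ (is_linear_prod _ _ (op_linear f) (op_linear g))
  is_linear_plus).
Qed.

Lemma op_opp_linear f : is_linear (fun x => opp (f x)).
Proof. exact: (is_linear_comp _ _ (op_linear f) is_linear_opp). Qed.

Lemma op_scal_linear (c : scalars k) f : is_linear (fun x => scal c (f x)).
Proof.
apply: (is_linear_comp _ _ (op_linear f)).
by apply: is_linear_scal_r; exact: scalars_mult_comm.
Qed.

Definition op_zero : bounded_op X := Build_bounded_op is_linear_zero.
Definition op_plus f g := Build_bounded_op (op_plus_linear f g).
Definition op_opp f := Build_bounded_op (op_opp_linear f).
Definition op_scal c f := Build_bounded_op (op_scal_linear c f).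
Definition op_id : bounded_op X := Build_bounded_op is_linear_id.
Definition op_comp f g : bounded_op X :=
  Build_bounded_op (is_linear_comp _ _ (op_linear g) (op_linear f)).

(** The inverse of [f]; it is meaningful only for invertible [f]. *)
Definition op_inv f : bounded_op X :=
  epsilon (inhabits op_id)
    (fun g => op_comp g f = op_id /\ op_comp f g = op_id).

Lemma op_plusC f g : op_plus f g = op_plus g f.
Proof. by apply: bounded_op_eq => x; exact: plus_comm. Qed.
Lemma op_plusA f g h : op_plus f (op_plus g h) = op_plus (op_plus f g) h.
Proof. by apply: bounded_op_eq => x; exact: plus_assoc. Qed.
Lemma op_plus0 f : op_plus f op_zero = f.
Proof. by apply: bounded_op_eq => x; exact: plus_zero_r. Qed.
Lemma op_plusN f : op_plus f (op_opp f) = op_zero.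
Proof. by apply: bounded_op_eq => x; exact: plus_opp_r. Qed.

Definition bounded_op_AbelianMonoid_mixin :=
  AbelianMonoid.Mixin _ op_plus op_zero op_plusC op_plusA op_plus0.
Canonical bounded_op_AbelianMonoid :=
  AbelianMonoid.Pack (bounded_op X) bounded_op_AbelianMonoid_mixin
    (bounded_op X).
Definition bounded_op_AbelianGroup_mixin :=
  AbelianGroup.Mixin bounded_op_AbelianMonoid op_opp op_plusN.
Canonical bounded_op_AbelianGroup :=
  AbelianGroup.Pack (bounded_op X)
    (AbelianGroup.Class _ _ bounded_op_AbelianGroup_mixin) (bounded_op X).

Lemma op_scalA (c d : scalars k) f :
  op_scal c (op_scal d f) = op_scal (mult c d) f.
Proof. by apply: bounded_op_eq => x; exact: scal_assoc. Qed.
Lemma op_scal1 f : op_scal one f = f.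
Proof. by apply: bounded_op_eq => x; exact: scal_one. Qed.
Lemma op_scalDr (c : scalars k) f g :
  op_scal c (plus f g) = plus (op_scal c f) (op_scal c g).
Proof. by apply: bounded_op_eq => x; exact: scal_distr_l. Qed.
Lemma op_scalDl (c d : scalars k) f :
  op_scal (plus c d) f = plus (op_scal c f) (op_scal d f).
Proof. by apply: bounded_op_eq => x; exact: scal_distr_r. Qed.

Definition bounded_op_ModuleSpace_mixin :=
  ModuleSpace.Mixin (scalars k) bounded_op_AbelianGroup op_scal
    op_scalA op_scal1 op_scalDr op_scalDl.
Canonical bounded_op_ModuleSpace :=
  ModuleSpace.Pack (scalars k) (bounded_op X)
    (ModuleSpace.Class _ _ _ bounded_op_ModuleSpace_mixin) (bounded_op X).

Definition op_norm f : R :=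
  real (Glb_Rbar
    (fun M => 0 <= M /\ forall x : X, norm (f x) <= M * norm x)).

Lemma op_norm_glb f :
  exists m, [/\ op_norm f = m, 0 <= m,
    (forall M, 0 <= M -> (forall x : X, norm (f x) <= M * norm x) -> m <= M) &
    forall B, (forall M, 0 <= M -> (forall x : X, norm (f x) <= M * norm x) ->
       B <= M) -> B <= m].
Proof.
rewrite /op_norm; set E := fun M => _ /\ _.
have [lb glb] := Glb_Rbar_correct E.
have [M [M0 hM]] := linear_norm _ (op_linear f).
have EM : E M by split; [lra | exact: hM].
have h0 : Rbar_le 0 (Glb_Rbar E) by apply: glb => x [hx _].
have hM' := lb _ EM.
move: lb glb h0 hM'; case: (Glb_Rbar E) => [m| |] //= lb glb h0 hM'.
exists m; split => // [M1 h1 h2|B hB].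
  by have := lb M1 (conj h1 h2).
by apply: (glb (Finite B)) => M1 [h1 h2] /=; exact: hB.
Qed.

Lemma op_norm_ge0 f : 0 <= op_norm f.
Proof. by have [m [-> ]] := op_norm_glb f. Qed.

Lemma op_norm_lub f M :
  0 <= M -> (forall x : X, norm (f x) <= M * norm x) -> op_norm f <= M.
Proof. by have [m [-> _ + _]] := op_norm_glb f; apply. Qed.

Lemma op_norm_bound f (x : X) : norm (f x) <= op_norm f * norm x.
Proof.
have [m [-> m0 _ hB]] := op_norm_glb f.
have [x0|x0] := Req_dec (norm x) 0.
  have [M [M0 hM]] := linear_norm _ (op_linear f).
  by have := hM x; rewrite x0 !Rmult_0_r.
have xp : 0 < norm x by have := norm_ge_0 x; lra.
have : norm (f x) / norm x <= m.
  apply: hB => M M0 hM.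
  apply: (Rmult_le_reg_r (norm x)) => //.
  by have -> : norm (f x) / norm x * norm x = norm (f x) by field.
move=> h; have := Rmult_le_compat_r _ _ _ (Rlt_le _ _ xp) h.
by have -> : norm (f x) / norm x * norm x = norm (f x) by field.
Qed.

Lemma op_norm_is_norm : is_norm op_norm.
Proof.
split.
- move=> f g; apply: op_norm_lub => [|x].
    by have := op_norm_ge0 f; have := op_norm_ge0 g; lra.
  apply: (Rle_trans _ _ _ (norm_triangle _ _)).
  by have := op_norm_bound f x; have := op_norm_bound g x; lra.
- move=> c f; apply: op_norm_lub => [|x].
    by apply: Rmult_le_pos; [exact: abs_ge_0 | exact: op_norm_ge0].
  apply: (Rle_trans _ _ _ (norm_scal _ _)).
  rewrite Rmult_assoc; apply: Rmult_le_compat_l; first exact: abs_ge_0.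
  exact: op_norm_bound.
- move=> f f0; apply: bounded_op_eq => x; apply: norm_eq_zero.
  have := op_norm_bound f x; rewrite f0 Rmult_0_l.
  have := norm_ge_0 (f x); lra.
Qed.

Canonical bounded_op_UniformSpace :=
  UniformSpace.Pack (bounded_op X) (norm_UniformSpace_mixin op_norm_is_norm)
    (bounded_op X).
Canonical bounded_op_NormedModuleAux :=
  NormedModuleAux.Pack (scalars k) (bounded_op X)
    (NormedModuleAux.Class _ _ (ModuleSpace.class _ bounded_op_ModuleSpace)
      (norm_UniformSpace_mixin op_norm_is_norm)) (bounded_op X).
Canonical bounded_op_NormedModule :=
  NormedModule.Pack (scalars k) (bounded_op X)
    (NormedModule.Class (scalars k) (bounded_op X)
      (NormedModuleAux.class _ bounded_op_NormedModuleAux)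
      (norm_NormedModule_mixin op_norm_is_norm))
    (bounded_op X).
End BoundedOperators.

Lemma cauchy_norm_lim (K : AbsRing) (X : CompleteNormedModule K) (T : Type)
    (F : (T -> Prop) -> Prop) (f : T -> X) :
  ProperFilter F ->
  (forall e : posreal, exists x0, F (fun t => norm (minus (f t) x0) < e)) ->
  forall e : posreal,
    F (fun t => norm (minus (f t) (lim (filtermap f F))) < e).
Proof.
move=> pF cF e.
have pF' := filtermap_proper_filter _ _ f _ pF.
have cf : cauchy (filtermap f F).
  move=> e'; have [x0 h] := cF e'; exists x0.
  rewrite /filtermap; move: h; apply: filter_imp => t.
  exact: norm_compat1.
have nf := @norm_factor_gt_0 _ X.
have e'0 : 0 < e / @norm_factor _ X by apply: Rdiv_lt_0_compat => //; case: e.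
have h : F (fun t => ball (lim (filtermap f F)) (mkposreal _ e'0) (f t)).
  exact: complete_cauchy _ pF' cf _.
move: h; apply: filter_imp => t /norm_compat2 /=.
by have -> : @norm_factor _ X * (e / @norm_factor _ X) = e by field; lra.
Qed.

Section BoundedOperatorsComplete.
Context (k : base_field) (X : CompleteNormedModule (scalars k)).

Lemma op_pointwise_cauchy (F : (bounded_op X -> Prop) -> Prop) :
  ProperFilter F -> cauchy F -> forall (x : X) (e : posreal),
  F (fun f => norm (minus (f x)
    (lim (filtermap (fun f : bounded_op X => f x) F))) < e).
Proof.
move=> pF cF x; apply: cauchy_norm_lim => e.
have x0 := norm_ge_0 x.
have e0 : 0 < e / (1 + norm x).
  by apply: Rdiv_lt_0_compat; [case: e | lra].
have [g hg] := cF (mkposreal _ e0); exists (g x).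
move: hg; apply: filter_imp => f /=; rewrite /ball /= => hf.
apply: (Rle_lt_trans _ (op_norm (minus f g) * norm x)).
  exact: (op_norm_bound (minus f g) x).
apply: (Rle_lt_trans _ (e / (1 + norm x) * norm x)).
  by apply: Rmult_le_compat_r => //; exact: Rlt_le.
have -> : e / (1 + norm x) * norm x = e - e / (1 + norm x) by field; lra.
lra.
Qed.

Lemma norm_small_eq (x y : X) :
  (forall e : posreal, norm (minus x y) <= e) -> x = y.
Proof.
move=> h.
have h0 : norm (minus x y) = 0.
  have := norm_ge_0 (minus x y) => -[] // hp.
  by have := h (mkposreal _ (is_pos_div_2 (mkposreal _ hp))) => /=; lra.
have := norm_eq_zero _ h0 => e.
by rewrite -(plus_zero_r y) -e plus_comm /minus -plus_assoc plus_opp_l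
  plus_zero_r.
Qed.

Lemma norm_minus_sym (x y : X) : norm (minus x y) = norm (minus y x).
Proof. by rewrite -opp_minus norm_opp. Qed.

Lemma norm_minus_triangle (z x y : X) :
  norm (minus x y) <= norm (minus x z) + norm (minus z y).
Proof. by rewrite (minus_trans z); exact: norm_triangle. Qed.

Lemma bounded_op_complete : cauchy_complete (bounded_op_UniformSpace X).
Proof.
move=> F pF cF.
have fand P Q : F P -> F Q -> F (fun f => P f /\ Q f) by exact: filter_and.
pose l x := lim (filtermap (fun f : bounded_op X => f x) F).
have hl := op_pointwise_cauchy pF cF; rewrite -/(l _) in hl.
have {}hl : forall x (e : posreal),
  F (fun f : bounded_op X => norm (minus (f x) (l x)) < e) := hl.
have lD x y : l (plus x y) = plus (l x) (l y).
  apply: norm_small_eq => e.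
  have hF := fand _ _ (hl (plus x y) (pos_div_2 e))
    (fand _ _ (hl x (pos_div_2 (pos_div_2 e)))
       (hl y (pos_div_2 (pos_div_2 e)))).
  have [f [/= h1 [h2 h3]]] := filter_ex (F := F) _ hF.
  apply: (Rle_trans _ _ _ (norm_minus_triangle (f (plus x y)) _ _)).
  rewrite norm_minus_sym (linear_plus _ (op_linear f)).
  rewrite (linear_plus _ (op_linear f)) in h1.
  have -> : minus (plus (f x) (f y)) (plus (l x) (l y)) =
            plus (minus (f x) (l x)) (minus (f y) (l y)).
    rewrite /minus opp_plus !plus_assoc; congr plus.
    by rewrite -!plus_assoc; congr plus; rewrite plus_comm.
  apply: (Rle_trans _ (e / 2 + (e / 2 / 2 + e / 2 / 2))); last lra.
  apply: Rplus_le_compat; first exact: Rlt_le.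
  apply: (Rle_trans _ _ _ (norm_triangle _ _)).
  by apply: Rplus_le_compat; exact: Rlt_le.
have lZ c x : l (scal c x) = scal c (l x).
  apply: norm_small_eq => e.
  have c0 := abs_ge_0 c.
  have e0 : 0 < e / 2 / (1 + abs c).
    by apply: Rdiv_lt_0_compat; [exact: is_pos_div_2 | lra].
  have hF := fand _ _ (hl (scal c x) (pos_div_2 e))
    (hl x (mkposreal _ e0)).
  have [f [/= h1 h2]] := filter_ex (F := F) _ hF.
  apply: (Rle_trans _ _ _ (norm_minus_triangle (f (scal c x)) _ _)).
  apply: (Rle_trans _ (e / 2 + e / 2)); last lra.
  rewrite norm_minus_sym (linear_scal _ (op_linear f)).
  rewrite (linear_scal _ (op_linear f)) in h1.
  have -> : minus (scal c (f x)) (scal c (l x)) = scal c (minus (f x) (l x)).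
    by rewrite /minus scal_distr_l scal_opp_r.
  have h3 := norm_scal c (minus (f x) (l x)).
  have h4 : abs c * norm (minus (f x) (l x)) <= abs c * (e / 2 / (1 + abs c)).
    by apply: Rmult_le_compat_l => //; exact: Rlt_le.
  have h5 : abs c * (e / 2 / (1 + abs c)) = e / 2 - e / 2 / (1 + abs c).
    by field; lra.
  have h6 : 0 < e / 2 / (1 + abs c) := e0.
  apply: Rplus_le_compat; first exact: Rlt_le.
  apply: (Rle_trans _ _ _ h3); lra.
have le_eps a b : (forall e : posreal, a <= b + e) -> a <= b.
  move=> h; case: (Rle_or_lt a b) => // hab.
  have hp : 0 < (a - b) / 2 by lra.
  by have /= := h (mkposreal _ hp); lra.
have near (e : posreal) (g : bounded_op X) :
    F (fun f => op_norm (minus f g) < e) ->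
    forall x, norm (minus (g x) (l x)) <= e * norm x.
  move=> hg x; apply: le_eps => e'.
  have [f [h1 h2]] := filter_ex (F := F) _ (fand _ _ hg (hl x e')).
  apply: (Rle_trans _ _ _ (norm_minus_triangle (f x) _ _)).
  apply: Rplus_le_compat; last exact: Rlt_le.
  rewrite norm_minus_sym.
  apply: (Rle_trans _ _ _ (op_norm_bound (minus f g) x)).
  by apply: Rmult_le_compat_r; [exact: norm_ge_0 | exact: Rlt_le].
have lB : exists M, 0 < M /\ forall x : X, norm (l x) <= M * norm x.
  have [g hg] := cF (mkposreal 1 Rlt_0_1).
  exists (op_norm g + 1); split; first by have := op_norm_ge0 g; lra.
  move=> x; have := near _ _ hg x => /=.
  have := op_norm_bound g x.
  have -> : l x = plus (minus (l x) (g x)) (g x).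
    by rewrite /minus -plus_assoc plus_opp_l plus_zero_r.
  have := norm_triangle (minus (l x) (g x)) (g x).
  rewrite (norm_minus_sym (l x)).
  rewrite {4}/minus -plus_assoc plus_opp_l plus_zero_r; lra.
exists (Build_bounded_op (Build_is_linear l lD lZ lB)) => e.
have [g hg] := cF (pos_div_2 (pos_div_2 e)).
move: (hg); apply: filter_imp => f hf.
apply: (Rle_lt_trans _ (e / 2)); last by case: e {hg hf} => /= e; lra.
have e0 := cond_pos e.
apply: op_norm_lub => [|x]; first lra.
apply: (Rle_trans _ _ _ (norm_minus_triangle (g x) (f x) (l x))).
have h1 := near _ _ hg x; rewrite /= in h1.
have h2 := op_norm_bound (minus f g) x.
have h3 : op_norm (minus f g) * norm x <= e / 2 / 2 * norm x.
  by apply: Rmult_le_compat_r; [exact: norm_ge_0 | exact: Rlt_le].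
have h4 : norm (minus (f x) (g x)) <= op_norm (minus f g) * norm x := h2.
lra.
Qed.

Canonical bounded_op_CompleteSpace :=
  CompleteSpace.Pack (bounded_op X)
    (CompleteSpace.Class _ _ (choose_CompleteSpace_mixin bounded_op_complete))
    (bounded_op X).
Canonical bounded_op_CompleteNormedModule :=
  CompleteNormedModule.Pack (scalars k) (bounded_op X)
    (CompleteNormedModule.Class _ _
      (NormedModule.class _ (bounded_op_NormedModule X))
      (choose_CompleteSpace_mixin bounded_op_complete)) (bounded_op X).
End BoundedOperatorsComplete.

Record cplx (X : CompleteNormedModule R_AbsRing) :=
  Cplx { cplx_re : X; cplx_im : X }.

Section Complexification.
Context (X : CompleteNormedModule R_AbsRing).
Implicit Types z w : cplx X.

Definition cplx_zero : cplx X := Cplx zero zero.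
Definition cplx_plus z w :=
  Cplx (plus (cplx_re z) (cplx_re w)) (plus (cplx_im z) (cplx_im w)).
Definition cplx_opp z := Cplx (opp (cplx_re z)) (opp (cplx_im z)).
Definition cplx_scal (c : C) z :=
  Cplx (minus (scal (fst c) (cplx_re z)) (scal (snd c) (cplx_im z)))
       (plus (scal (snd c) (cplx_re z)) (scal (fst c) (cplx_im z))).

Lemma cplx_eq z w : cplx_re z = cplx_re w -> cplx_im z = cplx_im w -> z = w.
Proof. by case: z w => [a b] [a' b'] /= -> ->. Qed.

Lemma cplx_plusC z w : cplx_plus z w = cplx_plus w z.
Proof. by apply: cplx_eq; exact: plus_comm. Qed.
Lemma cplx_plusA z w u :
  cplx_plus z (cplx_plus w u) = cplx_plus (cplx_plus z w) u.
Proof. by apply: cplx_eq; exact: plus_assoc. Qed.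
Lemma cplx_plus0 z : cplx_plus z cplx_zero = z.
Proof. by apply: cplx_eq; exact: plus_zero_r. Qed.
Lemma cplx_plusN z : cplx_plus z (cplx_opp z) = cplx_zero.
Proof. by apply: cplx_eq; exact: plus_opp_r. Qed.

Definition cplx_AbelianMonoid_mixin :=
  AbelianMonoid.Mixin _ cplx_plus cplx_zero cplx_plusC cplx_plusA cplx_plus0.
Canonical cplx_AbelianMonoid :=
  AbelianMonoid.Pack (cplx X) cplx_AbelianMonoid_mixin (cplx X).
Definition cplx_AbelianGroup_mixin :=
  AbelianGroup.Mixin cplx_AbelianMonoid cplx_opp cplx_plusN.
Canonical cplx_AbelianGroup :=
  AbelianGroup.Pack (cplx X) (AbelianGroup.Class _ _ cplx_AbelianGroup_mixin)
    (cplx X).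

Lemma plus_interchange (G : AbelianGroup) (a b c d : G) :
  plus (plus a b) (plus c d) = plus (plus a c) (plus b d).
Proof.
rewrite -!plus_assoc; congr plus; rewrite !plus_assoc; congr plus.
exact: plus_comm.
Qed.

Lemma scal_scalR (a b : R) (x : X) : scal a (scal b x) = scal (a * b) x.
Proof. exact: scal_assoc. Qed.
Lemma plus_scalR (a b : R) (x : X) :
  plus (scal a x) (scal b x) = scal (a + b) x.
Proof. by rewrite -(scal_distr_r a b x). Qed.
Lemma opp_scalR (a : R) (x : X) : opp (scal a x) = scal (- a) x.
Proof. by rewrite -(scal_opp_l a x). Qed.

Lemma scal_congr (a b : R) (x : X) : a = b -> scal a x = scal b x.
Proof. by move=> ->. Qed.

Lemma cplx_scalA (c d : C_Ring) z :
  cplx_scal c (cplx_scal d z) = cplx_scal (mult c d) z.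
Proof.
case: c d z => [a b] [a' b'] [x y].
apply: cplx_eq; rewrite /= /minus !scal_distr_l !scal_opp_r !scal_scalR
  !opp_scalR ?opp_plus ?opp_opp ?opp_scalR plus_interchange.
all: by rewrite !plus_scalR; congr plus; apply: scal_congr; ring.
Qed.
Lemma cplx_scal1 z : cplx_scal (@one C_Ring) z = z.
Proof.
by apply: cplx_eq; rewrite /= scal_one scal_zero_l ?plus_zero_l //
  /minus opp_zero plus_zero_r.
Qed.
Lemma cplx_scalDr (c : C_Ring) z w :
  cplx_scal c (plus z w) = plus (cplx_scal c z) (cplx_scal c w).
Proof.
by apply: cplx_eq; rewrite /= /minus !scal_distr_l ?opp_plus plus_interchange.
Qed.
Lemma cplx_scalDl (c d : C_Ring) z :
  cplx_scal (plus c d) z = plus (cplx_scal c z) (cplx_scal d z).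
Proof.
by apply: cplx_eq; rewrite /= /minus !scal_distr_r ?opp_plus plus_interchange.
Qed.

Definition cplx_ModuleSpace_mixin :=
  ModuleSpace.Mixin C_Ring cplx_AbelianGroup cplx_scal
    cplx_scalA cplx_scal1 cplx_scalDr cplx_scalDl.
Canonical cplx_ModuleSpace :=
  ModuleSpace.Pack C_Ring (cplx X)
    (ModuleSpace.Class _ _ _ cplx_ModuleSpace_mixin) (cplx X).

(** The (Taylor) norm of [x + i y] is the supremum over [t] of
    [|cos t x + sin t y|]; with it, real operators keep their norm. *)
Definition cplx_rot z (t : R) : X :=
  plus (scal (cos t) (cplx_re z)) (scal (sin t) (cplx_im z)).

Definition cplx_norm z : R :=
  real (Lub_Rbar (fun s => exists t, s = norm (cplx_rot z t))).
Lemma norm_scalR_le (a : R) (x : X) : Rabs a <= 1 -> norm (scal a x) <= norm x.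
Proof.
move=> h; apply: (Rle_trans _ _ _ (norm_scal _ _)).
have := Rmult_le_compat_r _ _ _ (norm_ge_0 x) h; rewrite Rmult_1_l.
by [].
Qed.

Lemma cplx_rot_le z t :
  norm (cplx_rot z t) <= norm (cplx_re z) + norm (cplx_im z).
Proof.
apply: (Rle_trans _ _ _ (norm_triangle _ _)).
apply: Rplus_le_compat; apply: norm_scalR_le; apply: Rabs_le.
  exact: COS_bound.
exact: SIN_bound.
Qed.

Lemma cplx_norm_spec z :
  (forall t, norm (cplx_rot z t) <= cplx_norm z) /\
  (forall B, (forall t, norm (cplx_rot z t) <= B) -> cplx_norm z <= B).
Proof.
rewrite /cplx_norm; set E := fun s => _.
have [ub lub] := Lub_Rbar_correct E.
have h1 : Rbar_le (Lub_Rbar E) (norm (cplx_re z) + norm (cplx_im z)).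
  by apply: lub => s [t ->] /=; exact: cplx_rot_le.
have h2 : Rbar_le (norm (cplx_rot z 0)) (Lub_Rbar E) by apply: ub; exists 0.
move: ub lub h1 h2; case: (Lub_Rbar E) => [m| |] //= ub lub _ _.
split=> [t|B hB]; first by apply: (ub (norm (cplx_rot z t))); exists t.
by apply: (lub (Finite B)) => s [t ->] /=.
Qed.

Lemma cplx_norm_le z : cplx_norm z <= norm (cplx_re z) + norm (cplx_im z).
Proof. by apply: (cplx_norm_spec z).2 => t; exact: cplx_rot_le. Qed.

Lemma cplx_norm_re z : norm (cplx_re z) <= cplx_norm z.
Proof.
have := (cplx_norm_spec z).1 0.
by rewrite /cplx_rot cos_0 sin_0 (scal_zero_l (cplx_im z)) plus_zero_r
  (scal_one (cplx_re z)).
Qed.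

Lemma cplx_norm_im z : norm (cplx_im z) <= cplx_norm z.
Proof.
have := (cplx_norm_spec z).1 (PI / 2).
by rewrite /cplx_rot cos_PI2 sin_PI2 (scal_zero_l (cplx_re z)) plus_zero_l
  (scal_one (cplx_im z)).
Qed.

Lemma unit_circle_angle (a b : R) :
  a * a + b * b = 1 -> exists t, a = cos t /\ b = sin t.
Proof.
move=> h.
have ha : -1 <= a <= 1 by nra.
have [hb|hb] := Rle_or_lt 0 b.
  exists (acos a); rewrite cos_acos // sin_acos //; split=> //.
  have -> : 1 - Rsqr a = b * b by rewrite /Rsqr; lra.
  by rewrite sqrt_square.
exists (- acos a); rewrite cos_neg sin_neg cos_acos // sin_acos //; split=> //.
have -> : 1 - Rsqr a = (- b) * (- b) by rewrite /Rsqr; lra.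
by rewrite sqrt_square; lra.
Qed.

Lemma C_polar (c : C) :
  exists t, c = (Cmod c * cos t, Cmod c * sin t)%R.
Proof.
case: c => a b; have [c0|c0] := Req_dec (Cmod (a, b)) 0.
  exists 0; rewrite c0 !Rmult_0_l; exact: Cmod_eq_0.
have h : Cmod (a, b) * Cmod (a, b) = a * a + b * b.
  rewrite /Cmod /= sqrt_sqrt; last by nra.
  by ring.
have [|t [h1 h2]] := @unit_circle_angle (a / Cmod (a, b)) (b / Cmod (a, b)).
  have -> : a / Cmod (a, b) * (a / Cmod (a, b)) +
            b / Cmod (a, b) * (b / Cmod (a, b)) =
            (a * a + b * b) / (Cmod (a, b) * Cmod (a, b)) by field.
  by rewrite -h; field.
by exists t; rewrite -h1 -h2; congr pair; field.
Qed.

Lemma cplx_norm_is_norm :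
  is_norm (K := C_AbsRing) (V := cplx_ModuleSpace) cplx_norm.
Proof.
split.
- move=> z w; apply: (cplx_norm_spec _).2 => t.
  have -> : cplx_rot (plus z w) t = plus (cplx_rot z t) (cplx_rot w t).
    by rewrite /cplx_rot !scal_distr_l plus_interchange.
  apply: (Rle_trans _ _ _ (norm_triangle _ _)).
  by apply: Rplus_le_compat; exact: (cplx_norm_spec _).1.
- move=> c z; apply: (cplx_norm_spec _).2 => t.
  have [u hu] := C_polar c; set r := Cmod c in hu.
  have -> : cplx_rot (scal c z) t = scal r (cplx_rot z (t - u)).
    rewrite hu /cplx_rot /= /minus !scal_distr_l !scal_opp_r !scal_scalR.
    rewrite !opp_scalR plus_interchange !plus_scalR.
    by congr plus; apply: scal_congr; rewrite ?cos_minus ?sin_minus; ring.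
  apply: (Rle_trans _ _ _ (norm_scal _ _)).
  have -> : abs c = r by [].
  have r0 : 0 <= r := Cmod_ge_0 c.
  have -> : abs (r : R_AbsRing) = r by exact: Rabs_pos_eq.
  apply: Rmult_le_compat_l => //; exact: (cplx_norm_spec _).1.
- move=> z z0; apply: cplx_eq; apply: norm_eq_zero.
    by have := cplx_norm_re z; have := norm_ge_0 (cplx_re z); lra.
  by have := cplx_norm_im z; have := norm_ge_0 (cplx_im z); lra.
Qed.

Canonical cplx_UniformSpace :=
  UniformSpace.Pack (cplx X) (norm_UniformSpace_mixin cplx_norm_is_norm)
    (cplx X).
Canonical cplx_NormedModuleAux :=
  NormedModuleAux.Pack C_AbsRing (cplx X)
    (NormedModuleAux.Class C_AbsRing (cplx X)
      (ModuleSpace.class _ cplx_ModuleSpace)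
      (norm_UniformSpace_mixin cplx_norm_is_norm)) (cplx X).
Canonical cplx_NormedModule :=
  NormedModule.Pack C_AbsRing (cplx X)
    (NormedModule.Class C_AbsRing (cplx X)
      (NormedModuleAux.class _ cplx_NormedModuleAux)
      (norm_NormedModule_mixin cplx_norm_is_norm)) (cplx X).

Lemma cplx_complete : cauchy_complete cplx_UniformSpace.
Proof.
move=> F pF cF.
have hr : forall e : posreal, exists x0,
    F (fun z => norm (minus (cplx_re z) x0) < e).
  move=> e; have [z0 h] := cF e; exists (cplx_re z0).
  move: h; apply: filter_imp => z /=; apply: Rle_lt_trans.
  exact: (cplx_norm_re (minus z z0)).
have hi : forall e : posreal, exists x0,
    F (fun z => norm (minus (cplx_im z) x0) < e).
  move=> e; have [z0 h] := cF e; exists (cplx_im z0).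
  move: h; apply: filter_imp => z /=; apply: Rle_lt_trans.
  exact: (cplx_norm_im (minus z z0)).
have lr := cauchy_norm_lim pF hr; have li := cauchy_norm_lim pF hi.
set l1 := lim _ in lr; set l2 := lim _ in li.
exists (Cplx l1 l2) => e.
have fand P Q : F P -> F Q -> F (fun f => P f /\ Q f) by exact: filter_and.
have := fand _ _ (lr (pos_div_2 e)) (li (pos_div_2 e)).
apply: filter_imp => z [h1 h2].
apply: (Rle_lt_trans _ _ _ (cplx_norm_le (minus z (Cplx l1 l2)))).
have -> : pos e = pos_div_2 e + pos_div_2 e by rewrite /=; lra.
exact: Rplus_lt_compat.
Qed.

Canonical cplx_CompleteSpace :=
  CompleteSpace.Pack (cplx X)
    (CompleteSpace.Class _ _ (choose_CompleteSpace_mixin cplx_complete))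
    (cplx X).
Canonical cplx_CompleteNormedModule :=
  CompleteNormedModule.Pack C_AbsRing (cplx X)
    (CompleteNormedModule.Class C_AbsRing (cplx X)
      (NormedModule.class _ cplx_NormedModule)
      (choose_CompleteSpace_mixin cplx_complete)) (cplx X).

Implicit Types f : @bounded_op RealField X.

Definition cplx_op_fun f z : cplx X := Cplx (f (cplx_re z)) (f (cplx_im z)).

Lemma cplx_op_linear f :
  is_linear (K := C_AbsRing) (U := cplx_NormedModule) (V := cplx_NormedModule)
    (cplx_op_fun f).
Proof.
have lf := op_linear f.
have fZ (a : R) x : f (scal a x) = scal a (f x) by exact: linear_scal lf _ _.
split.
- by move=> z w; apply: cplx_eq; exact: (linear_plus _ lf).
- move=> [a b] z; apply: cplx_eq; rewrite /=.
    by rewrite (linear_minus _ _ _ lf) !fZ.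
  by rewrite (linear_plus _ lf) !fZ.
- have [M [M0 hM]] := linear_norm _ lf; exists M; split=> // z.
  apply: (cplx_norm_spec (cplx_op_fun f z)).2 => t.
  have -> : cplx_rot (cplx_op_fun f z) t = f (cplx_rot z t).
    by rewrite /cplx_rot /= (linear_plus _ lf) !fZ.
  apply: (Rle_trans _ _ _ (hM _)).
  apply: Rmult_le_compat_l; first exact: Rlt_le.
  exact: (cplx_norm_spec z).1.
Qed.

Definition cplx_op f : @bounded_op ComplexField cplx_CompleteNormedModule :=
  @Build_bounded_op ComplexField cplx_CompleteNormedModule (cplx_op_fun f)
    (cplx_op_linear f).
End Complexification.

Definition complexify (k : base_field) :
    CompleteNormedModule (scalars k) -> CompleteNormedModule C_AbsRing :=
  match k with
  | RealField => cplx_CompleteNormedModule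
  | ComplexField => fun X => X
  end.

Definition complexify_op (k : base_field) :
    forall X : CompleteNormedModule (scalars k),
      bounded_op X -> @bounded_op ComplexField (complexify X) :=
  match k with
  | RealField => fun X => @cplx_op X
  | ComplexField => fun X f => f
  end.

Definition real_ops (k : base_field) (X : CompleteNormedModule (scalars k)) :
    CompleteNormedModule R_AbsRing :=
  realify (bounded_op_CompleteNormedModule X).

Definition op_RInt (k : base_field) (X : CompleteNormedModule (scalars k))
    (phi : R -> bounded_op X) (s t : R) : bounded_op X :=
  @RInt (real_ops X) phi s t.

Definition real_op_scal (k : base_field)
    (X : CompleteNormedModule (scalars k)) (r : R) (f : bounded_op X) :
    bounded_op X :=
  @scal R_Ring (real_ops X) r f.

(** [iota] is total: this is the limit of the means when it exists. *)
Definition time_average (k : base_field)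
    (X : CompleteNormedModule (scalars k)) (phi : R -> bounded_op X) :
    bounded_op X :=
  @iota (CompleteNormedModule.CompleteSpace _ (real_ops X))
    (fun L => filterlim (fun tau => real_op_scal (/ tau) (op_RInt phi 0 tau))
                (Rbar_locally p_infty) (locally L)).

Definition sup_norm (k : base_field) (X : CompleteNormedModule (scalars k))
    (phi : R -> bounded_op X) : R :=
  real (Lub_Rbar (fun s => exists tau, 0 <= tau /\ s = norm (phi tau))).

(** Differentiability on the half-line [0, +oo): a two-sided derivative at
    [t > 0] and a right derivative at [t = 0]. *)
Definition is_derive_Rplus (V : NormedModule R_AbsRing) (f : R -> V) (t : R)
    (l : V) : Prop :=
  @filterdiff R_AbsRing R_NormedModule V f (within (Rle 0) (locally t))
    (fun s => scal s l).

Definition op_derive (k : base_field) (X : CompleteNormedModule (scalars k))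
    (phi : R -> bounded_op X) (t : R) : bounded_op X :=
  @iota (CompleteNormedModule.CompleteSpace _ (real_ops X))
    (fun L => @is_derive_Rplus (real_ops X) phi t L).

(** Functions on the torus are functions of ['I_r -> R] (with its sup
    uniform structure) that are [2 PI]-periodic in each variable. *)

Definition dot (r : nat) (alpha : 'I_r -> Z) (theta : 'I_r -> R) : R :=
  \big[Rplus/0]_(i < r) (IZR (alpha i) * theta i).

Definition l1_norm (r : nat) (alpha : 'I_r -> Z) : R :=
  \big[Rplus/0]_(i < r) Rabs (IZR (alpha i)).

(** The last clause is the normalization of the constants for [r = 1]. *)
Definition diophantine (r : nat) (omega : 'I_r -> R) (cD nu : R) : Prop :=
  [/\ 0 < cD,
      INR r - 1 <= nu,
      (forall alpha : 'I_r -> Z, (exists i, alpha i <> 0%Z) ->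
         cD / Rpower (l1_norm alpha) nu <= Rabs (dot alpha omega)) &
      (r = 1%N -> nu = 0 /\ forall i, cD = Rabs (omega i))].

Definition torus_cons (r : nat) (x : R) (theta : 'I_r -> R) : 'I_r.+1 -> R :=
  fun i => if unlift ord0 i is Some j then theta j else x.

Fixpoint torus_int (V : CompleteNormedModule R_AbsRing) (r : nat) :
    (('I_r -> R) -> V) -> V :=
  match r with
  | 0%N => fun f => f (fun _ => 0)
  | r'.+1 => fun f =>
      RInt (fun x => torus_int (fun theta : 'I_r' -> R => f (torus_cons x theta)))
        0 (2 * PI)
  end.

(** [(2 PI)^(-r)] times the integral of [exp (- i alpha.theta) phi theta],
    in the operators on the complexification of [X]. *)
Definition fourier_coef (k : base_field)
    (X : CompleteNormedModule (scalars k)) (r : nat)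
    (phi : ('I_r -> R) -> bounded_op X) (alpha : 'I_r -> Z) :
    @bounded_op ComplexField (complexify X) :=
  real_op_scal (/ (2 * PI) ^ r)
    (torus_int (V := @real_ops ComplexField (complexify X))
       (fun theta =>
          op_scal (k := ComplexField)
            ((cos (dot alpha theta), - sin (dot alpha theta)) : C)
            (complexify_op (phi theta)))).

(** Sum over [Z^r] of a nonnegative family: supremum of its finite sums. *)
Definition Zr_sum (r : nat) (f : ('I_r -> Z) -> R) : Rbar :=
  Lub_Rbar (fun s => exists l : list ('I_r -> Z),
    NoDup l /\ s = \big[Rplus/0]_(alpha <- l) f alpha).

Definition fourier_norm (k : base_field)
    (X : CompleteNormedModule (scalars k)) (r : nat) (kappa : R)
    (phi : ('I_r -> R) -> bounded_op X) : Rbar :=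
  Zr_sum (fun alpha =>
    exp (kappa * l1_norm alpha) * norm (fourier_coef phi alpha)).

Definition analytic_torus (k : base_field)
    (X : CompleteNormedModule (scalars k)) (r : nat) (kappa : R)
    (phi : ('I_r -> R) -> bounded_op X) : Prop :=
  [/\ (forall (theta : 'I_r -> R) (m : 'I_r -> Z),
         phi (fun i => theta i + 2 * PI * IZR (m i)) = phi theta),
      (forall theta : 'I_r -> R, continuous phi theta) &
      is_finite (fourier_norm kappa phi)].

Definition exp_norm (k : base_field) (X : CompleteNormedModule (scalars k))
    (phi : R -> bounded_op X) : Rbar :=
  Lub_Rbar (fun s => exists tau, 0 <= tau /\ s = exp tau * norm (phi tau)).

Definition exp_decaying (k : base_field)
    (X : CompleteNormedModule (scalars k)) (phi : R -> bounded_op X) : Prop :=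
  continuous_on (Rle 0) phi /\ is_finite (exp_norm phi).

Definition splits (k : base_field) (X : CompleteNormedModule (scalars k))
    (r : nat) (omega : 'I_r -> R) (kappa : R) (phi : R -> bounded_op X)
    (phis : ('I_r -> R) -> bounded_op X) (phib : R -> bounded_op X) : Prop :=
  [/\ analytic_torus kappa phis,
      exp_decaying phib &
      forall tau, 0 <= tau ->
        phi tau = plus (phis (fun i => omega i * tau)) (phib tau)].

Definition in_E (k : base_field) (X : CompleteNormedModule (scalars k))
    (r : nat) (omega : 'I_r -> R) (kappa : R) (phi : R -> bounded_op X) :
    Prop :=
  exists phis phib, splits omega kappa phi phis phib.

(** [N_kappa phi], for [phi] in [E_kappa]: by uniqueness of the splitting,
    it does not depend on the choice made by [epsilon]. *)
Definition N_norm (k : base_field) (X : CompleteNormedModule (scalars k))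
    (r : nat) (omega : 'I_r -> R) (kappa : R) (phi : R -> bounded_op X) : R :=
  epsilon (inhabits 0) (fun N => exists phis phib,
    splits omega kappa phi phis phib /\
    N = real (fourier_norm kappa phis) + real (exp_norm phib)).

Section Averaging.
Context (k : base_field) (X : CompleteNormedModule (scalars k)).
Context (a : R -> bounded_op X).

Definition Lambda (phi : R -> bounded_op X) (tau : R) : bounded_op X :=
  minus (op_comp (a tau) (phi tau))
    (op_comp (phi tau) (time_average (fun s => op_comp (a s) (phi s)))).

Fixpoint Phi (eps : R) (n : nat) : R -> bounded_op X :=
  match n with
  | 0%N => fun _ => op_id X
  | m.+1 => fun tau =>
      let L := Lambda (Phi eps m) in
      minus (plus (op_id X) (real_op_scal eps (op_RInt L 0 tau)))
        (real_op_scal eps (time_average (fun t => op_RInt L 0 t)))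
  end.

Definition macro_op (eps : R) (n : nat) : bounded_op X :=
  time_average (fun s => op_comp (a s) (Phi eps n s)).

Definition defect (eps : R) (n : nat) (tau : R) : bounded_op X :=
  minus (real_op_scal (/ eps) (op_derive (Phi eps n) tau))
    (minus (op_comp (a tau) (Phi eps n tau))
       (op_comp (Phi eps n tau) (macro_op eps n))).

Definition micro_macro (u0 : X) (eps : R) (n : nat) (v w : R -> X) : Prop :=
  [/\ (forall t, 0 <= t ->
         @is_derive_Rplus (realify X) v t (macro_op eps n (v t))),
      v 0 = op_inv (Phi eps n 0) u0,
      (forall t, 0 <= t ->
         @is_derive_Rplus (realify X) w t
           (minus (a (t / eps) (w t)) (defect eps n (t / eps) (v t)))) &
      w 0 = zero].
End Averaging.

Definition c_I (cD nu kappa : R) : R :=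
  if Req_EM_T nu 0 then Rmax 1 (/ cD)
  else Rmax 1 (/ cD * Rpower (nu / (kappa * exp 1)) nu).

Definition eps_threshold (cD nu mu M c : R) (n : nat) : R :=
  c / (c_I cD nu (mu / (INR n + 1)) * ((2 + c) * (1 + c)) * M).

(* Main.v *)
Require Import Defs.
From Stdlib Require Import Reals Lra Lia ZArith List.
From Stdlib Require Import FunctionalExtensionality ClassicalEpsilon.
From mathcomp Require Import ssreflect ssrfun ssrbool eqtype ssrnat seq choice.
From mathcomp Require Import fintype finfun bigop.
From Coquelicot Require Import Coquelicot.

(** Functions of time are decomposed as an absolutely convergent sum of modes
    [C exp (i (alpha.omega) tau)], with coefficients in the operators on the
    complexification, plus an exponentially decaying remainder. With the norm
    [N_kappa] they form a Banach algebra; integrating a function of zero average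
    divides the modes by [i (alpha.omega)], which by the Diophantine condition
    costs a factor [c_I delta] and a width [delta] in [kappa]. With
    [delta = mu / (n + 1)], the [n + 1] iterations from [id] to [Phi (n + 1)]
    stay in the algebra, and by induction [N (Phi m - id) <= c] and
    [N (Phi (m + 1) - Phi m) <= (eps / eps_n)^(m + 1) / 2]. Since the defect is,
    up to [1 / eps], the derivative of [Phi n - Phi (n + 1)], its integral is
    bounded by [(eps / eps_n)^(n + 1)]. Gronwall's inequality then bounds [v],
    and also [w], once the defect has been integrated by parts against [v].
    That [a] is the sum of its Fourier series follows from the uniqueness of
    Fourier coefficients of continuous vector-valued functions. *)

Set Implicit Arguments.
Unset Strict Implicit.
Unset Printing Implicit Defensive.

Local Open Scope R_scope.

(** * Linear identities and norms *)

(** The defect is a difference of [Lambda] at two consecutive iterates, hence only of order eps^n; a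
    direct Gronwall estimate of [w] would lose one power of eps. The missing power is in its
    primitive, which is why the bounds concern Phi n - Phi (n + 1), one iterate beyond those of the
    statement. The n + 1 integrations use up the width mu exactly, and at width 0 the norm still
    dominates the supremum, which is all that the last step requires. The constants come from
    [Lambda]: on functions of norm at most 1 + c its norm is at most M (1 + c) (2 + c), so eps c_I
    N_c M <= c keeps the iterates in the ball of radius c around id. The Lipschitz constant M (3 + 2
    c) is covered as well, since c (3 + 2 c) <= N_c. The factor 1/2 is there because an integral of
    the defect is a difference of two values of Phi n - Phi (n + 1). The equations live in operators
    on a possibly real space, whereas modes need the number i. So the estimates are made in the
    operators on the complexification, seen as a real Banach space with a map [J] for i, and are
    carried back along an isometry. *)

Section VectorIdentities.
Context (V : ModuleSpace R_Ring).

Inductive vexpr :=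
  | VAtom of nat
  | VZero
  | VPlus of vexpr & vexpr
  | VOpp of vexpr
  | VMinus of vexpr & vexpr
  | VScal of R & vexpr.

Fixpoint veval (env : list V) (e : vexpr) : V :=
  match e with
  | VAtom n => List.nth n env zero
  | VZero => zero
  | VPlus e1 e2 => plus (veval env e1) (veval env e2)
  | VOpp e1 => opp (veval env e1)
  | VMinus e1 e2 => minus (veval env e1) (veval env e2)
  | VScal r e1 => scal r (veval env e1)
  end.

Fixpoint vcoef (e : vexpr) (i : nat) : R :=
  match e with
  | VAtom n => if Nat.eqb n i then 1 else 0
  | VZero => 0
  | VPlus e1 e2 => vcoef e1 i + vcoef e2 i
  | VOpp e1 => - vcoef e1 i
  | VMinus e1 e2 => vcoef e1 i - vcoef e2 i
  | VScal r e1 => r * vcoef e1 i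
  end.

(** Normal form of the reflection: every expression evaluates to the combination of the atoms with
    its coefficient function as weights. *)
Fixpoint vsum (env : list V) (w : nat -> R) : V :=
  match env with
  | nil => zero
  | x :: env' => plus (scal (w 0%N) x) (vsum env' (fun i => w i.+1))
  end.

Lemma vsum_ext env w1 w2 : (forall i, w1 i = w2 i) -> vsum env w1 = vsum env w2.
Proof.
elim: env w1 w2 => //= x env IH w1 w2 h.
by rewrite h (IH _ (fun i => w2 i.+1)).
Qed.

Lemma vsum_zero env : vsum env (fun _ => 0) = zero.
Proof.
elim: env => //= x env ->; rewrite plus_zero_r; exact: (scal_zero_l x).
Qed.

Lemma vsum_plus env w1 w2 :
  vsum env (fun i => w1 i + w2 i) = plus (vsum env w1) (vsum env w2).
Proof.
elim: env w1 w2 => [|x env IH] w1 w2 /=; first by rewrite plus_zero_l.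
rewrite IH plus_interchange; congr plus.
exact: (scal_distr_r (w1 0%N) (w2 0%N) x).
Qed.

Lemma vsum_scal env r w :
  vsum env (fun i => r * w i) = scal r (vsum env w).
Proof.
elim: env w => [|x env IH] w /=; first by rewrite scal_zero_r.
rewrite IH scal_distr_l; congr plus.
exact: (esym (scal_assoc r (w 0%N) x)).
Qed.

Lemma vsum_opp env w : vsum env (fun i => - w i) = opp (vsum env w).
Proof.
rewrite -scal_opp_one -vsum_scal; apply: vsum_ext => i.
by rewrite /opp /one /=; ring.
Qed.

Lemma vsum_atom env n :
  vsum env (fun i => if Nat.eqb n i then 1 else 0) = List.nth n env zero.
Proof.
elim: env n => [|x env IH] [|n] //=.
  rewrite vsum_zero plus_zero_r; exact: (scal_one x).
by rewrite IH (scal_zero_l x) plus_zero_l.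
Qed.

Lemma veval_vsum env e : veval env e = vsum env (vcoef e).
Proof.
elim: e => [n||e1 IH1 e2 IH2|e1 IH1|e1 IH1 e2 IH2|r e1 IH1] /=.
- by rewrite vsum_atom.
- by rewrite vsum_zero.
- by rewrite vsum_plus IH1 IH2.
- by rewrite vsum_opp IH1.
- by rewrite (@vsum_plus _ _ (fun i => - vcoef e2 i)) vsum_opp IH1 IH2.
- by rewrite vsum_scal IH1.
Qed.

Lemma veval_eq env e1 e2 :
  (forall i, (i < size env)%coq_nat -> vcoef e1 i = vcoef e2 i) ->
  veval env e1 = veval env e2.
Proof.
move=> h; rewrite !veval_vsum; move: (vcoef e1) (vcoef e2) h.
elim: env => //= x env IH w1 w2 h.
rewrite h; last by lia.
congr plus; apply: IH => i hi; apply: h; lia.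
Qed.
End VectorIdentities.

Ltac vec_mem x env :=
  lazymatch env with
  | nil => false
  | x :: _ => true
  | _ :: ?e => vec_mem x e
  end.
Ltac vec_index x env :=
  lazymatch env with
  | x :: _ => constr:(0%nat)
  | _ :: ?e => let n := vec_index x e in constr:(S n)
  end.
Ltac vec_atoms V t env :=
  lazymatch t with
  | @plus _ ?x ?y => let e := vec_atoms V x env in vec_atoms V y e
  | @minus _ ?x ?y => let e := vec_atoms V x env in vec_atoms V y e
  | @opp _ ?x => vec_atoms V x env
  | @scal _ _ _ ?x => vec_atoms V x env
  | @zero _ => env
  | ?x => lazymatch vec_mem x env with
          | true => env
          | false => constr:(@cons V x env)
          end
  end.
Ltac vec_reify t env :=
  lazymatch t with
  | @plus _ ?x ?y =>
      let e := vec_reify x env in let f := vec_reify y env in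
      constr:(VPlus e f)
  | @minus _ ?x ?y =>
      let e := vec_reify x env in let f := vec_reify y env in
      constr:(VMinus e f)
  | @opp _ ?x => let e := vec_reify x env in constr:(VOpp e)
  | @scal _ _ ?r ?x => let e := vec_reify x env in constr:(VScal r e)
  | @zero _ => constr:(VZero)
  | ?x => let n := vec_index x env in constr:(VAtom n)
  end.
(** Proof by reflection of a linear identity in [V]: the real coefficients of
    each atom are compared by [ring], and those that it cannot equate are left. *)
Ltac vec_eq V :=
  lazymatch goal with
  | |- @eq _ ?x ?y =>
    let env := vec_atoms V x (@nil V) in
    let env := vec_atoms V y env in
    let e := vec_reify x env in
    let f := vec_reify y env in
    refine (@veval_eq V env e f _);
    let i := fresh "i" in let hi := fresh "hi" in
    intros i hi; cbn [size] in hi;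
    repeat (destruct i as [|i];
            [clear hi; cbn [vcoef Nat.eqb];
             try (rewrite ?/one ?/opp ?/plus ?/mult /=; ring) | try (exfalso; lia)])
  end.

(** [plus], [minus], ... on a complete normed module are reached through two
    convertible but syntactically distinct structures, which [lra] separates. *)
Ltac canon_struct :=
  repeat match goal with
  | H : context [CompleteNormedModule.AbelianGroup ?K ?V] |- _ =>
      progress change (CompleteNormedModule.AbelianGroup K V) with
        (NormedModule.AbelianGroup K (CompleteNormedModule.NormedModule K V)) in H
  | |- context [CompleteNormedModule.AbelianGroup ?K ?V] =>
      progress change (CompleteNormedModule.AbelianGroup K V) with
        (NormedModule.AbelianGroup K (CompleteNormedModule.NormedModule K V))
  | H : context [CompleteNormedModule.ModuleSpace ?K ?V] |- _ =>
      progress change (CompleteNormedModule.ModuleSpace K V) with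
        (NormedModule.ModuleSpace K (CompleteNormedModule.NormedModule K V)) in H
  | |- context [CompleteNormedModule.ModuleSpace ?K ?V] =>
      progress change (CompleteNormedModule.ModuleSpace K V) with
        (NormedModule.ModuleSpace K (CompleteNormedModule.NormedModule K V))
  end.
Ltac vlra := canon_struct; lra.

Section NormFacts.
Context (V : NormedModule R_AbsRing).
Implicit Types x y z : V.

Lemma norm_minusC x y : norm (minus x y) = norm (minus y x).
Proof. by rewrite -opp_minus norm_opp. Qed.

Lemma norm_minus_le x y : norm (minus x y) <= norm x + norm y.
Proof. by rewrite -(norm_opp y); exact: norm_triangle. Qed.

Lemma norm_dist_triangle z x y :
  norm (minus x y) <= norm (minus x z) + norm (minus z y).
Proof. by rewrite (minus_trans z); exact: norm_triangle. Qed.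

Lemma norm_rev_triangle x y : norm x - norm y <= norm (minus x y).
Proof.
have := norm_triangle (minus x y) y.
have -> : plus (minus x y) y = x by vec_eq V.
lra.
Qed.

Lemma norm_scal_le (r : R) x : norm (scal r x) <= Rabs r * norm x.
Proof. exact: norm_scal. Qed.

Lemma norm_small_eq0 x : (forall e, 0 < e -> norm x <= e) -> x = zero.
Proof.
move=> h; apply: norm_eq_zero.
have [hp|<- //] := Rle_lt_or_eq_dec _ _ (norm_ge_0 x).
by have := h (norm x / 2); lra.
Qed.

Lemma minus_eq0 x y : minus x y = zero -> x = y.
Proof.
move=> h; have -> : x = plus (minus x y) y by vec_eq V.
by rewrite h plus_zero_l.
Qed.

Lemma norm_close_eq x y : (forall e, 0 < e -> norm (minus x y) <= e) -> x = y.
Proof. by move=> h; apply: minus_eq0; exact: norm_small_eq0. Qed.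

Lemma filterlim_normP (T : Type) (F : (T -> Prop) -> Prop) {FF : Filter F}
    (f : T -> V) l :
  filterlim f F (locally l) <->
  (forall e, 0 < e -> F (fun t => norm (minus (f t) l) <= e)).
Proof.
split=> [h e e0|h P hP].
  have : locally l (fun y => norm (minus y l) <= e).
    apply: locally_le_locally_norm; exists (mkposreal e e0) => y hy.
    exact: Rlt_le.
  exact: h.
have [d hd] := locally_norm_le_locally _ _ hP.
rewrite /filtermap; apply: filter_imp (h (d / 2) (is_pos_div_2 d)) => t ht.
apply: hd; rewrite /ball_norm; have := cond_pos d; lra.
Qed.

Lemma continuous_normP (U : UniformSpace) (f : U -> V) (x : U) :
  continuous f x <->
  (forall e, 0 < e -> exists d : posreal, forall (y : U), ball x d y ->
     norm (minus (f y) (f x)) <= e).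
Proof. exact: filterlim_normP. Qed.
End NormFacts.

(** * Derivatives on the half-line *)

Section HalfLineDerivative.
Context (V : NormedModule R_AbsRing).
Implicit Types f g : R -> V.

Lemma is_derive_RplusP f t l : 0 <= t ->
  is_derive_Rplus f t l <->
  (forall e, 0 < e -> exists d, 0 < d /\ forall s, 0 <= s -> Rabs (s - t) < d ->
     norm (minus (minus (f s) (f t)) (scal (s - t) l)) <= e * Rabs (s - t)).
Proof.
move=> t0; split=> [[_ h] e e0|h].
  have ht : is_filter_lim (within (Rle 0) (locally t)) t.
    by move=> P; apply: filter_imp.
  have [d hd] := h t ht (mkposreal e e0).
  exists d; split=> [|s s0 hs]; first exact: cond_pos.
  exact: (hd s hs s0).
split; first exact: is_linear_scal_l.
move=> x hx e.
(* [filterdiff] quantifies over all limit points of the filter. For t >= 0 the only one is t: a ball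
   around x of half the distance to t would have to contain t. *)
have -> : x = t.
  apply: Rminus_diag_uniq; apply: Rabs_eq_0.
  have [hp|<- //] := Rle_lt_or_eq_dec _ _ (Rabs_pos (x - t)).
  have h2 : 0 < Rabs (x - t) / 2 by lra.
  have hB : locally x (fun y : R => Rabs (y - x) < Rabs (x - t) / 2).
    by exists (mkposreal _ h2).
  have [d hd] := hx _ hB.
  have := hd t (ball_center t d) t0.
  by rewrite (Rabs_minus_sym t x); lra.
have [d [d0 hd]] := h e (cond_pos e).
by exists (mkposreal d d0) => s hs s0; exact: (hd s s0 hs).
Qed.

Lemma is_derive_Rplus_unique f t l1 l2 : 0 <= t ->
  is_derive_Rplus f t l1 -> is_derive_Rplus f t l2 -> l1 = l2.
Proof.
move=> t0 /(is_derive_RplusP _ _ t0) h1 /(is_derive_RplusP _ _ t0) h2.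
apply: norm_close_eq => e e0.
have [d1 [d10 hd1]] := h1 (e / 2) ltac:(lra).
have [d2 [d20 hd2]] := h2 (e / 2) ltac:(lra).
(* The test point t + u lies to the right of t, so it is admissible on the half-line even for t =
   0. *)
set u := Rmin d1 d2 / 2.
have u0 : 0 < u by rewrite /u; have := Rmin_pos _ _ d10 d20; lra.
have u1 : u < d1 by have := Rmin_l d1 d2; rewrite /u in u0 *; lra.
have u2 : u < d2 by have := Rmin_r d1 d2; rewrite /u in u0 *; lra.
have hu : t + u - t = u by ring.
have := hd1 (t + u) ltac:(lra); have := hd2 (t + u) ltac:(lra).
rewrite hu (Rabs_pos_eq u); last lra.
move=> /(_ u2) b2 /(_ u1) b1.
set D := minus (f (t + u)) (f t) in b1 b2.
have : norm (scal u (minus l1 l2)) <= e * u.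
  have -> : scal u (minus l1 l2) = minus (minus D (scal u l2)) (minus D (scal u l1)).
    by vec_eq V.
  by apply: (Rle_trans _ _ _ (norm_minus_le _ _)); lra.
move=> b.
have -> : minus l1 l2 = scal (/ u) (scal u (minus l1 l2)).
  by vec_eq V; field; lra.
apply: (Rle_trans _ _ _ (norm_scal_le _ _)).
rewrite Rabs_pos_eq; last by apply/Rlt_le/Rinv_0_lt_compat.
apply: (Rmult_le_reg_l u) => //; rewrite -Rmult_assoc Rinv_r; lra.
Qed.

Lemma is_derive_Rplus_ext f g t l : 0 <= t -> (forall s, 0 <= s -> f s = g s) ->
  is_derive_Rplus f t l -> is_derive_Rplus g t l.
Proof.
move=> t0 hfg /(is_derive_RplusP _ _ t0) h; apply/(is_derive_RplusP _ _ t0) => e e0.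
have [d [d0 hd]] := h e e0; exists d; split=> // s s0 hs.
by rewrite -!hfg //; exact: hd.
Qed.

Lemma is_derive_is_derive_Rplus f t l : 0 <= t ->
  is_derive f t l -> is_derive_Rplus f t l.
Proof.
move=> t0 [_ h]; apply/(is_derive_RplusP _ _ t0) => e e0.
have [d hd] := h t (fun P hP => hP) (mkposreal e e0).
by exists d; split=> [|s s0 hs]; [exact: cond_pos | exact: (hd s hs)].
Qed.

Lemma is_derive_Rplus_plus f g t l m : 0 <= t ->
  is_derive_Rplus f t l -> is_derive_Rplus g t m ->
  is_derive_Rplus (fun s => plus (f s) (g s)) t (plus l m).
Proof.
move=> t0 /(is_derive_RplusP _ _ t0) h1 /(is_derive_RplusP _ _ t0) h2.
apply/(is_derive_RplusP _ _ t0) => e e0.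
have [d1 [d10 hd1]] := h1 (e / 2) ltac:(lra).
have [d2 [d20 hd2]] := h2 (e / 2) ltac:(lra).
exists (Rmin d1 d2); split=> [|s s0 hs]; first exact: Rmin_pos.
have {}hd1 := hd1 s s0 (Rlt_le_trans _ _ _ hs (Rmin_l _ _)).
have {}hd2 := hd2 s s0 (Rlt_le_trans _ _ _ hs (Rmin_r _ _)).
have -> : minus (minus (plus (f s) (g s)) (plus (f t) (g t))) (scal (s - t) (plus l m))
  = plus (minus (minus (f s) (f t)) (scal (s - t) l))
         (minus (minus (g s) (g t)) (scal (s - t) m)) by vec_eq V.
by apply: (Rle_trans _ _ _ (norm_triangle _ _)); lra.
Qed.

Lemma is_derive_Rplus_const (x : V) t : 0 <= t ->
  is_derive_Rplus (fun _ => x) t zero.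
Proof.
move=> t0; apply/(is_derive_RplusP _ _ t0) => e e0; exists 1; split=> [|s _ _].
  exact: Rlt_0_1.
have -> : minus (minus x x) (scal (s - t) zero) = zero by vec_eq V.
by rewrite norm_zero; apply: Rmult_le_pos; [lra | exact: Rabs_pos].
Qed.

Lemma is_derive_Rplus_scal f t l (r : R) : 0 <= t ->
  is_derive_Rplus f t l ->
  is_derive_Rplus (fun s => scal r (f s)) t (scal r l).
Proof.
move=> t0 /(is_derive_RplusP _ _ t0) h.
apply/(is_derive_RplusP _ _ t0) => e e0.
have r0 := Rabs_pos r.
have q0 : 0 < e / (1 + Rabs r) by apply: Rdiv_lt_0_compat; lra.
have [d [d0 hd]] := h _ q0.
exists d; split=> // s s0 hs.
have -> : minus (minus (scal r (f s)) (scal r (f t))) (scal (s - t) (scal r l))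
  = scal r (minus (minus (f s) (f t)) (scal (s - t) l)) by vec_eq V.
apply: (Rle_trans _ _ _ (norm_scal_le _ _)).
have := Rmult_le_compat_l _ _ _ r0 (hd s s0 hs).
move=> h1; apply: (Rle_trans _ _ _ h1).
have st := Rabs_pos (s - t).
rewrite -Rmult_assoc; apply: Rmult_le_compat_r => //.
apply: (Rmult_le_reg_r (1 + Rabs r)); first lra.
have -> : Rabs r * (e / (1 + Rabs r)) * (1 + Rabs r) = Rabs r * e by field; lra.
nra.
Qed.

Lemma is_derive_Rplus_comp_div f t l (r : R) : 0 <= t -> 0 < r ->
  is_derive_Rplus f (t / r) l ->
  is_derive_Rplus (fun s => f (s / r)) t (scal (/ r) l).
Proof.
move=> t0 r0.
have q0 : 0 <= t / r by apply: Rdiv_le_0_compat.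
move=> /(is_derive_RplusP _ _ q0) h.
apply/(is_derive_RplusP _ _ t0) => e e0.
have [d [d0 hd]] := h (e * r) ltac:(nra).
exists (d * r); split=> [|s s0 hs]; first nra.
have hq : Rabs (s / r - t / r) = Rabs (s - t) / r.
  have -> : s / r - t / r = (s - t) / r by field; lra.
  by rewrite Rabs_div; [rewrite (Rabs_pos_eq r); lra | lra].
have q1 : Rabs (s / r - t / r) < d.
  rewrite hq; apply: (Rmult_lt_reg_r r) => //.
  by have -> : Rabs (s - t) / r * r = Rabs (s - t) by field; lra.
have := hd (s / r) ltac:(by apply: Rdiv_le_0_compat) q1.
rewrite hq; have -> : e * r * (Rabs (s - t) / r) = e * Rabs (s - t) by field; lra.
congr (norm _ <= _).
by vec_eq V; field; lra.
Qed.

Lemma is_derive_Rplus_continuous f t l : 0 <= t ->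
  is_derive_Rplus f t l ->
  forall e, 0 < e -> exists d, 0 < d /\
    forall s, 0 <= s -> Rabs (s - t) < d -> norm (minus (f s) (f t)) <= e.
Proof.
move=> t0 /(is_derive_RplusP _ _ t0) h e e0.
have [d [d0 hd]] := h 1 Rlt_0_1.
have l0 := norm_ge_0 l.
have q0 : 0 < e / (1 + norm l) by apply: Rdiv_lt_0_compat; lra.
exists (Rmin d (e / (1 + norm l))); split=> [|s s0 hs]; first exact: Rmin_pos.
have h1 := hd s s0 (Rlt_le_trans _ _ _ hs (Rmin_l _ _)).
have h2 := Rlt_le_trans _ _ _ hs (Rmin_r _ _).
have -> : minus (f s) (f t) =
  plus (minus (minus (f s) (f t)) (scal (s - t) l)) (scal (s - t) l) by vec_eq V.
apply: (Rle_trans _ _ _ (norm_triangle _ _)).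
have := norm_scal_le (s - t) l.
have : Rabs (s - t) * (1 + norm l) <= e.
  have -> : e = e / (1 + norm l) * (1 + norm l) by field; lra.
  by apply: Rmult_le_compat_r; lra.
lra.
Qed.
End HalfLineDerivative.

Section BilinearDerivative.
Context (U V W : NormedModule R_AbsRing) (B : U -> V -> W).
Hypothesis Bl : forall x y z, B (plus x y) z = plus (B x z) (B y z).
Hypothesis Br : forall x y z, B x (plus y z) = plus (B x y) (B x z).
Hypothesis Bsl : forall (r : R) x y, B (scal r x) y = scal r (B x y).
Hypothesis Bsr : forall (r : R) x y, B x (scal r y) = scal r (B x y).
Hypothesis Bn : forall x y, norm (B x y) <= norm x * norm y.

Lemma bilinear_minus_l x y z : B (minus x y) z = minus (B x z) (B y z).
Proof. by rewrite /minus Bl -(scal_opp_one y) Bsl scal_opp_one. Qed.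

Lemma bilinear_minus_r x y z : B x (minus y z) = minus (B x y) (B x z).
Proof. by rewrite /minus Br -(scal_opp_one z) Bsr scal_opp_one. Qed.

Lemma is_derive_Rplus_bilinear f g t l m : 0 <= t ->
  is_derive_Rplus f t l -> is_derive_Rplus g t m ->
  is_derive_Rplus (fun s => B (f s) (g s)) t (plus (B l (g t)) (B (f t) m)).
Proof.
move=> t0 hf hg.
have cg := is_derive_Rplus_continuous t0 hg.
move: hf hg => /(is_derive_RplusP _ _ t0) h1 /(is_derive_RplusP _ _ t0) h2.
apply/(is_derive_RplusP _ _ t0) => e e0.
set K := 2 + norm (g t) + norm (f t) + norm l.
have g0 := norm_ge_0 (g t); have f0 := norm_ge_0 (f t); have l0 := norm_ge_0 l.
have K0 : 2 <= K by rewrite /K; lra.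
set q := e / 3 / K.
have q0 : 0 < q by apply: Rdiv_lt_0_compat; lra.
have qK : q * K = e / 3 by rewrite /q; field; lra.
have [d1 [d10 hd1]] := h1 q q0; have [d2 [d20 hd2]] := h2 q q0.
(* The bound q makes the cross term B l (g s - g t) small, and the bound 1 keeps the norm of g s
   below K - 1. *)
have m0 : 0 < Rmin q 1 by apply: Rmin_pos; lra.
have [d3 [d30 hd3]] := cg _ m0.
exists (Rmin d1 (Rmin d2 d3)); split=> [|s s0 hs].
  by apply: Rmin_pos => //; exact: Rmin_pos.
have a1 := Rmin_l d1 (Rmin d2 d3); have a2 := Rmin_r d1 (Rmin d2 d3).
have a3 := Rmin_l d2 d3; have a4 := Rmin_r d2 d3.
have {}hd1 := hd1 s s0 ltac:(lra); have {}hd2 := hd2 s s0 ltac:(lra).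
have {}hd3 := hd3 s s0 ltac:(lra).
have b1 := Rmin_l q 1; have b2 := Rmin_r q 1.
set D1 := minus (minus (f s) (f t)) (scal (s - t) l) in hd1.
set D2 := minus (minus (g s) (g t)) (scal (s - t) m) in hd2.
have -> : minus (minus (B (f s) (g s)) (B (f t) (g t)))
    (scal (s - t) (plus (B l (g t)) (B (f t) m))) =
  plus (plus (B D1 (g s)) (scal (s - t) (B l (minus (g s) (g t))))) (B (f t) D2).
  rewrite /D1 /D2 !(bilinear_minus_l, bilinear_minus_r, Bsl, Bsr).
  by vec_eq W.
have st := Rabs_pos (s - t).
have gs : norm (g s) <= K - 1.
  have -> : g s = plus (minus (g s) (g t)) (g t) by vec_eq V.
  by apply: (Rle_trans _ _ _ (norm_triangle _ _)); rewrite /K; lra.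
have third x y u v : 0 <= x -> 0 <= y -> x <= u -> y <= v -> x * y <= u * v.
  by move=> *; apply: Rmult_le_compat.
have e1 : norm (B D1 (g s)) <= e / 3 * Rabs (s - t).
  apply: (Rle_trans _ _ _ (Bn _ _)).
  apply: (Rle_trans _ (q * Rabs (s - t) * K)); last by rewrite -qK; lra.
  by apply: third; try exact: norm_ge_0; lra.
have e2 : norm (scal (s - t) (B l (minus (g s) (g t)))) <= e / 3 * Rabs (s - t).
  apply: (Rle_trans _ _ _ (norm_scal_le _ _)).
  rewrite Rmult_comm; apply: Rmult_le_compat_r => //.
  apply: (Rle_trans _ _ _ (Bn _ _)); rewrite -qK Rmult_comm.
  by apply: third; try exact: norm_ge_0; rewrite /K; lra.
have e3 : norm (B (f t) D2) <= e / 3 * Rabs (s - t).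
  apply: (Rle_trans _ _ _ (Bn _ _)).
  apply: (Rle_trans _ (K * (q * Rabs (s - t)))); last by rewrite -qK; lra.
  by apply: third; try exact: norm_ge_0; rewrite /K; lra.
apply: (Rle_trans _ _ _ (norm_triangle _ _)).
have := norm_triangle (B D1 (g s)) (scal (s - t) (B l (minus (g s) (g t)))).
lra.
Qed.
End BilinearDerivative.

(** Continuous induction: let m be the supremum of the t such that P holds on [0, t]. The closing
    hypothesis gives P m, and the opening one then passes beyond m, a contradiction. *)
Lemma real_induction (P : R -> Prop) :
  P 0 ->
  (forall t, 0 <= t -> (forall s, 0 <= s <= t -> P s) ->
     exists d, 0 < d /\ forall s, t < s < t + d -> P s) ->
  (forall t, 0 < t -> (forall s, 0 <= s < t -> P s) -> P t) ->
  forall t, 0 <= t -> P t.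
Proof.
move=> P0 Pright Pleft T T0; apply: NNPP => nPT.
pose E t := 0 <= t /\ forall s, 0 <= s <= t -> P s.
have E0 : E 0 by split=> [|s hs]; [lra | have -> : s = 0 by lra].
have Eb : is_upper_bound E T.
  move=> t [t0 ht]; apply: Rnot_lt_le => tT; apply: nPT; apply: ht; lra.
have [m [ub lub]] := completeness E (ex_intro _ T Eb) (ex_intro _ 0 E0).
have m0 : 0 <= m := ub 0 E0.
have below s : 0 <= s < m -> P s.
  move=> [s0 sm]; apply: NNPP => nPs.
  have : m <= s; last lra.
  apply: lub => t [t0 ht]; apply: Rnot_lt_le => st; apply: nPs; apply: ht; lra.
have Pm : P m.
  have [mp|<- //] := Rle_lt_or_eq_dec _ _ m0; exact: Pleft.
have upto s : 0 <= s <= m -> P s.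
  move=> [s0 sm]; have [sm'|-> //] := Rle_lt_or_eq_dec _ _ sm; exact: below.
have [d [d0 hd]] := Pright m m0 upto.
have : m + d / 2 <= m; last lra.
apply: ub; split=> [|s hs]; first lra.
have [sm|ms] := Rle_or_lt s m; [apply: upto | apply: hd]; lra.
Qed.

Section MeanValue.
Context (V : NormedModule R_AbsRing).

(** There is no intermediate point for a vector-valued f. Instead the inequality with slack e t is
    propagated by real induction: near each t, differentiability gives it with an error at most e |s
    - t|, and e is then sent to 0. *)
Lemma mean_value_Rplus (f f' : R -> V) (g g' : R -> R) :
  (forall t, 0 <= t -> is_derive_Rplus f t (f' t)) ->
  (forall t, 0 <= t -> is_derive_Rplus (V := R_NormedModule) g t (g' t)) ->
  (forall t, 0 <= t -> norm (f' t) <= g' t) ->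
  forall t, 0 <= t -> norm (minus (f t) (f 0)) <= g t - g 0.
Proof.
move=> df dg le_fg T T0.
apply: le_epsilon => e e0.
(* Dividing the slack by 1 + T rather than T avoids a separate case T = 0. *)
have [T1 hT1] : exists T1, T1 = 1 + T by exists (1 + T).
have {}e0 : 0 < e / T1 by apply: Rdiv_lt_0_compat; lra.
suff : norm (minus (f T) (f 0)) <= g T - g 0 + e / T1 * T.
  move=> h; apply: (Rle_trans _ _ _ h); apply: Rplus_le_compat_l.
  have {2}-> : e = e / T1 * T1 by field; lra.
  by apply: Rmult_le_compat_l; lra.
move: (e / T1) e0 => {}e e0.
have step t : 0 <= t -> exists d, 0 < d /\ forall s, 0 <= s -> Rabs (s - t) < d ->
    norm (minus (f s) (f t)) <= Rabs (s - t) * (norm (f' t) + e / 2) /\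
    Rabs (g s - g t - (s - t) * g' t) <= e / 2 * Rabs (s - t).
  move=> t0.
  have [d1 [d10 hd1]] := (is_derive_RplusP _ _ t0).1 (df t t0) (e / 2) ltac:(lra).
  have [d2 [d20 hd2]] := (is_derive_RplusP _ _ t0).1 (dg t t0) (e / 2) ltac:(lra).
  exists (Rmin d1 d2); split=> [|s s0 hs]; first exact: Rmin_pos.
  have {}hd1 := hd1 s s0 (Rlt_le_trans _ _ _ hs (Rmin_l _ _)).
  have {}hd2 := hd2 s s0 (Rlt_le_trans _ _ _ hs (Rmin_r _ _)).
  split; last exact: hd2.
  have -> : minus (f s) (f t) =
    plus (minus (minus (f s) (f t)) (scal (s - t) (f' t))) (scal (s - t) (f' t)).
    by vec_eq V.
  apply: (Rle_trans _ _ _ (norm_triangle _ _)).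
  have := norm_scal_le (s - t) (f' t); lra.
apply: (real_induction (P := fun t => norm (minus (f t) (f 0)) <= g t - g 0 + e * t))
  T0.
- by rewrite minus_eq_zero norm_zero; lra.
- move=> t t0 ht; have [d [d0 hd]] := step t t0; exists d; split=> // s hs.
  have ha : Rabs (s - t) = s - t by apply: Rabs_pos_eq; lra.
  have [h1 h2] := hd s ltac:(lra) ltac:(lra).
  rewrite ha in h1 h2; have h3 := (Rabs_le_between _ _).1 h2.
  have h4 := ht t ltac:(lra); have h5 := le_fg t t0.
  have := norm_dist_triangle (f t) (f s) (f 0).
  have : (s - t) * norm (f' t) <= (s - t) * g' t by apply: Rmult_le_compat_l; lra.
  lra.
- move=> t tp ht; have t0 : 0 <= t by lra.
  have [d [d0 hd]] := step t t0.
  have [s hs] : exists s, 0 <= s < t /\ t - d < s.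
    exists (Rmax 0 (t - d / 2)); have := Rmax_l 0 (t - d / 2).
    have := Rmax_r 0 (t - d / 2).
    have : Rmax 0 (t - d / 2) < t by apply: Rmax_lub_lt; lra.
    lra.
  have ha : Rabs (s - t) = t - s by rewrite Rabs_minus_sym; apply: Rabs_pos_eq; lra.
  have [h1 h2] := hd s ltac:(lra) ltac:(lra).
  rewrite ha in h1 h2; have h3 := (Rabs_le_between _ _).1 h2.
  have h4 := ht s ltac:(lra); have h5 := le_fg t t0.
  have := norm_dist_triangle (f s) (f t) (f 0); rewrite (norm_minusC (f t) (f s)).
  have : (t - s) * norm (f' t) <= (t - s) * g' t by apply: Rmult_le_compat_l; lra.
  lra.
Qed.
End MeanValue.

(** * Continuity, integration and Gronwall's inequality on the half-line *)

Section HalfLineContinuity.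
Context (V : NormedModule R_AbsRing).
Implicit Types f g : R -> V.

(** Continuity on [0, +oo), expressed through the retraction [Rmax 0]. *)
Definition continuous_Rplus f := forall x : R, continuous (fun t => f (Rmax 0 t)) x.

Lemma Rmax0_lipschitz s t : Rabs (Rmax 0 s - Rmax 0 t) <= Rabs (s - t).
Proof.
rewrite /Rmax; case: Rle_dec => hs; case: Rle_dec => ht;
  rewrite /Rabs; repeat (case: Rcase_abs => ?); lra.
Qed.

Lemma continuous_RplusP f :
  continuous_Rplus f <->
  (forall t e, 0 <= t -> 0 < e -> exists d, 0 < d /\
    forall s, 0 <= s -> Rabs (s - t) < d -> norm (minus (f s) (f t)) <= e).
Proof.
split=> [h t e t0 e0|h x].
  have [d hd] := (continuous_normP _ _).1 (h t) e e0.
  exists d; split=> [|s s0 hs]; first exact: cond_pos.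
  by have := hd s hs; rewrite !Rmax_right.
apply/continuous_normP => e e0.
have [d [d0 hd]] := h (Rmax 0 x) e (Rmax_l _ _) e0.
exists (mkposreal d d0) => y hy; apply: hd; first exact: Rmax_l.
apply: Rle_lt_trans hy; exact: Rmax0_lipschitz.
Qed.

Lemma continuous_on_Rplus f :
  continuous_on (Rle 0) f -> continuous_Rplus f.
Proof.
move=> h; apply/continuous_RplusP => t e t0 e0.
have [d hd] := (filterlim_normP _ _).1 (h t t0) e e0.
by exists d; split=> [|s s0 hs]; [exact: cond_pos | exact: (hd s hs s0)].
Qed.

Lemma continuous_Rplus_continuous f :
  (forall x : R, continuous f x) -> continuous_Rplus f.
Proof.
move=> h; apply/continuous_RplusP => t e t0 e0.
have [d hd] := (continuous_normP _ _).1 (h t) e e0.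
by exists d; split=> [|s s0 hs]; [exact: cond_pos | exact: (hd s hs)].
Qed.

Lemma continuous_Rplus_ext f g : (forall t, 0 <= t -> f t = g t) ->
  continuous_Rplus f -> continuous_Rplus g.
Proof.
move=> fg h x; apply: (continuous_ext _ _ _ _ (h x)) => t.
by apply: fg; exact: Rmax_l.
Qed.

Lemma continuous_Rplus_const (c : V) : continuous_Rplus (fun _ => c).
Proof. by move=> x; exact: continuous_const. Qed.

Lemma continuous_Rplus_plus f g :
  continuous_Rplus f -> continuous_Rplus g ->
  continuous_Rplus (fun t => plus (f t) (g t)).
Proof. by move=> hf hg x; exact: (continuous_plus _ _ _ (hf x) (hg x)). Qed.

Lemma continuous_Rplus_minus f g :
  continuous_Rplus f -> continuous_Rplus g ->
  continuous_Rplus (fun t => minus (f t) (g t)).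
Proof. by move=> hf hg x; exact: (continuous_minus _ _ _ (hf x) (hg x)). Qed.

Lemma derivable_continuous_Rplus f (f' : R -> V) :
  (forall t, 0 <= t -> is_derive_Rplus f t (f' t)) -> continuous_Rplus f.
Proof.
move=> h; apply/continuous_RplusP => t e t0.
exact: (is_derive_Rplus_continuous t0 (h t t0)).
Qed.

Lemma continuous_Rplus_norm f : continuous_Rplus f ->
  forall x : R, continuous (fun t => norm (f (Rmax 0 t))) x.
Proof. by move=> h x; apply: continuous_comp (h x) (filterlim_norm _). Qed.
End HalfLineContinuity.

Section BilinearContinuity.
Context (U V W : NormedModule R_AbsRing) (B : U -> V -> W).
Hypothesis Bl : forall x y z, B (plus x y) z = plus (B x z) (B y z).
Hypothesis Br : forall x y z, B x (plus y z) = plus (B x y) (B x z).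
Hypothesis Bsl : forall (r : R) x y, B (scal r x) y = scal r (B x y).
Hypothesis Bsr : forall (r : R) x y, B x (scal r y) = scal r (B x y).
Hypothesis Bn : forall x y, norm (B x y) <= norm x * norm y.

Lemma filterlim_bilinear (T : Type) (F : (T -> Prop) -> Prop) {FF : Filter F}
    (f : T -> U) (g : T -> V) x y :
  filterlim f F (locally x) -> filterlim g F (locally y) ->
  filterlim (fun t => B (f t) (g t)) F (locally (B x y)).
Proof.
move=> /filterlim_normP hf /filterlim_normP hg; apply/filterlim_normP => e e0.
set K := 2 + norm x + norm y.
have x0 := norm_ge_0 x; have y0 := norm_ge_0 y.
have K0 : 0 < K by rewrite /K; lra.
have q0 : 0 < e / 2 / K by apply: Rdiv_lt_0_compat; lra.
have qK : e / 2 / K * K = e / 2 by field; lra.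
have m0 : 0 < Rmin (e / 2 / K) 1 by apply: Rmin_pos; lra.
have b1 := Rmin_l (e / 2 / K) 1; have b2 := Rmin_r (e / 2 / K) 1.
apply: (filter_imp _ _ _ (filter_and _ _ (hf _ m0) (hg _ m0))) => t [h1 h2].
have -> : minus (B (f t) (g t)) (B x y) =
    plus (B (minus (f t) x) (g t)) (B x (minus (g t) y)).
  rewrite (bilinear_minus_l Bl Bsl) (bilinear_minus_r Br Bsr).
  by vec_eq W.
have gt : norm (g t) <= K - 1 - norm x.
  have -> : g t = plus (minus (g t) y) y by vec_eq V.
  by apply: (Rle_trans _ _ _ (norm_triangle _ _)); rewrite /K; lra.
apply: (Rle_trans _ _ _ (norm_triangle _ _)).
have e1 : norm (B (minus (f t) x) (g t)) <= e / 2 / K * (K - 1 - norm x).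
  apply: (Rle_trans _ _ _ (Bn _ _)).
  by apply: Rmult_le_compat; try exact: norm_ge_0; lra.
have e2 : norm (B x (minus (g t) y)) <= norm x * (e / 2 / K).
  apply: (Rle_trans _ _ _ (Bn _ _)).
  by apply: Rmult_le_compat; try exact: norm_ge_0; lra.
nra.
Qed.

Lemma continuous_Rplus_bilinear f g :
  continuous_Rplus f -> continuous_Rplus g ->
  continuous_Rplus (fun t => B (f t) (g t)).
Proof. by move=> hf hg x; exact: (filterlim_bilinear (hf x) (hg x)). Qed.
End BilinearContinuity.

Section HalfLineIntegral.
Context (V : CompleteNormedModule R_AbsRing).
Implicit Types f g : R -> V.

Lemma ex_RInt_Rplus f s t : continuous_Rplus f -> 0 <= s -> 0 <= t ->
  ex_RInt f s t.
Proof.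
move=> cf s0 t0.
apply: (ex_RInt_ext (fun u => f (Rmax 0 u))) => [u hu|].
  rewrite Rmax_right //; have := Rmin_glb _ _ _ s0 t0; lra.
by apply: ex_RInt_continuous => u _; exact: cf.
Qed.

(** The extension of f by f 0 to the left of 0 is continuous on the whole line, so the two-sided
    fundamental theorem applies to it and restricts to the half-line. *)
Lemma RInt_Rplus_derive f t : continuous_Rplus f -> 0 <= t ->
  is_derive_Rplus (fun u => RInt f 0 u) t (f t).
Proof.
move=> cf t0.
have : is_derive_Rplus (fun u => RInt (fun s => f (Rmax 0 s)) 0 u) t (f (Rmax 0 t)).
  apply: is_derive_is_derive_Rplus => //.
  apply: (is_derive_RInt (fun s => f (Rmax 0 s)) _ 0); last exact: cf.
  apply: filter_forall => u; apply: RInt_correct.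
  by apply: ex_RInt_continuous => v _; exact: cf.
rewrite Rmax_right //; apply: is_derive_Rplus_ext => // s s0.
apply: RInt_ext => u; rewrite Rmin_left // Rmax_right // => hu.
rewrite Rmax_right //; lra.
Qed.

(** Since F has only a one-sided derivative at 0, the argument goes through the mean value
    inequality with g = 0: the integral minus F has derivative zero, so it is constant. *)
Lemma RInt_Rplus_primitive (F f : R -> V) : continuous_Rplus f ->
  (forall t, 0 <= t -> is_derive_Rplus F t (f t)) ->
  forall t, 0 <= t -> RInt f 0 t = minus (F t) (F 0).
Proof.
move=> cf dF t t0.
have d0 s : 0 <= s -> is_derive_Rplus
    (fun u => plus (RInt f 0 u) (scal (-1) (F u))) s zero.
  move=> s0; have -> : zero = plus (f s) (scal (-1) (f s)) by vec_eq V.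
  apply: is_derive_Rplus_plus => //; first exact: RInt_Rplus_derive.
  by apply: is_derive_Rplus_scal => //; exact: dF.
have := mean_value_Rplus (g := fun _ => 0) (g' := fun _ => 0) d0
  (fun s s0 => is_derive_Rplus_const (V := R_NormedModule) 0 s0)
  (fun s s0 => ltac:(rewrite norm_zero; lra)) t0.
rewrite RInt_point Rminus_diag => h.
apply: minus_eq0; apply: norm_eq_zero; apply: Rle_antisym; last exact: norm_ge_0.
apply: Rle_trans h; apply: Req_le; congr norm.
by vec_eq V.
Qed.

Lemma norm_RInt_Rplus_le f (g : R -> R) s t lg : continuous_Rplus f ->
  0 <= s <= t -> (forall u, 0 <= u -> norm (f u) <= g u) ->
  is_RInt g s t lg -> norm (RInt f s t) <= lg.
Proof.
move=> cf st fg hg; apply: (norm_RInt_le f g s t) hg; first lra.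
  by move=> u hu; apply: fg; lra.
by apply: RInt_correct; apply: ex_RInt_Rplus => //; lra.
Qed.

Lemma norm_RInt_Rplus_le_const f M t : continuous_Rplus f -> 0 <= t ->
  (forall u, 0 <= u -> norm (f u) <= M) -> norm (RInt f 0 t) <= t * M.
Proof.
move=> cf t0 fM; apply: (norm_RInt_Rplus_le cf _ fM); first lra.
have := @is_RInt_const R_NormedModule 0 t M.
by rewrite Rminus_0_r.
Qed.
End HalfLineIntegral.

Section Gronwall.
Lemma gronwall (y : R -> R) (K F T : R) :
  0 <= K -> (forall x : R, continuous y x) -> 0 <= T ->
  (forall t, 0 <= t <= T -> y t <= F + K * RInt y 0 t) ->
  y T <= F * exp (K * T).
Proof.
move=> K0 cy T0 hy.
have dY t : is_derive (fun u => RInt y 0 u) t (y t).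
  apply: (is_derive_RInt y _ 0) => //.
  apply: filter_forall => u; apply: RInt_correct.
  by apply: ex_RInt_continuous => v _; exact: cy.
(* [h] does not increase on [0, T]: by hypothesis y is at most F + K RInt y 0 t there, so [dh] is
   nonpositive. *)
set h := fun t => (F + K * RInt y 0 t) * exp (- (K * t)).
set dh := fun t => K * (y t - (F + K * RInt y 0 t)) * exp (- (K * t)).
have dH t : is_derive h t (dh t).
  rewrite /h /dh.
  evar_last.
    apply: is_derive_mult; last by move=> ? ?; exact: Rmult_comm.
      apply: is_derive_plus; first exact: is_derive_const.
      apply: is_derive_scal; exact: dY.
    apply: (is_derive_comp exp (fun t => - (K * t))); first exact: is_derive_exp.
    by auto_derive.
  by rewrite /plus /mult /zero /scal /= /mult /=; ring.
have [c [hc e]] := MVT_gen h 0 T dh (fun x _ => dH x)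
  (fun x _ => derivable_continuous_pt _ _ (exist _ (dh x) ((is_derive_Reals _ _ _).1 (dH x)))).
rewrite Rmin_left // Rmax_right // in hc.
have : dh c * (T - 0) <= 0.
  have := hy c hc; have := exp_pos (- (K * c)); rewrite /dh => e0 h1.
  have : K * (y c - (F + K * RInt y 0 c)) <= 0 by nra.
  move=> h2; have : K * (y c - (F + K * RInt y 0 c)) * exp (- (K * c)) <= 0 by nra.
  move: (K * (y c - (F + K * RInt y 0 c)) * exp (- (K * c))) => q; nra.
rewrite -e /h RInt_point Rmult_0_r Ropp_0 exp_0 => le_h.
apply: (Rle_trans _ _ _ (hy T ltac:(lra))).
have hF : (F + K * RInt y 0 T) * exp (- (K * T)) <= F.
  lra.
have -> : F + K * RInt y 0 T = (F + K * RInt y 0 T) * exp (- (K * T)) * exp (K * T).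
  by rewrite Rmult_assoc -exp_plus Rplus_opp_l exp_0; ring.
by apply: Rmult_le_compat_r hF; exact/Rlt_le/exp_pos.
Qed.
End Gronwall.

(** * Time averages and complex structures *)

Section TimeAverages.
Context (V : CompleteNormedModule R_AbsRing).
Implicit Types f g : R -> V.

Definition mean f (tau : R) : V := scal (/ tau) (RInt f 0 tau).

Definition has_average f (L : V) :=
  filterlim (mean f) (Rbar_locally p_infty) (locally L).

Lemma eventually_pos (P : R -> Prop) :
  (forall x, 0 < x -> P x) -> Rbar_locally p_infty P.
Proof. by move=> h; exists 0. Qed.

Lemma has_average_unique f L1 L2 :
  has_average f L1 -> has_average f L2 -> L1 = L2.
Proof. by move=> h1 h2; apply: (filterlim_locally_unique (mean f) L1 L2 h1 h2). Qed.

Lemma has_average_ext f g L : (forall t, 0 <= t -> f t = g t) ->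
  has_average f L -> has_average g L.
Proof.
move=> fg; apply: filterlim_ext_loc; apply: eventually_pos => x x0.
rewrite /mean; congr scal; apply: RInt_ext => t.
by rewrite Rmin_left ?Rmax_right; try lra; move=> ht; apply: fg; lra.
Qed.

Lemma has_average_plus f g L1 L2 : continuous_Rplus f -> continuous_Rplus g ->
  has_average f L1 -> has_average g L2 ->
  has_average (fun t => plus (f t) (g t)) (plus L1 L2).
Proof.
move=> cf cg hf hg.
apply: (filterlim_ext_loc (fun x => plus (mean f x) (mean g x))).
  apply: eventually_pos => x x0; rewrite /mean RInt_plus ?scal_distr_l //;
    by apply: ex_RInt_Rplus => //; lra.
exact: (filterlim_comp_2 _ _ plus hf hg (filterlim_plus _ _)).
Qed.

Lemma has_average_const (c : V) : has_average (fun _ => c) c.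
Proof.
apply: (filterlim_ext_loc (fun _ => c)); last exact: filterlim_const.
apply: eventually_pos => x x0; rewrite /mean RInt_const.
by vec_eq V; field; lra.
Qed.

Lemma norm_mean_le f M x : continuous_Rplus f -> 0 < x ->
  (forall t, 0 <= t -> norm (f t) <= M) -> norm (mean f x) <= M.
Proof.
move=> cf x0 fM; apply: (Rle_trans _ _ _ (norm_scal_le _ _)).
have ix := Rinv_0_lt_compat _ x0.
rewrite Rabs_pos_eq; last lra.
apply: (Rmult_le_reg_l x) => //.
rewrite -Rmult_assoc Rinv_r; last lra.
rewrite Rmult_1_l; apply: norm_RInt_Rplus_le_const => //; lra.
Qed.

Lemma norm_average_le f M L : continuous_Rplus f ->
  (forall t, 0 <= t -> norm (f t) <= M) -> has_average f L -> norm L <= M.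
Proof.
move=> cf fM /filterlim_normP hL; apply: le_epsilon => e e0.
have [B hB] := hL e e0.
have x0 : 0 < Rmax 0 B + 1 by have := Rmax_l 0 B; lra.
have h1 := hB (Rmax 0 B + 1) ltac:(have := Rmax_r 0 B; lra).
move: (Rmax 0 B + 1) x0 h1 => x x0 h1.
have := norm_mean_le cf x0 fM; have := norm_rev_triangle L (mean f x).
by rewrite norm_minusC; lra.
Qed.

Lemma mean_minus f g x : continuous_Rplus f -> continuous_Rplus g -> 0 < x ->
  mean (fun t => minus (f t) (g t)) x = minus (mean f x) (mean g x).
Proof.
move=> cf cg x0; rewrite /mean RInt_minus; try by apply: ex_RInt_Rplus => //; lra.
by vec_eq V.
Qed.

(** The mean over [0, x] of a function with bounded primitive is O(1/x). *)
Lemma has_average_bounded_primitive f (F : R -> V) M : continuous_Rplus f ->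
  (forall t, 0 <= t -> RInt f 0 t = minus (F t) (F 0)) ->
  (forall t, 0 <= t -> norm (F t) <= M) -> has_average f zero.
Proof.
move=> cf hF FM; apply/filterlim_normP => e e0.
have M0 : 0 <= M := Rle_trans _ _ _ (norm_ge_0 _) (FM 0 (Rle_refl 0)).
exists (2 * M / e) => x hx.
have x0 : 0 < x by apply: Rle_lt_trans hx; apply: Rdiv_le_0_compat; lra.
have xe : 2 * M <= x * e.
  have -> : 2 * M = 2 * M / e * e by field; lra.
  by apply: Rmult_le_compat_r; lra.
rewrite minus_zero_r /mean hF; last lra.
apply: (Rle_trans _ _ _ (norm_scal_le _ _)).
have ix := Rinv_0_lt_compat _ x0.
rewrite Rabs_pos_eq; last lra.
have := norm_minus_le (F x) (F 0).
have := FM x ltac:(lra); have := FM 0 (Rle_refl 0) => h1 h2 h3.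
apply: (Rmult_le_reg_l x) => //; rewrite -Rmult_assoc Rinv_r; [|lra]. vlra.
Qed.

(** Taking means does not increase uniform distances, so the means of f inherit the Cauchy property
    at infinity from those of the approximants; completeness gives the limit. *)
Lemma has_average_uniform_limit f :
  continuous_Rplus f ->
  (forall e, 0 < e -> exists g L, [/\ continuous_Rplus g, has_average g L &
     forall t, 0 <= t -> norm (minus (f t) (g t)) <= e]) ->
  exists L, has_average f L.
Proof.
move=> cf h.
apply/(filterlim_locally_cauchy (F := Rbar_locally p_infty) (mean f)) => e.
have e0 := cond_pos e.
have [g [L [cg /filterlim_normP hL fg]]] := h (e / 8) ltac:(lra).
exists (fun x => 0 < x /\ norm (minus (mean g x) L) <= e / 8); split.
  apply: filter_and; first exact: eventually_pos.
  by apply: hL; lra.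
have near x : 0 < x -> norm (minus (mean f x) (mean g x)) <= e / 8.
  move=> x0; rewrite -mean_minus //; apply: norm_mean_le => //.
  exact: continuous_Rplus_minus.
move=> u v [u0 hu] [v0 hv]; apply: norm_compat1.
have := near u u0; have := near v v0 => h1 h2.
have := norm_dist_triangle (mean g v) (mean f v) (mean f u).
have := norm_dist_triangle L (mean g v) (mean f u).
have := norm_dist_triangle (mean g u) L (mean f u).
rewrite (norm_minusC L (mean g u)) (norm_minusC (mean g u) (mean f u)); vlra.
Qed.

Lemma has_average_minus f g L1 L2 : continuous_Rplus f -> continuous_Rplus g ->
  has_average f L1 -> has_average g L2 ->
  has_average (fun t => minus (f t) (g t)) (minus L1 L2).
Proof.
move=> cf cg hf hg.
apply: (filterlim_ext_loc (fun x => minus (mean f x) (mean g x))).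
  by apply: eventually_pos => x x0; rewrite mean_minus.
apply: (filterlim_comp_2 _ _ (fun x y => plus x (opp y)) hf hg).
apply: (filterlim_comp_2 _ _ plus); last exact: filterlim_plus.
  exact: filterlim_fst.
apply: filterlim_comp filterlim_snd _; exact: filterlim_opp.
Qed.

Lemma has_average_scal f L (c : R) : continuous_Rplus f -> has_average f L ->
  has_average (fun t => scal c (f t)) (scal c L).
Proof.
move=> cf hf; apply: (filterlim_ext_loc (fun x => scal c (mean f x))).
  apply: eventually_pos => x x0; rewrite /mean RInt_scal; first by vec_eq V.
  by apply: ex_RInt_Rplus => //; lra.
exact: (filterlim_comp _ _ _ _ _ _ _ _ hf (filterlim_scal_r c L)).
Qed.

Lemma average_dist_le f g e L1 L2 :
  continuous_Rplus f -> continuous_Rplus g ->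
  has_average f L1 -> has_average g L2 ->
  (forall t, 0 <= t -> norm (minus (f t) (g t)) <= e) ->
  norm (minus L1 L2) <= e.
Proof.
move=> cf cg hf hg fg.
apply: (norm_average_le (continuous_Rplus_minus cf cg) fg).
exact: has_average_minus.
Qed.
End TimeAverages.

Lemma continuous_uniform_limit (U : UniformSpace) (V : NormedModule R_AbsRing)
    (f : U -> V) (x : U) :
  (forall e, 0 < e -> exists2 g : U -> V, continuous g x &
     forall y, norm (minus (f y) (g y)) <= e) ->
  continuous f x.
Proof.
move=> h; apply/continuous_normP => e e0.
have [g /continuous_normP cg fg] := h (e / 3) ltac:(lra).
have [d hd] := cg (e / 3) ltac:(lra); exists d => y hy.
have := hd y hy; have := fg x; have := fg y => h1 h2 h3.
have := norm_dist_triangle (g y) (f y) (f x).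
have := norm_dist_triangle (g x) (g y) (f x).
rewrite (norm_minusC (g x)); lra.
Qed.

(** Complex scalars are reduced to one real-linear map J, multiplication by i, so that limits,
    integrals and derivatives are all taken in a real Banach space. The last field says that
    unimodular factors do not increase the norm. *)
Record complex_structure (V : NormedModule R_AbsRing) (J : V -> V) : Prop := {
  J_plus : forall x y, J (plus x y) = plus (J x) (J y);
  J_scal : forall (r : R) x, J (scal r x) = scal r (J x);
  J_J : forall x, J (J x) = opp x;
  J_phase_le : forall t x, norm (plus (scal (cos t) x) (scal (sin t) (J x))) <= norm x }.

Section Rotation.
Context (V : NormedModule R_AbsRing) (J : V -> V).
Hypothesis hJ : complex_structure J.

(** Multiplication by [exp (i t)]. *)
Definition phase (t : R) (x : V) : V := plus (scal (cos t) x) (scal (sin t) (J x)).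

Lemma phase_plus t x y : phase t (plus x y) = plus (phase t x) (phase t y).
Proof. by rewrite /phase (J_plus hJ); vec_eq V. Qed.

Lemma phase_scal t (r : R) x : phase t (scal r x) = scal r (phase t x).
Proof. by rewrite /phase (J_scal hJ); vec_eq V. Qed.

Lemma phase_minus t x y : phase t (minus x y) = minus (phase t x) (phase t y).
Proof.
by rewrite /minus phase_plus -(scal_opp_one y) phase_scal scal_opp_one.
Qed.

Lemma phase_zero t : phase t zero = zero.
Proof. by have := phase_minus t zero zero; rewrite !minus_eq_zero. Qed.

Lemma phase_0 x : phase 0 x = x.
Proof. by rewrite /phase cos_0 sin_0; vec_eq V. Qed.

Lemma J_phase t x : J (phase t x) = phase t (J x).
Proof. by rewrite /phase (J_plus hJ) !(J_scal hJ). Qed.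

Lemma phase_phase s t x : phase s (phase t x) = phase (s + t) x.
Proof.
rewrite {1}/phase J_phase /phase (J_J hJ) cos_plus sin_plus.
by vec_eq V.
Qed.

Lemma norm_phase_le t x : norm (phase t x) <= norm x.
Proof. exact: J_phase_le. Qed.

Lemma norm_J_le x : norm (J x) <= norm x.
Proof.
have := norm_phase_le (PI / 2) x; rewrite /phase cos_PI2 sin_PI2.
by have -> : plus (scal 0 x) (scal 1 (J x)) = J x by vec_eq V.
Qed.

Lemma is_derive_phase (l t : R) x :
  is_derive (fun s => phase (l * s) x) t (scal l (phase (l * t) (J x))).
Proof.
rewrite /phase (J_J hJ).
evar_last.
  apply: is_derive_plus; apply: is_derive_scal_l.
    by auto_derive.
  by auto_derive.
by vec_eq V.
Qed.

Lemma continuous_phase (U : UniformSpace) (h : U -> R) (f : U -> V) (x : U) :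
  continuous h x -> continuous f x -> continuous (fun y => phase (h y) (f y)) x.
Proof.
move=> ch cf.
have cJ : continuous (fun y => J (f y)) x.
  apply/continuous_normP => e e0.
  have [d hd] := (continuous_normP _ _).1 cf e e0; exists d => y hy.
  have -> : minus (J (f y)) (J (f x)) = J (minus (f y) (f x)).
    by rewrite /minus (J_plus hJ) -(scal_opp_one (f x)) (J_scal hJ) scal_opp_one.
  by apply: Rle_trans (norm_J_le _) (hd y hy).
apply: continuous_plus; apply: continuous_scal => //.
  by apply: continuous_comp ch (continuous_cos _).
by apply: continuous_comp ch (continuous_sin _).
Qed.
End Rotation.

(** * Trigonometric series *)

Lemma exp_le x y : x <= y -> exp x <= exp y.
Proof.
by case=> [/exp_increasing h|->]; [exact: Rlt_le | exact: Rle_refl].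
Qed.

Section Frequencies.
Context (r : nat).
Implicit Types alpha beta : 'I_r -> Z.

Definition freq_add alpha beta : 'I_r -> Z := fun i => (alpha i + beta i)%Z.
Definition freq_zero : 'I_r -> Z := fun _ => 0%Z.
Definition freq_nz alpha : bool := [exists i, ~~ Z.eqb (alpha i) 0].

Lemma freq_nzP alpha : reflect (exists i, alpha i <> 0%Z) (freq_nz alpha).
Proof.
by apply: (iffP existsP) => -[i hi]; exists i; move: hi; case: Z.eqb_spec.
Qed.

Lemma freq_nzN alpha : freq_nz alpha = false -> alpha = freq_zero.
Proof.
move=> h; apply: functional_extensionality => i.
apply: NNPP => hi; have : freq_nz alpha by apply/freq_nzP; exists i.
by rewrite h.
Qed.

Lemma dot_add alpha beta theta :
  dot (freq_add alpha beta) theta = dot alpha theta + dot beta theta.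
Proof.
rewrite /dot; elim/big_rec3: _ => [|i x y z _ ->]; first by rewrite Rplus_0_r.
by rewrite /freq_add plus_IZR; ring.
Qed.

Lemma dot_zero theta : dot freq_zero theta = 0.
Proof.
rewrite /dot; elim/big_rec: _ => // i x _ ->.
by rewrite /freq_zero; ring.
Qed.

Lemma dot_scal alpha theta t : dot alpha (fun i => theta i * t) = dot alpha theta * t.
Proof.
rewrite /dot; elim/big_rec2: _ => [|i x y _ ->]; first by rewrite Rmult_0_l.
by ring.
Qed.

Lemma l1_norm_ge0 alpha : 0 <= l1_norm alpha.
Proof.
rewrite /l1_norm; elim/big_rec: _ => [|i x _ hx]; first lra.
by have := Rabs_pos (IZR (alpha i)); lra.
Qed.

Lemma l1_norm_zero : l1_norm freq_zero = 0.
Proof.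
rewrite /l1_norm; elim/big_rec: _ => // i x _ ->.
by rewrite /freq_zero Rabs_R0; ring.
Qed.

Lemma l1_norm_add alpha beta :
  l1_norm (freq_add alpha beta) <= l1_norm alpha + l1_norm beta.
Proof.
rewrite /l1_norm; elim/big_rec3: _ => [|i x y z _ hx]; first lra.
have := Rabs_triang (IZR (alpha i)) (IZR (beta i)).
by rewrite /freq_add plus_IZR; lra.
Qed.

Lemma l1_norm_ge1 alpha : freq_nz alpha -> 1 <= l1_norm alpha.
Proof.
move=> /freq_nzP [j hj].
have hj1 : 1 <= Rabs (IZR (alpha j)).
  by rewrite -abs_IZR; apply: IZR_le; lia.
suff : forall s : seq 'I_r, j \in s ->
    1 <= \big[Rplus/0]_(i <- s) Rabs (IZR (alpha i)).
  by apply; exact: mem_index_enum.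
have ge0 : forall s : seq 'I_r, 0 <= \big[Rplus/0]_(i <- s) Rabs (IZR (alpha i)).
  move=> s; elim/big_rec: _ => [|i x _ hx]; first lra.
  by have := Rabs_pos (IZR (alpha i)); lra.
elim=> // x s IH; rewrite in_cons big_cons => /orP[/eqP <-|/IH h].
  by have := ge0 s; lra.
by have := Rabs_pos (IZR (alpha x)); lra.
Qed.
End Frequencies.

Section TrigonometricPolynomials.
Context (V : CompleteNormedModule R_AbsRing) (J : V -> V).
Hypothesis hJ : complex_structure J.
Context (r : nat) (omega : 'I_r -> R).

(** Formal sums of [C exp (i alpha.theta)]; frequencies may be repeated. *)
Definition trig := seq (('I_r -> Z) * V).
Implicit Types p q : trig.

Fixpoint teval p (theta : 'I_r -> R) : V :=
  if p is m :: p' then plus (phase J (dot m.1 theta) m.2) (teval p' theta)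
  else zero.

Definition qeval p (tau : R) : V := teval p (fun i => omega i * tau).

Fixpoint tnorm (kappa : R) p : R :=
  if p is m :: p' then exp (kappa * l1_norm m.1) * norm m.2 + tnorm kappa p'
  else 0.

Definition tscal (c : R) p : trig := [seq (m.1, scal c m.2) | m <- p].

Lemma teval_cat p q theta : teval (p ++ q) theta = plus (teval p theta) (teval q theta).
Proof.
elim: p => [|m p IH] /=; first by rewrite plus_zero_l.
by rewrite IH plus_assoc.
Qed.

Lemma tnorm_cat kappa p q : tnorm kappa (p ++ q) = tnorm kappa p + tnorm kappa q.
Proof. by elim: p => [|m p IH] /=; [rewrite Rplus_0_l | rewrite IH; ring]. Qed.

Lemma teval_scal c p theta : teval (tscal c p) theta = scal c (teval p theta).
Proof.
elim: p => [|m p IH] /=; first by rewrite scal_zero_r.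
by rewrite IH (phase_scal hJ); vec_eq V.
Qed.

Lemma tnorm_ge0 kappa p : 0 <= tnorm kappa p.
Proof.
elim: p => [|m p IH] /=; first lra.
have := norm_ge_0 m.2; have := exp_pos (kappa * l1_norm m.1) => h1 h2.
have := Rmult_le_pos _ _ (Rlt_le _ _ h1) h2; lra.
Qed.

Lemma tnorm_scal kappa c p : tnorm kappa (tscal c p) <= Rabs c * tnorm kappa p.
Proof.
elim: p => [|m p IH] /=; first lra.
have := norm_scal_le c m.2; have := exp_pos (kappa * l1_norm m.1) => h1 h2.
have := Rmult_le_compat_l _ _ _ (Rlt_le _ _ h1) h2; vlra.
Qed.

Lemma norm_teval_le kappa p theta : 0 <= kappa -> norm (teval p theta) <= tnorm kappa p.
Proof.
move=> k0; elim: p => [|m p IH] /=; first by rewrite norm_zero; lra.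
apply: (Rle_trans _ _ _ (norm_triangle _ _)); apply: Rplus_le_compat => //.
apply: (Rle_trans _ _ _ (norm_phase_le hJ _ _)).
have h : 1 <= exp (kappa * l1_norm m.1).
  rewrite -exp_0; apply: exp_le; apply: Rmult_le_pos => //; exact: l1_norm_ge0.
have := norm_ge_0 m.2; nra.
Qed.

Lemma qeval_cons m p tau :
  qeval (m :: p) tau = plus (phase J (dot m.1 omega * tau) m.2) (qeval p tau).
Proof. by rewrite /qeval /= dot_scal. Qed.

Fixpoint qderiv p (tau : R) : V :=
  if p is m :: p'
  then plus (scal (dot m.1 omega) (phase J (dot m.1 omega * tau) (J m.2))) (qderiv p' tau)
  else zero.

Lemma is_derive_qeval p tau : is_derive (qeval p) tau (qderiv p tau).
Proof.
elim: p => [|m p IH] /=; first exact: is_derive_const.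
apply: (is_derive_ext (fun t => plus (phase J (dot m.1 omega * t) m.2) (qeval p t))).
  by move=> t; rewrite qeval_cons.
apply: is_derive_plus => //; exact: is_derive_phase.
Qed.

Lemma continuous_Rplus_qeval p : continuous_Rplus (qeval p).
Proof.
apply: (derivable_continuous_Rplus (f' := qderiv p)) => t t0.
apply: is_derive_is_derive_Rplus => //; exact: is_derive_qeval.
Qed.

(** A series is given by a sequence of finite blocks, not by a coefficient function. Its partial
    sums are then lists, on which integration and multiplication act mode by mode without
    reindexing. *)
Fixpoint psum (p : nat -> trig) (n : nat) : trig :=
  if n is m.+1 then psum p m ++ p m else [::].

Lemma tnorm_psum_le kappa (p : nat -> trig) n m : (n <= m)%N ->
  tnorm kappa (psum p n) <= tnorm kappa (psum p m).
Proof.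
move=> /subnK <-; elim: (m - n)%N => [|k IH]; first by rewrite add0n; lra.
rewrite addSn /= tnorm_cat; have := tnorm_ge0 kappa (p (k + n)%N); lra.
Qed.

Lemma norm_psum_minus_le kappa (p : nat -> trig) n m theta : 0 <= kappa -> (n <= m)%N ->
  norm (minus (teval (psum p m) theta) (teval (psum p n) theta)) <=
  tnorm kappa (psum p m) - tnorm kappa (psum p n).
Proof.
move=> k0 /subnK <-; elim: (m - n)%N => [|k IH].
  by rewrite add0n minus_eq_zero norm_zero; lra.
rewrite addSn /= teval_cat tnorm_cat.
set x := teval (psum p (k + n)) theta in IH *; set y := teval (p _) theta.
have -> : minus (plus x y) (teval (psum p n) theta) =
  plus (minus x (teval (psum p n) theta)) y by vec_eq V.
apply: (Rle_trans _ _ _ (norm_triangle _ _)).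
have : norm y <= tnorm kappa (p (k + n)%N) by exact: norm_teval_le.
vlra.
Qed.

Definition tsum (p : nat -> trig) (s : ('I_r -> R) -> V) :=
  forall e, 0 < e -> exists n0 : nat, forall n, (n0 <= n)%N -> forall theta,
    norm (minus (s theta) (teval (psum p n) theta)) <= e.

(** Weierstrass test: the norms of the partial sums increase and are bounded, hence converge, and
    their increments dominate the distances between partial sums uniformly in theta. *)
Lemma tsum_exists kappa (p : nat -> trig) N : 0 <= kappa ->
  (forall n, tnorm kappa (psum p n) <= N) -> exists s, tsum p s.
Proof.
move=> k0 hN.
have [L hL] : ex_finite_lim_seq (fun n => tnorm kappa (psum p n)).
  apply: (ex_finite_lim_seq_incr _ N) => // n; exact: tnorm_psum_le.
have tail e : 0 < e -> exists n0 : nat, forall n m, (n0 <= n)%N -> (n <= m)%N ->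
    forall theta,
    norm (minus (teval (psum p m) theta) (teval (psum p n) theta)) <= e.
  move=> e0; have [n0 hn0] := (is_lim_seq_spec _ _).2 hL (mkposreal _ (is_pos_div_2 (mkposreal e e0))).
  exists n0 => n m hn hm theta.
  apply: (Rle_trans _ _ _ (norm_psum_minus_le p theta k0 hm)).
  have h1 := (Rabs_lt_between _ _).1 (hn0 n ltac:(by apply/leP)).
  have h2 := (Rabs_lt_between _ _).1 (hn0 m ltac:(by apply/leP; apply: leq_trans hm)).
  rewrite /= in h1 h2; lra.
have hlim theta : exists x, filterlim (fun n => teval (psum p n) theta) eventually (locally x).
  apply/(filterlim_locally_cauchy (F := eventually)) => e.
  have [n0 hn0] := tail (e / 4) ltac:(have := cond_pos e; lra).
  exists (fun n => (n0 <= n)%N); split; first by exists n0 => n /leP.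
  move=> n m hn hm; apply: norm_compat1.
  have h1 := hn0 n0 n (leqnn _) hn theta; have h2 := hn0 n0 m (leqnn _) hm theta.
  have := norm_dist_triangle (teval (psum p n0) theta)
    (teval (psum p m) theta) (teval (psum p n) theta).
  rewrite (norm_minusC (teval (psum p n0) theta)).
  have := cond_pos e; vlra.
pose s theta := proj1_sig (constructive_indefinite_description _ (hlim theta)).
exists s => e e0.
have [n0 hn0] := tail (e / 2) ltac:(lra).
exists n0 => n hn theta.
have : filterlim (fun n => teval (psum p n) theta) eventually (locally (s theta)).
  by rewrite /s; case: constructive_indefinite_description.
move=> /filterlim_normP /(_ (e / 2) ltac:(lra)) [m0 hm0].
(* The index m0 depends on theta, but n0 does not: the comparison passes through a late partial sum
   that disappears from the final bound. *)
have h1 := hn0 n (maxn n m0) hn (leq_maxl _ _) theta.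
have h2 := hm0 (maxn n m0) ltac:(by apply/leP; exact: leq_maxr).
have := norm_dist_triangle (teval (psum p (maxn n m0)) theta)
  (s theta) (teval (psum p n) theta).
rewrite (norm_minusC (s theta) (teval (psum p (maxn n m0)) theta)); vlra.
Qed.

(** Dividing a mode by i (alpha.omega) is multiplying it by -i / (alpha.omega). Constant modes,
    which have no bounded primitive, are dropped. *)
Definition tantider p : trig :=
  [seq (m.1, scal (- / dot m.1 omega) (J m.2)) | m <- p & freq_nz m.1].

Definition tnz p : trig := [seq m <- p | freq_nz m.1].

Fixpoint zero_mode p : V :=
  if p is m :: p' then plus (if freq_nz m.1 then zero else m.2) (zero_mode p')
  else zero.

Lemma teval_tnz p theta : teval (tnz p) theta = minus (teval p theta) (zero_mode p).
Proof.
elim: p => [|m p IH] /=; first by rewrite minus_eq_zero.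
case: ifP => h /=; rewrite IH; first by vec_eq V.
rewrite (freq_nzN h) dot_zero phase_0; vec_eq V.
Qed.

Lemma tantider_psum (p : nat -> trig) n : tantider (psum p n) = psum (fun k => tantider (p k)) n.
Proof. by elim: n => //= n <-; rewrite /tantider filter_cat map_cat. Qed.

Section SmallDivisors.
Context (delta K : R).
Hypothesis K_ge0 : 0 <= K.
Hypothesis nonresonant : forall alpha : 'I_r -> Z, freq_nz alpha ->
  dot alpha omega <> 0 /\ / Rabs (dot alpha omega) <= K * exp (delta * l1_norm alpha).

(** The growth exp (delta |alpha|) allowed to the inverse small divisor is exactly what is gained by
    lowering the width from kappa to kappa - delta. *)
Lemma tnorm_tantider kappa p :
  tnorm (kappa - delta) (tantider p) <= K * tnorm kappa p.
Proof.
elim: p => [|m p IH] /=; first lra.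
have t0 := tnorm_ge0 kappa p; have m0 := norm_ge_0 m.2.
have ep := exp_pos (kappa * l1_norm m.1).
have en : 0 <= exp (kappa * l1_norm m.1) * norm m.2 by apply: Rmult_le_pos; lra.
have Ken := Rmult_le_pos _ _ K_ge0 en.
rewrite /tantider /=; case: ifP => h /=; last first.
  by rewrite -/(tantider p); lra.
rewrite -/(tantider p).
have [d0 hd] := nonresonant h.
have h1 : norm (scal (- / dot m.1 omega) (J m.2)) <=
    K * exp (delta * l1_norm m.1) * norm m.2.
  apply: (Rle_trans _ _ _ (norm_scal_le _ _)).
  rewrite Rabs_Ropp Rabs_inv; apply: Rmult_le_compat => //; last exact: norm_J_le.
    by apply/Rlt_le/Rinv_0_lt_compat; exact: Rabs_pos_lt.
  exact: norm_ge_0.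
have h2 := Rmult_le_compat_l _ _ _
  (Rlt_le _ _ (exp_pos ((kappa - delta) * l1_norm m.1))) h1.
have h3 : exp ((kappa - delta) * l1_norm m.1) *
    (K * exp (delta * l1_norm m.1) * norm m.2) =
    K * (exp (kappa * l1_norm m.1) * norm m.2).
  have -> : kappa * l1_norm m.1 = (kappa - delta) * l1_norm m.1 + delta * l1_norm m.1.
    by ring.
  by rewrite exp_plus; ring.
lra.
Qed.

Lemma qderiv_tantider p tau : qderiv (tantider p) tau = qeval (tnz p) tau.
Proof.
elim: p => [|m p IH] //=.
rewrite /tantider /=; case: ifP => h //=; rewrite -/(tantider p).
rewrite qeval_cons IH; congr plus.
have [d0 _] := nonresonant h.
rewrite (J_scal hJ) (J_J hJ) (phase_scal hJ).
rewrite -(scal_opp_one m.2) (phase_scal hJ).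
by vec_eq V; rewrite ?/one ?/opp /=; field.
Qed.

(** The nonconstant modes have the bounded primitive [tantider], so their means tend to zero and
    only the constant modes survive. *)
Lemma has_average_qeval p : has_average (qeval p) (zero_mode p).
Proof.
have cz : continuous_Rplus (fun _ : R => zero_mode p) by exact: continuous_Rplus_const.
have -> : zero_mode p = plus zero (zero_mode p) by rewrite plus_zero_l.
apply: (has_average_ext (f := fun t => plus (qeval (tnz p) t) (zero_mode p))).
  by move=> t _; rewrite /qeval teval_tnz; vec_eq V.
apply: has_average_plus => //; first exact: continuous_Rplus_qeval.
  apply: (has_average_bounded_primitive (F := qeval (tantider p))
            (M := tnorm 0 (tantider p))).
  - exact: continuous_Rplus_qeval.
  - apply: RInt_Rplus_primitive; first exact: continuous_Rplus_qeval.
    move=> t t0; rewrite -qderiv_tantider; apply: is_derive_is_derive_Rplus => //.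
    exact: is_derive_qeval.
  - by move=> t _; apply: norm_teval_le; lra.
exact: has_average_const.
Qed.
End SmallDivisors.
End TrigonometricPolynomials.

(** * Quasi-periodic functions with an exponentially small remainder *)

Section ExponentialDecay.
Context (V : CompleteNormedModule R_AbsRing).
Implicit Types b : R -> V.

Definition flat (N : R) b :=
  continuous_Rplus b /\ forall t, 0 <= t -> norm (b t) <= N * exp (- t).

Lemma flat_ge0 N b : flat N b -> 0 <= N.
Proof.
move=> [_ /(_ 0 (Rle_refl 0))]; rewrite Ropp_0 exp_0 Rmult_1_r.
exact: (Rle_trans _ _ _ (norm_ge_0 _)).
Qed.

Lemma exp_opp_le1 t : 0 <= t -> exp (- t) <= 1.
Proof. by move=> t0; rewrite -exp_0; apply: exp_le; lra. Qed.

Lemma flat_bound N b t : flat N b -> 0 <= t -> norm (b t) <= N.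
Proof.
move=> fb t0; have N0 := flat_ge0 fb; have [_ /(_ t t0)] := fb.
have := exp_opp_le1 t0; nra.
Qed.

Lemma norm_RInt_flat N b s t : flat N b -> 0 <= s <= t ->
  norm (RInt b s t) <= N * exp (- s).
Proof.
move=> fb st; have N0 := flat_ge0 fb; have [cb hb] := fb.
apply: (Rle_trans _ (N * (exp (- s) - exp (- t)))); last first.
  by have := exp_pos (- t); nra.
apply: (norm_RInt_Rplus_le cb st hb).
have -> : N * (exp (- s) - exp (- t)) =
    minus ((fun x => - N * exp (- x)) t) ((fun x => - N * exp (- x)) s).
  by rewrite /minus /plus /opp /=; ring.
apply: (is_RInt_derive (V := R_CompleteNormedModule) (fun x => - N * exp (- x))
  (fun x => N * exp (- x))) => x _.
  by auto_derive => //; ring.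
apply: (ex_derive_continuous (V := R_NormedModule)); by auto_derive.
Qed.

Lemma RInt_flat_Chasles N b s t : flat N b -> 0 <= s -> 0 <= t ->
  minus (RInt b 0 t) (RInt b 0 s) = RInt b s t.
Proof.
move=> [cb _] s0 t0.
rewrite -(RInt_Chasles b 0 s t); try by apply: ex_RInt_Rplus => //; lra.
by vec_eq V.
Qed.

(** Here beta is the integral of b over the half-line, and the difference is minus the integral over
    [t, +oo), which decays with the same rate and the same constant. Hence integration costs nothing
    on the decaying part. *)
Lemma flat_integral N b : flat N b ->
  exists beta, flat N (fun t => minus (RInt b 0 t) beta).
Proof.
move=> fb; have N0 := flat_ge0 fb; have [cb hb] := fb.
have [beta hbeta] : exists beta,
    filterlim (fun t => RInt b 0 t) (Rbar_locally p_infty) (locally beta).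
  apply/(filterlim_locally_cauchy (F := Rbar_locally p_infty)) => e.
  have e0 := cond_pos e.
  have [T [T0 hT]] : exists T, 0 <= T /\ N * exp (- T) < e.
    have q0 : 0 < N / e + 1 by have := Rdiv_le_0_compat _ _ N0 e0; lra.
    (* This choice gives N exp (- T) <= N e / (N + e) < e; the added 1 keeps the logarithm
       meaningful when N = 0. *)
    exists (Rmax 0 (ln (N / e + 1))); split; first exact: Rmax_l.
    apply: (Rle_lt_trans _ (N * exp (- ln (N / e + 1)))).
      apply: Rmult_le_compat_l => //; apply: exp_le.
      have := Rmax_r 0 (ln (N / e + 1)); lra.
    rewrite exp_Ropp exp_ln //; apply: (Rmult_lt_reg_r (N / e + 1)) => //.
    rewrite Rmult_assoc Rinv_l; last lra.
    have -> : e * (N / e + 1) = N + e by field; lra.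
    lra.
  have key u v : T < u -> u <= v -> ball (RInt b 0 u) e (RInt b 0 v).
    move=> Tu uv; apply: norm_compat1.
    have -> : minus (RInt b 0 v) (RInt b 0 u) = RInt b u v.
      by apply: (RInt_flat_Chasles fb); lra.
    apply: Rle_lt_trans (norm_RInt_flat fb _) _; first lra.
    apply: Rle_lt_trans hT; apply: Rmult_le_compat_l => //; apply: exp_le; lra.
  exists (fun x => T < x); split; first by exists T.
  move=> u v Tu Tv; have [uv|vu] := Rle_or_lt u v; first exact: key.
  by apply: ball_sym; apply: key; lra.
exists beta; split.
  apply: continuous_Rplus_minus; last exact: continuous_Rplus_const.
  by apply: derivable_continuous_Rplus => t; exact: RInt_Rplus_derive.
move=> t t0; apply: le_epsilon => e e0.
have [B hB] := (filterlim_normP _ _).1 hbeta e e0.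
have ht := Rmax_l t B; have hB' := Rmax_r t B.
have h1 := hB (Rmax t B + 1) ltac:(lra).
have h2 := norm_RInt_flat (s := t) (t := Rmax t B + 1) fb ltac:(lra).
rewrite -(RInt_flat_Chasles fb) in h2; try lra.
have := norm_dist_triangle (RInt b 0 (Rmax t B + 1)) (RInt b 0 t) beta.
rewrite (norm_minusC (RInt b 0 t) (RInt b 0 (Rmax t B + 1))); vlra.
Qed.

Lemma has_average_flat N b : flat N b -> has_average b zero.
Proof.
move=> fb; have [cb _] := fb.
apply: (has_average_bounded_primitive (F := fun t => RInt b 0 t) (M := N)) => //.
  by move=> t t0; rewrite RInt_point minus_zero_r.
move=> t t0; have := norm_RInt_flat (s := 0) (t := t) fb ltac:(lra).
by rewrite Ropp_0 exp_0 Rmult_1_r.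
Qed.
End ExponentialDecay.

Section QuasiPeriodic.
Context (V : CompleteNormedModule R_AbsRing) (J : V -> V).
Hypothesis hJ : complex_structure J.
Context (r : nat) (omega : 'I_r -> R).
Notation trig := (seq (('I_r -> Z) * V)).
Notation qev := (qeval J omega).
Notation tev := (teval J).

(** [sharp] and [quasi] express that a function is in [E^sharp_kappa], resp.
    [E_kappa], with norm at most [N]. *)
Definition sharp (kappa N : R) (s : R -> V) := exists p : nat -> trig,
  (forall n, tnorm kappa (psum p n) <= N) /\
  forall e, 0 < e -> exists n0 : nat, forall n, (n0 <= n)%N -> forall t, 0 <= t ->
    norm (minus (s t) (qev (psum p n) t)) <= e.

Definition quasi (kappa N : R) (f : R -> V) := exists s b N1 N2,
  [/\ sharp kappa N1 s, flat N2 b, N1 + N2 <= N &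
      forall t, 0 <= t -> f t = plus (s t) (b t)].

Lemma sharp_ge0 kappa N s : sharp kappa N s -> 0 <= N.
Proof. by move=> [p [/(_ 0%N) h _]]. Qed.

Lemma sharp_bound kappa N s t : 0 <= kappa -> sharp kappa N s -> 0 <= t ->
  norm (s t) <= N.
Proof.
move=> k0 [p [hN hs]] t0; apply: le_epsilon => e e0.
have [n0 /(_ n0 (leqnn _) t t0) h] := hs e e0.
have h1 : norm (qev (psum p n0) t) <= tnorm kappa (psum p n0).
  exact: norm_teval_le.
have := hN n0; have := norm_rev_triangle (s t) (qev (psum p n0) t); vlra.
Qed.

Lemma sharp_continuous kappa N s : sharp kappa N s -> continuous_Rplus s.
Proof.
move=> [p [_ hs]] x; apply: continuous_uniform_limit => e e0.
have [n0 /(_ n0 (leqnn _)) h] := hs e e0.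
exists (fun t => qev (psum p n0) (Rmax 0 t)).
  exact: (@continuous_Rplus_qeval _ _ hJ _ omega (psum p n0) x).
by move=> t; apply: h; exact: Rmax_l.
Qed.

Lemma tnorm_mono k1 k2 (p : trig) : k1 <= k2 -> tnorm k1 p <= tnorm k2 p.
Proof.
move=> k12; elim: p => [|m p IH] /=; first lra.
apply: Rplus_le_compat => //; apply: Rmult_le_compat_r; first exact: norm_ge_0.
by apply: exp_le; apply: Rmult_le_compat_r => //; exact: l1_norm_ge0.
Qed.

Lemma sharp_weaken k1 k2 N s : k1 <= k2 -> sharp k2 N s -> sharp k1 N s.
Proof.
move=> k12 [p [hN hs]]; exists p; split=> // n.
by apply: Rle_trans (hN n); exact: tnorm_mono.
Qed.

Lemma sharp_const kappa c : sharp kappa (norm c) (fun _ => c).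
Proof.
exists (fun n => if n is 0%N then [:: (@freq_zero r, c)] else [::]).
have tn n : psum (fun n => if n is 0%N then [:: (@freq_zero r, c)] else [::]) n =
    if n is 0%N then [::] else [:: (@freq_zero r, c)].
  by elim: n => // -[|n] //= ->.
split=> [n|e e0].
  rewrite tn; case: n => [|n] /=; first exact: norm_ge_0.
  by rewrite l1_norm_zero Rmult_0_r exp_0; lra.
exists 1%N => -[|n] // _ t _; rewrite tn /qeval /=.
rewrite dot_zero phase_0 plus_zero_r minus_eq_zero norm_zero; lra.
Qed.

Lemma teval_psum_cat (p q : nat -> trig) n theta :
  tev (psum (fun k => p k ++ q k) n) theta =
  plus (tev (psum p n) theta) (tev (psum q n) theta).
Proof.
elim: n => [|n IH] /=; first by rewrite plus_zero_l.
by rewrite !teval_cat IH plus_interchange.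
Qed.

Lemma tnorm_psum_cat kappa (p q : nat -> trig) n :
  tnorm kappa (psum (fun k => p k ++ q k) n) =
  tnorm kappa (psum p n) + tnorm kappa (psum q n).
Proof.
elim: n => [|n IH] /=; first by rewrite Rplus_0_l.
by rewrite !tnorm_cat IH; ring.
Qed.

Lemma sharp_plus kappa N1 N2 s1 s2 :
  sharp kappa N1 s1 -> sharp kappa N2 s2 ->
  sharp kappa (N1 + N2) (fun t => plus (s1 t) (s2 t)).
Proof.
move=> [p [hp sp]] [q [hq sq]]; exists (fun k => p k ++ q k); split=> [n|e e0].
  by rewrite tnorm_psum_cat; have := hp n; have := hq n; lra.
have [n1 h1] := sp (e / 2) ltac:(lra); have [n2 h2] := sq (e / 2) ltac:(lra).
exists (maxn n1 n2) => n; rewrite geq_max => /andP[l1 l2] t t0.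
rewrite {1}/qeval teval_psum_cat -!/(qeval _ _ _ _).
have -> : minus (plus (s1 t) (s2 t)) (plus (qev (psum p n) t) (qev (psum q n) t))
  = plus (minus (s1 t) (qev (psum p n) t)) (minus (s2 t) (qev (psum q n) t)).
  by vec_eq V.
apply: (Rle_trans _ _ _ (norm_triangle _ _)).
by have := h1 n l1 t t0; have := h2 n l2 t t0; vlra.
Qed.

Lemma psum_scal c (p : nat -> trig) n :
  psum (fun k => tscal c (p k)) n = tscal c (psum p n).
Proof. by elim: n => //= n ->; rewrite /tscal map_cat. Qed.

Lemma sharp_scal kappa N s c : sharp kappa N s ->
  sharp kappa (Rabs c * N) (fun t => scal c (s t)).
Proof.
have c0 := Rabs_pos c.
move=> [p [hp sp]]; exists (fun k => tscal c (p k)); split=> [n|e e0].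
  rewrite psum_scal; apply: (Rle_trans _ _ _ (tnorm_scal _ _ _)).
  exact: Rmult_le_compat_l.
have q0 : 0 < e / (1 + Rabs c) by apply: Rdiv_lt_0_compat; lra.
have [n0 h0] := sp _ q0; exists n0 => n hn t t0.
rewrite psum_scal /qeval (teval_scal hJ) -/(qeval _ _ _ _).
have -> : minus (scal c (s t)) (scal c (qev (psum p n) t)) =
  scal c (minus (s t) (qev (psum p n) t)) by vec_eq V.
apply: (Rle_trans _ _ _ (norm_scal_le _ _)).
have h1 := Rmult_le_compat_l _ _ _ c0 (h0 n hn t t0).
apply: (Rle_trans _ _ _ h1).
apply: (Rmult_le_reg_r (1 + Rabs c)); first lra.
have -> : Rabs c * (e / (1 + Rabs c)) * (1 + Rabs c) = Rabs c * e by field; lra.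
nra.
Qed.

Section Product.
Context (B : V -> V -> V).
Hypothesis Bl : forall x y z, B (plus x y) z = plus (B x z) (B y z).
Hypothesis Br : forall x y z, B x (plus y z) = plus (B x y) (B x z).
Hypothesis Bsl : forall (c : R) x y, B (scal c x) y = scal c (B x y).
Hypothesis Bsr : forall (c : R) x y, B x (scal c y) = scal c (B x y).
Hypothesis Bn : forall x y, norm (B x y) <= norm x * norm y.
Hypothesis BJl : forall x y, B (J x) y = J (B x y).
Hypothesis BJr : forall x y, B x (J y) = J (B x y).

Lemma B_phase s t x y : B (phase J s x) (phase J t y) = phase J (s + t) (B x y).
Proof.
rewrite -(phase_phase hJ) {1}/phase {1}/phase Bl !Br !Bsl !Bsr !BJl !BJr.
by rewrite /phase !(J_plus hJ, J_scal hJ); vec_eq V.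
Qed.

Lemma B_zero_l y : B zero y = zero.
Proof.
by have := Bsl 0 zero y; rewrite (scal_zero_l (zero : V)) => ->; exact: scal_zero_l.
Qed.

Lemma B_zero_r x : B x zero = zero.
Proof.
by have := Bsr 0 x zero; rewrite (scal_zero_l (zero : V)) => ->; exact: scal_zero_l.
Qed.

Definition tmul1 (m : ('I_r -> Z) * V) (q : trig) : trig :=
  [seq (freq_add m.1 m'.1, B m.2 m'.2) | m' <- q].

Fixpoint tmul (p q : trig) : trig :=
  if p is m :: p' then tmul1 m q ++ tmul p' q else [::].

Lemma teval_tmul1 m q theta :
  tev (tmul1 m q) theta = B (phase J (dot m.1 theta) m.2) (tev q theta).
Proof.
elim: q => [|m' q IH] /=; first by rewrite B_zero_r.
by rewrite IH Br B_phase dot_add.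
Qed.

Lemma teval_tmul p q theta :
  tev (tmul p q) theta = B (tev p theta) (tev q theta).
Proof.
elim: p => [|m p IH] /=; first by rewrite B_zero_l.
by rewrite teval_cat IH Bl teval_tmul1.
Qed.

Lemma tnorm_tmul kappa p q : 0 <= kappa ->
  tnorm kappa (tmul p q) <= tnorm kappa p * tnorm kappa q.
Proof.
move=> k0; elim: p => [|m p IH] /=; first lra.
rewrite tnorm_cat Rmult_plus_distr_r; apply: Rplus_le_compat => //.
elim: q {IH} => [|m' q IH] /=; first lra.
rewrite Rmult_plus_distr_l; apply: Rplus_le_compat => //.
apply: (Rle_trans _ (exp (kappa * (l1_norm m.1 + l1_norm m'.1)) * (norm m.2 * norm m'.2))).
  apply: Rmult_le_compat => //.
  - exact/Rlt_le/exp_pos.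
  - exact: norm_ge_0.
  - apply: exp_le; apply: Rmult_le_compat_l => //; exact: l1_norm_add.
rewrite Rmult_plus_distr_l exp_plus; apply: Req_le; ring.
Qed.

(** The n-th square shell of the product of two series, so that the partial sums of [pmul p q]
    evaluate exactly to the products of the partial sums, without a Cauchy-product tail to
    estimate. *)
Definition pmul (p q : nat -> trig) (n : nat) : trig :=
  tmul (p n) (psum q n.+1) ++ tmul (psum p n) (q n).

Lemma teval_psum_pmul p q n theta :
  tev (psum (pmul p q) n) theta =
  B (tev (psum p n) theta) (tev (psum q n) theta).
Proof.
elim: n => [|n IH] /=; first by rewrite B_zero_l.
rewrite !teval_cat IH !teval_tmul /= !teval_cat !Bl !Br; vec_eq V.
Qed.

Lemma tnorm_psum_pmul kappa p q n : 0 <= kappa ->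
  tnorm kappa (psum (pmul p q) n) <= tnorm kappa (psum p n) * tnorm kappa (psum q n).
Proof.
move=> k0; elim: n => [|n IH] /=; first lra.
rewrite !tnorm_cat.
have h1 := tnorm_tmul (p n) (psum q n.+1) k0.
have h2 := tnorm_tmul (psum p n) (q n) k0.
have e1 : tnorm kappa (psum q n.+1) = tnorm kappa (psum q n) + tnorm kappa (q n).
  by rewrite tnorm_cat.
rewrite e1 in h1; lra.
Qed.

Lemma sharp_mul kappa N1 N2 s1 s2 : 0 <= kappa ->
  sharp kappa N1 s1 -> sharp kappa N2 s2 ->
  sharp kappa (N1 * N2) (fun t => B (s1 t) (s2 t)).
Proof.
move=> k0 h1 h2; have b1 t := sharp_bound (t := t) k0 h1.
have N10 := sharp_ge0 h1; have N20 := sharp_ge0 h2.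
move: h1 h2 => [p [hp sp]] [q [hq sq]]; exists (pmul p q); split=> [n|e e0].
  apply: (Rle_trans _ _ _ (tnorm_psum_pmul _ _ _ k0)).
  by apply: Rmult_le_compat; try exact: tnorm_ge0.
set K := 1 + N1 + N2.
have K0 : 0 < K by rewrite /K; lra.
have q0 : 0 < e / K by apply: Rdiv_lt_0_compat.
have [n1 h1] := sp _ q0; have [n2 h2] := sq _ q0.
exists (maxn n1 n2) => n; rewrite geq_max => /andP[l1 l2] t t0.
rewrite {1}/qeval teval_psum_pmul -!/(qeval _ _ _ _).
have {}h1 := h1 n l1 t t0; have {}h2 := h2 n l2 t t0.
set x := qev (psum p n) t in h1 *; set y := qev (psum q n) t in h2 *.
have y0 : norm y <= N2.
  apply: Rle_trans (hq n); exact: norm_teval_le.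
have -> : minus (B (s1 t) (s2 t)) (B x y) =
    plus (B (s1 t) (minus (s2 t) y)) (B (minus (s1 t) x) y).
  by rewrite (bilinear_minus_r Br Bsr) (bilinear_minus_l Bl Bsl); vec_eq V.
apply: (Rle_trans _ _ _ (norm_triangle _ _)).
have e1 : norm (B (s1 t) (minus (s2 t) y)) <= N1 * (e / K).
  apply: (Rle_trans _ _ _ (Bn _ _)).
  by apply: Rmult_le_compat; try exact: norm_ge_0; [exact: b1 | exact: h2].
have e2 : norm (B (minus (s1 t) x) y) <= (e / K) * N2.
  apply: (Rle_trans _ _ _ (Bn _ _)).
  by apply: Rmult_le_compat; try exact: norm_ge_0.
have -> : e = e / K * K by field; lra.
apply: (Rle_trans _ (N1 * (e / K) + e / K * N2)); first exact: Rplus_le_compat.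
move: (e / K) q0 => d d0; rewrite /K; nra.
Qed.

(** Quasi-periodic parts are bounded and decaying parts form an ideal: every product with a decaying
    factor is decaying, and only s1 s2 remains quasi-periodic. *)
Lemma quasi_mul kappa N1 N2 f1 f2 : 0 <= kappa ->
  quasi kappa N1 f1 -> quasi kappa N2 f2 ->
  quasi kappa (N1 * N2) (fun t => B (f1 t) (f2 t)).
Proof.
move=> k0 [s1 [b1 [S1 [F1 [hs1 hb1 hN1 e1]]]]] [s2 [b2 [S2 [F2 [hs2 hb2 hN2 e2]]]]].
exists (fun t => B (s1 t) (s2 t)), (fun t => plus (B (s1 t) (b2 t)) (B (b1 t) (plus (s2 t) (b2 t)))).
(* These constants add up to (S1 + F1) (S2 + F2), which makes the norm submultiplicative with
   constant 1. *)
exists (S1 * S2), (S1 * F2 + F1 * (S2 + F2)).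
have S10 := sharp_ge0 hs1; have S20 := sharp_ge0 hs2.
have F10 := flat_ge0 hb1; have F20 := flat_ge0 hb2.
have cs1 := sharp_continuous hs1; have cs2 := sharp_continuous hs2.
have [cb1 lb1] := hb1; have [cb2 lb2] := hb2.
split.
- exact: sharp_mul.
- split.
    apply: continuous_Rplus_plus; apply: continuous_Rplus_bilinear => //.
    exact: continuous_Rplus_plus.
  move=> t t0; apply: (Rle_trans _ _ _ (norm_triangle _ _)).
  have a1 := sharp_bound k0 hs1 t0; have a2 := sharp_bound k0 hs2 t0.
  have a3 := lb1 t t0; have a4 := lb2 t t0; have a5 := flat_bound hb2 t0.
  rewrite Rmult_plus_distr_r; apply: Rplus_le_compat.
    apply: (Rle_trans _ _ _ (Bn _ _)); rewrite Rmult_assoc.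
    by apply: Rmult_le_compat; try exact: norm_ge_0.
  apply: (Rle_trans _ _ _ (Bn _ _)).
  have -> : F1 * (S2 + F2) * exp (- t) = F1 * exp (- t) * (S2 + F2) by ring.
  apply: Rmult_le_compat; try exact: norm_ge_0; first exact: a3.
  apply: (Rle_trans _ _ _ (norm_triangle _ _)); lra.
- have -> : S1 * S2 + (S1 * F2 + F1 * (S2 + F2)) = (S1 + F1) * (S2 + F2) by ring.
  by apply: Rmult_le_compat; lra.
- move=> t t0; rewrite e1 // e2 // !Bl !Br; vec_eq V.
Qed.
End Product.

Lemma quasi_ext kappa N f g : (forall t, 0 <= t -> f t = g t) ->
  quasi kappa N f -> quasi kappa N g.
Proof.
move=> fg [s [b [N1 [N2 [h1 h2 h3 h4]]]]]; exists s, b, N1, N2; split=> // t t0.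
by rewrite -fg // h4.
Qed.

Lemma quasi_weaken k1 k2 N1 N2 f : k1 <= k2 -> N2 <= N1 ->
  quasi k2 N2 f -> quasi k1 N1 f.
Proof.
move=> k12 N12 [s [b [S [F [h1 h2 h3 h4]]]]]; exists s, b, S, F; split=> //.
  exact: sharp_weaken h1.
lra.
Qed.

Lemma quasi_bound kappa N f t : 0 <= kappa -> quasi kappa N f -> 0 <= t ->
  norm (f t) <= N.
Proof.
move=> k0 [s [b [S [F [h1 h2 h3 h4]]]]] t0; rewrite h4 //.
apply: (Rle_trans _ _ _ (norm_triangle _ _)).
have := sharp_bound k0 h1 t0; have := flat_bound h2 t0; vlra.
Qed.

Lemma quasi_continuous kappa N f : quasi kappa N f -> continuous_Rplus f.
Proof.
move=> [s [b [S [F [h1 [h2 _] h3 h4]]]]].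
apply: (continuous_Rplus_ext (f := fun t => plus (s t) (b t))).
  by move=> t t0; rewrite h4.
by apply: continuous_Rplus_plus => //; exact: sharp_continuous h1.
Qed.

Lemma flat_zero : flat 0 (fun _ : R => zero : V).
Proof.
split; first exact: continuous_Rplus_const.
by move=> t _; rewrite norm_zero; lra.
Qed.

Lemma quasi_const kappa c : quasi kappa (norm c) (fun _ => c).
Proof.
exists (fun _ => c), (fun _ => zero), (norm c), 0; split.
- exact: sharp_const.
- exact: flat_zero.
- lra.
- by move=> t _; rewrite plus_zero_r.
Qed.

Lemma quasi_plus kappa N1 N2 f1 f2 :
  quasi kappa N1 f1 -> quasi kappa N2 f2 ->
  quasi kappa (N1 + N2) (fun t => plus (f1 t) (f2 t)).
Proof.
move=> [s1 [b1 [S1 [F1 [hs1 [cb1 hb1] hN1 e1]]]]]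
  [s2 [b2 [S2 [F2 [hs2 [cb2 hb2] hN2 e2]]]]].
exists (fun t => plus (s1 t) (s2 t)), (fun t => plus (b1 t) (b2 t)), (S1 + S2), (F1 + F2).
split.
- exact: sharp_plus.
- split; first exact: continuous_Rplus_plus.
  move=> t t0; apply: (Rle_trans _ _ _ (norm_triangle _ _)).
  by have := hb1 t t0; have := hb2 t t0; lra.
- lra.
- by move=> t t0; rewrite e1 // e2 // plus_interchange.
Qed.

Lemma quasi_scal kappa N f c : quasi kappa N f ->
  quasi kappa (Rabs c * N) (fun t => scal c (f t)).
Proof.
move=> [s [b [S [F [hs [cb hb] hN e]]]]].
exists (fun t => scal c (s t)), (fun t => scal c (b t)), (Rabs c * S), (Rabs c * F).
have c0 := Rabs_pos c; split.
- exact: sharp_scal.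
- split.
    move=> x; apply: (continuous_scal (fun _ => c) _ _ (continuous_const _ _)).
    exact: cb.
  move=> t t0; apply: (Rle_trans _ _ _ (norm_scal_le _ _)).
  rewrite Rmult_assoc; apply: Rmult_le_compat_l => //; exact: hb.
- by have := Rmult_le_compat_l _ _ _ c0 hN; lra.
- by move=> t t0; rewrite e // scal_distr_l.
Qed.

Lemma quasi_minus kappa N1 N2 f1 f2 :
  quasi kappa N1 f1 -> quasi kappa N2 f2 ->
  quasi kappa (N1 + N2) (fun t => minus (f1 t) (f2 t)).
Proof.
move=> h1 h2; have := quasi_plus h1 (quasi_scal (-1) h2).
rewrite Rabs_Ropp Rabs_R1 Rmult_1_l; apply: quasi_ext => t _.
by vec_eq V.
Qed.

Section Integration.
Context (delta K : R).
Hypothesis delta_ge0 : 0 <= delta.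
Hypothesis K_ge1 : 1 <= K.
Hypothesis nonresonant : forall alpha : 'I_r -> Z, freq_nz alpha ->
  dot alpha omega <> 0 /\ / Rabs (dot alpha omega) <= K * exp (delta * l1_norm alpha).

Lemma quasi_average kappa N f : quasi kappa N f -> exists L, has_average f L.
Proof.
move=> [s [b [S [F [hs hb hN e]]]]].
have cs := sharp_continuous hs; have [cb _] := hb.
have [p [_ hp]] := hs.
have [L hL] : exists L, has_average s L.
  apply: has_average_uniform_limit => // d d0.
  have [n0 /(_ n0 (leqnn _)) h] := hp d d0.
  exists (qev (psum p n0)), (zero_mode (psum p n0)); split=> //.
    exact: continuous_Rplus_qeval.
  exact: (has_average_qeval hJ (K := K) (delta := delta)).
exists (plus L zero).
apply: (has_average_ext (f := fun t => plus (s t) (b t))).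
  by move=> t t0; rewrite e.
by apply: has_average_plus => //; exact: has_average_flat hb.
Qed.

(** The series is integrated mode by mode. The bound on the blocks [tantider] makes the integrated
    series converge uniformly, and the identity with the integral passes to the limit on each
    [0, t]. *)
Lemma sharp_primitive kappa N s : 0 <= kappa - delta ->
  sharp kappa N s -> has_average s zero ->
  exists P, [/\ sharp (kappa - delta) (K * N) P, has_average P zero &
    forall t, 0 <= t -> RInt s 0 t = minus (P t) (P 0)].
Proof.
move=> k0 hs as0; have cs := sharp_continuous hs.
have K0 : 0 <= K by lra.
have [p [hN hp]] := hs.
have hq n : tnorm (kappa - delta) (psum (fun k => tantider J omega (p k)) n) <= K * N.
  rewrite -tantider_psum; apply: (Rle_trans _ (K * tnorm kappa (psum p n))).
    exact: tnorm_tantider.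
  exact: Rmult_le_compat_l.
have [P0 hP0] := tsum_exists hJ k0 hq.
pose P t := P0 (fun i => omega i * t).
have hP d : 0 < d -> exists n0 : nat, forall n, (n0 <= n)%N -> forall t,
    norm (minus (P t) (qev (psum (fun k => tantider J omega (p k)) n) t)) <= d.
  by move=> d0; have [n0 h] := hP0 d d0; exists n0 => n hn t; exact: h.
have shP : sharp (kappa - delta) (K * N) P.
  exists (fun k => tantider J omega (p k)); split=> // d d0.
  by have [n0 h] := hP d d0; exists n0 => n hn t _; exact: h.
have cP := sharp_continuous shP.
(* The average of s vanishes, but the constant modes of its partial sums need not. They are averages
   of functions uniformly close to s, hence small, and can be removed without changing the limit. *)
have nzp d : 0 < d -> exists n0 : nat, forall n, (n0 <= n)%N -> forall t, 0 <= t ->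
    norm (minus (s t) (qev (tnz (psum p n)) t)) <= d.
  move=> d0; have [n0 h] := hp (d / 2) ltac:(lra); exists n0 => n hn t t0.
  have h1 := h n hn t t0.
  have h2 : norm (minus zero (zero_mode (psum p n))) <= d / 2.
    have cq : continuous_Rplus (qev (psum p n)) by exact: continuous_Rplus_qeval.
    have aq : has_average (qev (psum p n)) (zero_mode (psum p n)).
      exact: (has_average_qeval hJ nonresonant).
    exact: (average_dist_le cs cq as0 aq (h n hn)).
  rewrite /qeval teval_tnz -/(qeval _ _ _ _).
  have -> : minus (s t) (minus (qev (psum p n) t) (zero_mode (psum p n))) =
    minus (minus (s t) (qev (psum p n) t)) (minus zero (zero_mode (psum p n))).
    by vec_eq V.
  apply: (Rle_trans _ _ _ (norm_minus_le _ _)); vlra.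
exists P; split=> //.
- have [L hL] : exists L, has_average P L.
    have qP : quasi (kappa - delta) (K * N) P.
      exists P, (fun _ => zero), (K * N), 0; split=> //; first exact: flat_zero.
        lra.
      by move=> t _; rewrite plus_zero_r.
    exact: quasi_average qP.
  suff -> : zero = L by [].
  apply/esym/norm_close_eq => d d0.
  have [n0 /(_ n0 (leqnn _)) h] := hP d d0.
  rewrite -tantider_psum in h.
  apply: (average_dist_le (g := qev (tantider J omega (psum p n0))) cP _ hL)
    => [|| t _ //]; first exact: continuous_Rplus_qeval.
  (* An antiderivative contains only modes of nonzero frequency, so it has average zero. *)
  suff -> : zero = zero_mode (tantider J omega (psum p n0)).
    exact: (has_average_qeval hJ nonresonant).
  elim: (psum p n0) => //= m q IH.
  rewrite /tantider /=; case: ifP => hm //=.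
  by rewrite -/(tantider J omega q) hm -IH plus_zero_l.
- move=> t t0; apply: norm_close_eq => d d0.
  (* The error consists of two boundary terms and an integral over [0, t], that is, at most 2 + t
     times the uniform precision. *)
  have d1 : 0 < d / (3 + t) by apply: Rdiv_lt_0_compat; lra.
  have [n1 h1] := hP _ d1; have [n2 h2] := nzp _ d1.
  have {}h1 := h1 (maxn n1 n2) (leq_maxl _ _).
  have {}h2 := h2 (maxn n1 n2) (leq_maxr _ _).
  move: (maxn n1 n2) h1 h2 => n; rewrite -tantider_psum => h1 h2.
  set Q := qev (tantider J omega (psum p n)) in h1.
  have cz : continuous_Rplus (qev (tnz (psum p n))).
    exact: continuous_Rplus_qeval.
  have eQ : RInt (qev (tnz (psum p n))) 0 t = minus (Q t) (Q 0).
    apply: RInt_Rplus_primitive => // u u0.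
    rewrite -(qderiv_tantider hJ nonresonant); apply: is_derive_is_derive_Rplus => //.
    exact: is_derive_qeval.
  have h3 : norm (RInt (fun u => minus (s u) (qev (tnz (psum p n)) u)) 0 t) <=
      t * (d / (3 + t)).
    apply: norm_RInt_Rplus_le_const => //; exact: continuous_Rplus_minus.
  rewrite RInt_minus in h3; try by apply: ex_RInt_Rplus => //; lra.
  have -> : minus (RInt s 0 t) (minus (P t) (P 0)) =
      plus (minus (RInt s 0 t) (RInt (qev (tnz (psum p n))) 0 t))
        (minus (minus (P 0) (Q 0)) (minus (P t) (Q t))).
    by rewrite eQ; vec_eq V.
  apply: (Rle_trans _ _ _ (norm_triangle _ _)).
  have := norm_minus_le (minus (P 0) (Q 0)) (minus (P t) (Q t)).
  have := h1 0; have := h1 t.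
  have ed : d = 3 * (d / (3 + t)) + t * (d / (3 + t)) by field; lra.
  vlra.
Qed.

(** The only place where analyticity width is lost. *)
Lemma quasi_centered_integral kappa N f : 0 <= kappa - delta ->
  quasi kappa N f -> has_average f zero ->
  exists m, has_average (fun t => RInt f 0 t) m /\
    quasi (kappa - delta) (K * N) (fun t => minus (RInt f 0 t) m).
Proof.
move=> k0 [s [b [S [F [hs hb hN e]]]]] af.
have cs := sharp_continuous hs; have [cb _] := hb; have F0 := flat_ge0 hb.
have as0 : has_average s zero.
  have qs : quasi kappa S s.
    exists s, (fun _ => zero), S, 0; split=> //; first exact: flat_zero.
      lra.
    by move=> t _; rewrite plus_zero_r.
  have [L hL] := quasi_average qs.
  suff -> : zero = L by [].
  apply: (has_average_unique af).
  have -> : L = plus L zero by rewrite plus_zero_r.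
  apply: (has_average_ext (f := fun t => plus (s t) (b t))).
    by move=> t t0; rewrite e.
  by apply: has_average_plus => //; exact: has_average_flat hb.
have [P [hP aP eP]] := sharp_primitive k0 hs as0.
have [beta hbeta] := flat_integral hb.
have cP := sharp_continuous hP.
have eI t : 0 <= t -> RInt f 0 t =
    plus (plus (P t) (minus (RInt b 0 t) beta)) (minus beta (P 0)).
  move=> t0.
  rewrite (RInt_ext f (fun u => plus (s u) (b u))); last first.
    by move=> u; rewrite Rmin_left ?Rmax_right //; move=> hu; apply: e; lra.
  rewrite RInt_plus; try by apply: ex_RInt_Rplus => //; lra.
  by rewrite eP //; vec_eq V.
(* P and the decaying remainder both have average zero, so the constant left in [eI] is the average
   of the primitive. *)
exists (minus beta (P 0)); split.
  apply: (has_average_ext (f := fun t =>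
    plus (plus (P t) (minus (RInt b 0 t) beta)) (minus beta (P 0)))).
    by move=> t t0; rewrite eI.
  rewrite -[X in has_average _ X](plus_zero_l (minus beta (P 0))).
  rewrite -[X in plus X (minus beta _)](plus_zero_l zero).
  have [cbeta _] := hbeta.
  apply: has_average_plus; [exact: continuous_Rplus_plus|exact: continuous_Rplus_const| |].
    by apply: has_average_plus => //; exact: has_average_flat hbeta.
  exact: has_average_const.
exists P, (fun t => minus (RInt b 0 t) beta), (K * S), F; split=> //.
  (* Only the quasi-periodic part picks up the factor K; since K >= 1, the bound K S + F is still at
     most K N. *)
  have S0 := sharp_ge0 hs; nra.
by move=> t t0; rewrite eI //; vec_eq V.
Qed.
End Integration.
End QuasiPeriodic.

(** * Integration over the torus *)

(** L commutes with Riemann sums by linearity, and the bound K lets it pass to their limit. *)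
Lemma RInt_linear_map (U V : CompleteNormedModule R_AbsRing) (L : U -> V) (K : R)
    (f : R -> U) (a b : R) :
  (forall x y, L (plus x y) = plus (L x) (L y)) ->
  (forall (c : R) x, L (scal c x) = scal c (L x)) ->
  (forall x, norm (L x) <= K * norm x) ->
  ex_RInt f a b -> is_RInt (fun x => L (f x)) a b (L (RInt f a b)).
Proof.
move=> LD LZ LK hf.
have L0 : L zero = zero.
  by have := LZ 0 zero; rewrite (scal_zero_l (zero : U)) => ->; exact: scal_zero_l.
have LB x y : minus (L x) (L y) = L (minus x y).
  by rewrite /minus LD -(scal_opp_one y) LZ scal_opp_one.
have := RInt_correct f a b hf; rewrite /is_RInt.
set F := Riemann_fine a b; move: (RInt f a b) => I.
move=> /filterlim_normP hI; apply/filterlim_normP => e e0.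
have K0 := Rabs_pos K.
have q0 : 0 < e / (1 + Rabs K) by apply: Rdiv_lt_0_compat; lra.
have := hI _ q0; apply: filter_imp => s hs.
have -> : Riemann_sum (fun x => L (f x)) s = L (Riemann_sum f s).
  move: s {hs}; apply: (@SF_cons_ind R) => [x|h s IH]; first by rewrite /Riemann_sum /= L0.
  by rewrite !Riemann_sum_cons LD LZ IH.
rewrite -LZ LB; apply: (Rle_trans _ _ _ (LK _)).
have n0 := norm_ge_0 (minus (scal (sign (b - a)) (Riemann_sum f s)) I).
apply: (Rle_trans _ (Rabs K * (e / (1 + Rabs K)))).
  apply: (Rle_trans _ _ _ (Rmult_le_compat_r _ _ _ n0 (Rle_abs K))).
  exact: Rmult_le_compat_l.
apply: (Rmult_le_reg_r (1 + Rabs K)); first lra.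
have -> : Rabs K * (e / (1 + Rabs K)) * (1 + Rabs K) = Rabs K * e by field; lra.
nra.
Qed.

Section ParametricIntegral.
Context (V : CompleteNormedModule R_AbsRing).

(** By the tube lemma, [f u'] is uniformly close to [f u] on [[a, b]] for [u']
    near [u]. *)
Lemma continuous_RInt_param (U : UniformSpace) (f : U -> R -> V) (a b : R) :
  a <= b ->
  (forall q : U * R, continuous (fun q : U * R => f q.1 q.2) q) ->
  forall u : U, continuous (fun u => RInt (f u) a b) u.
Proof.
move=> ab cf u; apply/continuous_normP => e e0.
have ef : 0 < e / (1 + (b - a)) by apply: Rdiv_lt_0_compat; lra.
set d := e / (1 + (b - a)) in ef.
have loc t : exists dt : posreal, forall (u' : U) (x : R),
    ball u dt u' -> Rabs (x - t) < dt -> norm (minus (f u' x) (f u t)) <= d / 2.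
  have [dt hdt] := (continuous_normP _ _).1 (cf (u, t)) (d / 2) ltac:(lra).
  by exists dt => u' x h1 h2; apply: (hdt (u', x)).
pose dl t := proj1_sig (constructive_indefinite_description _ (loc t)).
have hdl t : forall (u' : U) (x : R),
    ball u (dl t) u' -> Rabs (x - t) < dl t -> norm (minus (f u' x) (f u t)) <= d / 2.
  by rewrite /dl; case: constructive_indefinite_description.
have [d0 hd0] := compactness_value_1d a b dl.
have int u' : ex_RInt (f u') a b.
  apply: ex_RInt_continuous => x _.
  apply: (continuous_comp (fun x : R => (u', x)) (fun q : U * R => f q.1 q.2)).
    by move=> P [d1 hP]; exists d1 => y hy; apply: hP; split=> //; exact: ball_center.
  exact: cf.
exists d0 => u' hu'.
rewrite -RInt_minus //.
apply: (Rle_trans _ ((b - a) * d)); last first.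
  rewrite /d; apply: (Rmult_le_reg_r (1 + (b - a))); first lra.
  have -> : (b - a) * (e / (1 + (b - a))) * (1 + (b - a)) = (b - a) * e by field; lra.
  nra.
apply: (norm_RInt_le_const (fun x => minus (f u' x) (f u x)) a b) => // [x hx|].
  apply: Rnot_lt_le => hlt; apply: (hd0 x hx) => -[t [ht [h1 h2]]].
  have h3 := hdl t u' x (ball_le u _ _ h2 _ hu') h1.
  have h4 := hdl t u x (ball_center _ _) h1.
  have := norm_dist_triangle (f u t) (f u' x) (f u x).
  rewrite (norm_minusC (f u t)); vlra.
by apply: RInt_correct; exact: ex_RInt_minus.
Qed.
End ParametricIntegral.

Section Torus.
Context (V : CompleteNormedModule R_AbsRing).

Lemma PI2_ge0 : 0 <= 2 * PI.
Proof. by have := PI_RGT_0; lra. Qed.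

Lemma torus_cons_ball (r : nat) (x x' : R) (th th' : 'I_r -> R) (e : posreal) :
  ball x e x' -> ball (th : fct_UniformSpace 'I_r R_UniformSpace) e th' ->
  ball (torus_cons x th : fct_UniformSpace 'I_r.+1 R_UniformSpace) e (torus_cons x' th').
Proof. by move=> hx hth i; rewrite /torus_cons; case: unlift. Qed.

Lemma torus_cons_eta (r : nat) (theta : 'I_r.+1 -> R) :
  torus_cons (theta ord0) (fun j => theta (lift ord0 j)) = theta.
Proof.
apply: functional_extensionality => i; rewrite /torus_cons.
by case: unliftP => [j|] ->.
Qed.

Lemma dot_torus_cons (r : nat) (m : Z) (alpha : 'I_r -> Z) x (theta : 'I_r -> R) :
  dot (fun i => if unlift ord0 i is Some j then alpha j else m) (torus_cons x theta) =
  IZR m * x + dot alpha theta.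
Proof.
rewrite /dot big_ord_recl /torus_cons unlift_none; congr Rplus.
by apply: eq_bigr => i _; rewrite liftK.
Qed.

(** The parameter space is arbitrary because the induction on r enlarges it: to integrate over one
    more variable, the inner integral must be jointly continuous on U * R. *)
Lemma continuous_torus_int (r : nat) (U : UniformSpace) (f : U -> ('I_r -> R) -> V) :
  (forall q : U * ('I_r -> R),
     continuous (fun q : U * ('I_r -> R) => f q.1 q.2) q) ->
  forall u : U, continuous (fun u => torus_int (f u)) u.
Proof.
elim: r U f => [|r IH] U f cf u /=.
  apply: (continuous_comp (fun u : U => (u, (fun _ => 0) : 'I_0 -> R))
    (fun q : U * ('I_0 -> R) => f q.1 q.2)) => //.
  by move=> P [d hP]; exists d => y hy; apply: hP; split=> //; exact: ball_center.
apply: (continuous_RInt_param PI2_ge0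
  (f := fun u x => torus_int (fun theta => f u (torus_cons x theta)))) => q.
apply: (IH _ (fun (q : U * R) theta => f q.1 (torus_cons q.2 theta))) => -[[u' x] th].
apply: (continuous_comp
  (fun p : U * R * ('I_r -> R) => (p.1.1, torus_cons p.1.2 p.2) : U * ('I_r.+1 -> R))
  (fun q : U * ('I_r.+1 -> R) => f q.1 q.2)) => //.
move=> P [d hP]; exists d => -[[u2 x2] th2] [[h1 h2] h3]; apply: hP; split=> //=.
exact: torus_cons_ball.
Qed.

Lemma continuous_torus_slice (r : nat) (f : ('I_r.+1 -> R) -> V) :
  (forall theta : 'I_r.+1 -> R, continuous f theta) ->
  forall q : R * ('I_r -> R),
    continuous (fun q : R * ('I_r -> R) => f (torus_cons q.1 q.2)) q.
Proof.
move=> cf q; apply: (continuous_comp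
  (fun p : R * ('I_r -> R) => torus_cons p.1 p.2) f) => //.
by move=> P [d hP]; exists d => -[x2 th2] [h1 h2]; apply: hP; exact: torus_cons_ball.
Qed.

Lemma continuous_torus_slice1 (r : nat) (f : ('I_r.+1 -> R) -> V) x :
  (forall theta : 'I_r.+1 -> R, continuous f theta) ->
  forall theta : 'I_r -> R, continuous (fun th => f (torus_cons x th)) theta.
Proof.
move=> cf th; apply: (continuous_comp (fun th : 'I_r -> R => torus_cons x th) f) => //.
move=> P [d hP]; exists d => th2 h2; apply: hP; apply: torus_cons_ball => //.
exact: ball_center.
Qed.

Lemma ex_RInt_torus (r : nat) (f : ('I_r.+1 -> R) -> V) a b :
  (forall theta : 'I_r.+1 -> R, continuous f theta) ->
  ex_RInt (fun x => torus_int (fun theta => f (torus_cons x theta))) a b.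
Proof.
move=> cf; apply: ex_RInt_continuous => x _.
apply: (continuous_torus_int (f := fun (x : R) theta => f (torus_cons x theta))).
exact: continuous_torus_slice.
Qed.

Lemma torus_int_minus (r : nat) (f g : ('I_r -> R) -> V) :
  (forall theta : 'I_r -> R, continuous f theta) ->
  (forall theta : 'I_r -> R, continuous g theta) ->
  torus_int (fun theta => minus (f theta) (g theta)) = minus (torus_int f) (torus_int g).
Proof.
elim: r f g => //= r IH f g cf cg.
rewrite -RInt_minus; try exact: ex_RInt_torus.
by apply: RInt_ext => x _; apply: IH; exact: continuous_torus_slice1.
Qed.

Lemma torus_int_plus (r : nat) (f g : ('I_r -> R) -> V) :
  (forall theta : 'I_r -> R, continuous f theta) ->
  (forall theta : 'I_r -> R, continuous g theta) ->
  torus_int (fun theta => plus (f theta) (g theta)) = plus (torus_int f) (torus_int g).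
Proof.
elim: r f g => //= r IH f g cf cg.
rewrite -RInt_plus; try exact: ex_RInt_torus.
by apply: RInt_ext => x _; apply: IH; exact: continuous_torus_slice1.
Qed.

Lemma norm_torus_int_le (r : nat) (f : ('I_r -> R) -> V) M :
  (forall theta : 'I_r -> R, continuous f theta) ->
  (forall theta, norm (f theta) <= M) -> norm (torus_int f) <= (2 * PI) ^ r * M.
Proof.
elim: r f => [|r IH] f cf fM /=; first by have := fM (fun _ => 0); lra.
have -> : 2 * PI * (2 * PI) ^ r * M = (2 * PI - 0) * ((2 * PI) ^ r * M) by ring.
apply: (norm_RInt_le_const (fun x => torus_int (fun theta => f (torus_cons x theta)))).
- exact: PI2_ge0.
- by move=> x _; apply: IH => //; exact: continuous_torus_slice1.
- apply: RInt_correct; exact: ex_RInt_torus.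
Qed.

Lemma torus_int_linear_map (r : nat) (L : V -> V) (f : ('I_r -> R) -> V) :
  (forall x y, L (plus x y) = plus (L x) (L y)) ->
  (forall (c : R) x, L (scal c x) = scal c (L x)) ->
  (forall x, norm (L x) <= norm x) ->
  (forall theta : 'I_r -> R, continuous f theta) ->
  torus_int (fun theta => L (f theta)) = L (torus_int f).
Proof.
move=> LD LZ LK; elim: r f => //= r IH f cf.
apply: is_RInt_unique.
apply: (is_RInt_ext (fun x => L (torus_int (fun theta => f (torus_cons x theta))))).
  by move=> x _; rewrite IH //; exact: continuous_torus_slice1.
apply: (RInt_linear_map (K := 1)) => // [x|]; first by rewrite Rmult_1_l.
exact: ex_RInt_torus.
Qed.
End Torus.

(** * Uniqueness of Fourier coefficients *)

Lemma cos_sin_period x (k : Z) :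
  cos (x + 2 * PI * IZR k) = cos x /\ sin (x + 2 * PI * IZR k) = sin x.
Proof.
have key (y : R) (n : nat) : cos (y + 2 * PI * INR n) = cos y /\
    sin (y + 2 * PI * INR n) = sin y.
  have -> : y + 2 * PI * INR n = y + 2 * INR n * PI by ring.
  by rewrite cos_period sin_period.
have [k0|k0] := Z_le_gt_dec 0 k.
  by have -> : IZR k = INR (Z.to_nat k) by rewrite INR_IZR_INZ Z2Nat.id.
have ek : IZR k = - INR (Z.to_nat (- k)).
  by rewrite INR_IZR_INZ Z2Nat.id; [rewrite opp_IZR; ring | lia].
have [c s] := key (x + 2 * PI * IZR k) (Z.to_nat (- k)).
by rewrite -c -s ek; split; congr (_ _); ring.
Qed.

(** Away from 0 and from the other multiples of the period, the cosine stays below its value at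
    distance d; this bounds the kernels off their peak. *)
Lemma cos_far_le y d : 0 < d <= PI -> d <= Rabs y <= 2 * PI - d -> cos y <= cos d.
Proof.
have P := PI_RGT_0.
move=> hd hy.
have -> : cos y = cos (Rabs y) by rewrite /Rabs; case: Rcase_abs; rewrite ?cos_neg.
have [h|h] := Rle_or_lt (Rabs y) PI; first by apply: cos_decr_1; lra.
have -> : cos (Rabs y) = cos (2 * PI - Rabs y).
  rewrite -(cos_neg (Rabs y)); have [<- _] := cos_sin_period (- Rabs y) 1.
  by congr cos; rewrite Rmult_1_r; ring.
by apply: cos_decr_1; lra.
Qed.

Section Uniqueness.
Context (V : CompleteNormedModule R_AbsRing) (J : V -> V).
Hypothesis hJ : complex_structure J.

Lemma phase_period x (k : Z) y : phase J (x + 2 * PI * IZR k) y = phase J x y.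
Proof. by rewrite /phase; have [-> ->] := cos_sin_period x k. Qed.

Lemma phase_bounded_linear t :
  (forall x y, phase J t (plus x y) = plus (phase J t x) (phase J t y)) /\
  (forall (c : R) x, phase J t (scal c x) = scal c (phase J t x)).
Proof. by split=> *; [exact: phase_plus | exact: phase_scal]. Qed.

Lemma scal_cos_phase t y :
  scal (cos t) y = plus (scal (/ 2) (phase J t y)) (scal (/ 2) (phase J (- t) y)).
Proof. by rewrite /phase cos_neg sin_neg; vec_eq V; field. Qed.

Section OneVariable.
Context (h : R -> V).
Hypothesis ch : forall x : R, continuous h x.
Hypothesis coef0 : forall m : Z,
  RInt (fun x => phase J (- (IZR m * x)) (h x)) 0 (2 * PI) = zero.

Definition kern (x0 : R) (n : nat) (x : R) : R := (1 + cos (x - x0)) ^ n.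

Lemma kern_ge0 x0 n x : 0 <= kern x0 n x.
Proof. by apply: pow_le; have := COS_bound (x - x0); lra. Qed.

Lemma continuous_kern x0 n (x : R) : continuous (kern x0 n) x.
Proof. by apply: ex_derive_continuous; rewrite /kern; auto_derive. Qed.

Lemma continuous_kern_phase x0 n (m : Z) (x : R) :
  continuous (fun x => phase J (- (IZR m * x)) (scal (kern x0 n x) (h x))) x.
Proof.
apply: (continuous_phase hJ); last by apply: continuous_scal => //; exact: continuous_kern.
by apply: (ex_derive_continuous (V := R_NormedModule)); auto_derive.
Qed.

(** Multiplying by 1 + cos (x - x0) combines the frequencies m, m - 1 and m + 1. An induction on n,
    for all m at once, thus reduces to the vanishing coefficients of h, with no expansion of the
    power. *)
Lemma RInt_kern x0 n (m : Z) :
  RInt (fun x => phase J (- (IZR m * x)) (scal (kern x0 n x) (h x))) 0 (2 * PI) = zero.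
Proof.
elim: n m => [|n IH] m.
  rewrite -[RHS](coef0 m); apply: RInt_ext => x _.
  by rewrite /kern /=; congr phase; vec_eq V.
set g := fun m x => phase J (- (IZR m * x)) (scal (kern x0 n x) (h x)).
have exg k : ex_RInt (g k) 0 (2 * PI).
  by apply: ex_RInt_continuous => x _; exact: continuous_kern_phase.
have Lg t k : is_RInt (fun x => scal (/ 2) (phase J t (g k x))) 0 (2 * PI) zero.
  have -> : zero = scal (/ 2) (phase J t (RInt (g k) 0 (2 * PI))).
    by rewrite IH (phase_zero hJ) scal_zero_r.
  have [pD pZ] := phase_bounded_linear t.
  apply: is_RInt_scal; apply: (RInt_linear_map (K := 1)) => // y.
  by rewrite Rmult_1_l; exact: norm_phase_le.
apply: is_RInt_unique.
apply: (is_RInt_ext (fun x => plus (g m x)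
  (plus (scal (/ 2) (phase J (- x0) (g (m - 1)%Z x)))
        (scal (/ 2) (phase J x0 (g (m + 1)%Z x)))))).
  move=> x _; rewrite /g !(phase_phase hJ) minus_IZR plus_IZR.
  have -> : - x0 + - ((IZR m - 1) * x) = (- (IZR m * x)) + (x - x0) by ring.
  have -> : x0 + - ((IZR m + 1) * x) = (- (IZR m * x)) + - (x - x0) by ring.
  rewrite -!(phase_phase hJ) -!(phase_scal hJ) -!(phase_plus hJ); congr phase.
  rewrite !(phase_scal hJ).
  have -> : scal (kern x0 n.+1 x) (h x) =
    plus (scal (kern x0 n x) (h x)) (scal (kern x0 n x) (scal (cos (x - x0)) (h x))).
    by rewrite /kern /=; vec_eq V.
  by rewrite scal_cos_phase !(phase_phase hJ) -/(Rminus x x0); vec_eq V.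
rewrite -[X in is_RInt _ _ _ X](plus_zero_l (zero : V)).
apply: is_RInt_plus; first by rewrite -(IH m); exact: RInt_correct.
rewrite -[X in is_RInt _ _ _ X](plus_zero_l (zero : V)).
exact: is_RInt_plus.
Qed.

(** The kernel is nonnegative, so its integral is at least that over [x0 - d/2, x0 + d/2], where
    each factor is at least 1 + cos (d / 2). *)
Lemma RInt_kern_ge x0 n d : 0 < d -> d <= x0 -> d <= 2 * PI - x0 ->
  d * (1 + cos (d / 2)) ^ n <= RInt (kern x0 n) 0 (2 * PI).
Proof.
move=> d0 d1 d2.
have ek a b : ex_RInt (kern x0 n) a b.
  by apply: ex_RInt_continuous => x _; exact: continuous_kern.
have ge0 a b : a <= b -> 0 <= RInt (kern x0 n) a b.
  by move=> ab; apply: RInt_ge_0 => // x _; exact: kern_ge0.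
rewrite -(RInt_Chasles _ 0 (x0 - d / 2) (2 * PI)) //.
rewrite -(RInt_Chasles _ (x0 - d / 2) (x0 + d / 2) (2 * PI)) //.
have g1 := ge0 0 (x0 - d / 2) ltac:(lra).
have g2 := ge0 (x0 + d / 2) (2 * PI) ltac:(lra).
suff : d * (1 + cos (d / 2)) ^ n <= RInt (kern x0 n) (x0 - d / 2) (x0 + d / 2).
  by rewrite /plus /=; lra.
have -> : d * (1 + cos (d / 2)) ^ n =
  RInt (fun _ => (1 + cos (d / 2)) ^ n) (x0 - d / 2) (x0 + d / 2).
  by rewrite RInt_const /scal /= /mult /=; field.
apply: RInt_le => //; [lra | exact: ex_RInt_const |] => x hx.
have P := PI_RGT_0.
apply: pow_incr; split; first by have := COS_bound (d / 2); lra.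
apply: Rplus_le_compat_l.
have -> : cos (x - x0) = cos (Rabs (x - x0)).
  by rewrite /Rabs; case: Rcase_abs; rewrite ?cos_neg.
have h1 : Rabs (x - x0) <= d / 2 by apply: Rabs_le; lra.
have h2 := Rabs_pos (x - x0).
by apply: cos_decr_1; lra.
Qed.

(** The kernels [(1 + cos (x - x0))^n] concentrate at [x0]. *)
Lemma fourier_unique_interior x0 : 0 < x0 < 2 * PI -> h x0 = zero.
Proof.
move=> hx0; have P := PI_RGT_0.
apply: norm_small_eq0 => e0 e00.
have [e [e0' ->]] : exists e, 0 < e /\ e0 = 2 * e by exists (e0 / 2); split; lra.
have [d1 hd1] := (continuous_normP _ _).1 (@ch x0) e e0'.
(* Besides continuity at x0, the distance to both ends matters: a point of [0, 2 PI] at distance at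
   least d from x0 is then also at distance at most 2 PI - d, hence away from the other peaks of the
   kernel. *)
set d := Rmin d1 (Rmin x0 (2 * PI - x0)).
have d0 : 0 < d.
  by apply: Rmin_pos; [exact: cond_pos | apply: Rmin_pos; lra].
have dd1 : d <= d1 := Rmin_l _ _.
have dx : d <= x0 := Rle_trans _ _ _ (Rmin_r _ _) (Rmin_l _ _).
have dx2 : d <= 2 * PI - x0 := Rle_trans _ _ _ (Rmin_r _ _) (Rmin_r _ _).
have [M hM] : exists M, forall x, 0 <= x <= 2 * PI -> norm (h x) <= M.
  have cn (x : R) : 0 <= x <= 2 * PI -> continuity_pt (fun x => norm (h x)) x.
    move=> _; apply/continuity_pt_filterlim.
    exact: (continuous_comp h _ x (@ch x) (filterlim_norm _)).
  have [c [hc _]] := continuity_ab_maj _ 0 (2 * PI) ltac:(lra) cn.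
  by exists (norm (h c)).
have M0 : 0 <= M := Rle_trans _ _ _ (norm_ge_0 _) (hM x0 ltac:(lra)).
set A := 1 + cos d; set B := 1 + cos (d / 2).
have A0 : 0 <= A by rewrite /A; have := COS_bound d; lra.
have AB : A < B by rewrite /A /B; apply: Rplus_lt_compat_l; apply: cos_decreasing_1; lra.
(* As the kernel is orthogonal to h, its integral times h x0 is the integral of the kernel times h
   x0 - h x: at most e times the kernel near x0, and at most 2 M A^n elsewhere. *)
have main n : norm (h x0) * (d * B ^ n) <= e * (d * B ^ n) + 4 * PI * M * A ^ n.
  set I := RInt (kern x0 n) 0 (2 * PI).
  have hI : d * B ^ n <= I by exact: RInt_kern_ge.
  have ek : ex_RInt (kern x0 n) 0 (2 * PI).
    by apply: ex_RInt_continuous => x _; exact: continuous_kern.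
  have ekh : ex_RInt (fun x => scal (kern x0 n x) (h x)) 0 (2 * PI).
    by apply: ex_RInt_continuous => x _; apply: continuous_scal => //; exact: continuous_kern.
  have i1 : is_RInt (fun x => scal (kern x0 n x) (h x)) 0 (2 * PI) zero.
    have := RInt_correct _ _ _ ekh.
    rewrite (RInt_ext _ (fun x => phase J (- (IZR 0 * x)) (scal (kern x0 n x) (h x)))).
      by rewrite RInt_kern.
    by move=> x _; rewrite Rmult_0_l Ropp_0 phase_0.
  have i2 : is_RInt (fun x => scal (kern x0 n x) (h x0)) 0 (2 * PI) (scal I (h x0)).
    apply: (RInt_linear_map (U := R_CompleteNormedModule) (L := fun c => scal c (h x0))
      (K := norm (h x0))) => // [x y|c x|x].
    - exact: scal_distr_r.
    - exact: (esym (scal_assoc c x (h x0))).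
    - rewrite Rmult_comm; exact: norm_scal_le.
  have i3 := is_RInt_minus _ _ _ _ _ _ i2 i1.
  have i4 : is_RInt (fun x => e * kern x0 n x + 2 * M * A ^ n) 0 (2 * PI)
      (e * I + 4 * PI * M * A ^ n).
    have -> : e * I + 4 * PI * M * A ^ n =
        plus (scal e I) (scal (2 * PI - 0) (2 * M * A ^ n)).
      by rewrite /plus /scal /= /mult /=; ring.
    apply: (is_RInt_plus (V := R_NormedModule)); last exact: is_RInt_const.
    by apply: (is_RInt_scal (V := R_NormedModule)); exact: RInt_correct.
  have key : norm (minus (scal I (h x0)) zero) <= e * I + 4 * PI * M * A ^ n.
    apply: (norm_RInt_le _ _ 0 (2 * PI) _ _ ltac:(lra) _ i3 i4) => x hx.
    have -> : minus (scal (kern x0 n x) (h x0)) (scal (kern x0 n x) (h x)) =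
      scal (kern x0 n x) (minus (h x0) (h x)) by vec_eq V.
    apply: (Rle_trans _ _ _ (norm_scal_le _ _)).
    have kp := kern_ge0 x0 n x; rewrite (Rabs_pos_eq _ kp).
    have An := pow_le A n A0.
    have [near|far] := Rlt_or_le (Rabs (x - x0)) d.
      have hh : norm (minus (h x0) (h x)) <= e.
        by rewrite norm_minusC; apply: hd1; apply: Rlt_le_trans dd1.
      have := Rmult_le_compat_l _ _ _ kp hh.
      have : 0 <= 2 * M * A ^ n by apply: Rmult_le_pos => //; lra.
      vlra.
    have k2 : kern x0 n x <= A ^ n.
      apply: pow_incr; split; first by have := COS_bound (x - x0); lra.
      apply: Rplus_le_compat_l; apply: cos_far_le; first by split=> //; lra.
      split=> //; apply: Rabs_le; lra.
    have m2 : norm (minus (h x0) (h x)) <= 2 * M.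
      apply: (Rle_trans _ _ _ (norm_minus_le _ _)).
      by have := hM x hx; have := hM x0 ltac:(lra); lra.
    have := Rmult_le_compat _ _ _ _ kp (norm_ge_0 _) k2 m2.
    by have := Rmult_le_pos _ _ (Rlt_le _ _ e0') kp; vlra.
  rewrite minus_zero_r in key.
  have Ip : 0 < I.
    by apply: Rlt_le_trans hI; apply: Rmult_lt_0_compat => //; apply: pow_lt; lra.
  have hk : norm (h x0) * I <= e * I + 4 * PI * M * A ^ n.
    have -> : norm (h x0) * I = I * norm (scal (/ I) (scal I (h x0))).
      rewrite Rmult_comm; congr (_ * norm _); vec_eq V; field; lra.
    apply: Rle_trans key.
    apply: (Rle_trans _ (I * (Rabs (/ I) * norm (scal I (h x0))))).
      by apply: Rmult_le_compat_l; [lra | exact: norm_scal_le].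
    rewrite Rabs_pos_eq; last by apply/Rlt_le/Rinv_0_lt_compat.
    by rewrite -Rmult_assoc Rinv_r; lra.
  (* Replacing I by its lower bound d B^n in [hk] is legitimate only if the coefficient |h x0| - e
     is positive; otherwise the claim is immediate. *)
  have [he|he] := Rle_or_lt (norm (h x0)) e.
    have : 0 <= 4 * PI * M * A ^ n.
      by apply: Rmult_le_pos; [nra | exact: pow_le].
    have : 0 <= d * B ^ n by apply: Rmult_le_pos; [lra | apply: pow_le; lra].
    nra.
  nra.
have B0 : 0 < B by lra.
(* Off-peak values over near-peak values: A < B because the cosine decreases from d / 2 to d, so q^N
   tends to zero and beats the constant 4 PI M. *)
set q := A / B.
have q1 : Rabs q < 1.
  rewrite Rabs_pos_eq; last by apply: Rdiv_le_0_compat.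
  by apply: (Rmult_lt_reg_r B) => //; rewrite /q; field_simplify; lra.
have [N hN] := pow_lt_1_zero q q1 (e * d / (4 * PI * M + 1)) ltac:(
  apply: Rdiv_lt_0_compat; nra).
have {}hN := hN N (le_n N).
have qN : 0 <= q ^ N by apply: pow_le; apply: Rdiv_le_0_compat.
rewrite (Rabs_pos_eq _ qN) in hN.
have BN : 0 < B ^ N by exact: pow_lt.
have eA : A ^ N = q ^ N * B ^ N.
  by rewrite -Rpow_mult_distr; congr pow; rewrite /q; field; lra.
have hq : (4 * PI * M + 1) * q ^ N <= e * d.
  have -> : e * d = (4 * PI * M + 1) * (e * d / (4 * PI * M + 1)) by field; nra.
  by apply: Rmult_le_compat_l; [nra | lra].
have := main N; rewrite eA => mN.
have : norm (h x0) * d <= e * d + 4 * PI * M * q ^ N.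
  apply: (Rmult_le_reg_r (B ^ N)) => //; lra.
move=> mN2; apply: (Rmult_le_reg_r d) => //; lra.
Qed.
End OneVariable.

(** The kernel argument needs room on both sides of x0, so it covers the open interval; the endpoint
    0 follows by continuity, the other reals by periodicity. *)
Lemma fourier_unique_1d (h : R -> V) :
  (forall x : R, continuous h x) ->
  (forall x (k : Z), h (x + 2 * PI * IZR k) = h x) ->
  (forall m : Z, RInt (fun x => phase J (- (IZR m * x)) (h x)) 0 (2 * PI) = zero) ->
  forall x, h x = zero.
Proof.
move=> ch per coef0 x; have P := PI_RGT_0.
have int := fourier_unique_interior ch coef0.
have h0 : h 0 = zero.
  apply: norm_small_eq0 => e e0.
  have [d hd] := (continuous_normP _ _).1 (ch 0) e e0.
  have dp := cond_pos d.
  have m0 : 0 < Rmin (d / 2) PI by apply: Rmin_pos; lra.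
  have m1 := Rmin_l (d / 2) PI; have m2 := Rmin_r (d / 2) PI.
  have := hd (Rmin (d / 2) PI); rewrite int; last lra.
  rewrite norm_minusC minus_zero_r; apply.
  rewrite /ball /= /AbsRing_ball /= /abs /= /minus /plus /opp /=.
  by rewrite Rabs_pos_eq; lra.
(* [up] minus one serves as a floor, so that y is the representative of x in [0, 2 PI). *)
have [a1 a2] := archimed (x / (2 * PI)).
set k := (up (x / (2 * PI)) - 1)%Z.
have ek : IZR k = IZR (up (x / (2 * PI))) - 1 by rewrite /k minus_IZR.
set y := x - 2 * PI * IZR k.
have ey : x = y + 2 * PI * IZR k by rewrite /y; ring.
have y0 : 0 <= y < 2 * PI.
  have -> : y = (x / (2 * PI) - IZR (up (x / (2 * PI))) + 1) * (2 * PI).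
    by rewrite /y ek; field; lra.
  by split; nra.
rewrite ey per; have [yp|<- //] := Rle_lt_or_eq_dec _ _ y0.1.
by apply: int; lra.
Qed.

Lemma continuous_dot (r : nat) (alpha : 'I_r -> Z) (theta : 'I_r -> R) :
  continuous (dot alpha) theta.
Proof.
rewrite /dot; elim: (index_enum _) => [|i s IH].
  apply: (continuous_ext (fun _ => 0)); last exact: continuous_const.
  by move=> th; rewrite big_nil.
apply: (continuous_ext (fun th : 'I_r -> R => plus (scal (IZR (alpha i)) (th i))
  (\big[Rplus/0]_(j <- s) (IZR (alpha j) * th j)))).
  by move=> th; rewrite big_cons.
apply: (continuous_plus (V := R_NormedModule)) => //.
apply: (continuous_scal (V := R_NormedModule)); first exact: continuous_const.
by move=> Q [d hQ]; exists d => th hth; apply: hQ; exact: hth.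
Qed.

(** Induction on r. For a fixed frequency in the last r variables, the partial coefficient is a
    continuous periodic function [H] of the first one, whose own coefficients are coefficients of f.
    So [H] vanishes, and the induction hypothesis applies to each slice. *)
Lemma fourier_unique (r : nat) (f : ('I_r -> R) -> V) :
  (forall theta : 'I_r -> R, continuous f theta) ->
  (forall (theta : 'I_r -> R) (m : 'I_r -> Z),
     f (fun i => theta i + 2 * PI * IZR (m i)) = f theta) ->
  (forall alpha : 'I_r -> Z,
     torus_int (fun theta => phase J (- dot alpha theta) (f theta)) = zero) ->
  forall theta, f theta = zero.
Proof.
elim: r f => [|r IH] f cf per coef0 theta.
  have := coef0 (fun _ => 0%Z) => /=; rewrite /dot big_ord0 Ropp_0 phase_0 => <-.
  by congr f; apply: functional_extensionality => -[].
rewrite -(torus_cons_eta theta); move: (theta ord0) (fun j => _) => x th.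
move: th; apply: IH => [th|th m|alpha].
- exact: continuous_torus_slice1.
- rewrite -[RHS](per _ (fun i => if unlift ord0 i is Some j then m j else 0%Z)).
  congr f; apply: functional_extensionality => i; rewrite /torus_cons.
  by case: unlift => [j|] //; ring.
set H := fun x => torus_int (fun th => phase J (- dot alpha th) (f (torus_cons x th))).
have cphase (q : R * ('I_r -> R)) :
    continuous (fun q : R * ('I_r -> R) =>
      phase J (- dot alpha q.2) (f (torus_cons q.1 q.2))) q.
  apply: (continuous_phase hJ); last exact: continuous_torus_slice.
  apply: (continuous_opp (V := R_NormedModule)).
  apply: (continuous_comp (fun q : R * ('I_r -> R) => q.2) (dot alpha)).
    exact: continuous_snd.
  exact: continuous_dot.
suff : forall x, H x = zero by apply.
apply: fourier_unique_1d => [y|y k|m].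
- apply: (continuous_torus_int (f := fun (x : R) th =>
    phase J (- dot alpha th) (f (torus_cons x th)))) => q; exact: cphase q.
- rewrite /H; congr torus_int; apply: functional_extensionality => th; congr phase.
  rewrite -[RHS](per _ (fun i => if unlift ord0 i is Some j then 0%Z else k)).
  congr f; apply: functional_extensionality => i; rewrite /torus_cons.
  by case: unlift => [j|] //; ring.
rewrite -[RHS](coef0 (fun i => if unlift ord0 i is Some j then alpha j else m)) /=.
apply: RInt_ext => y _.
have [pD pZ] := phase_bounded_linear (- (IZR m * y)).
rewrite /H -torus_int_linear_map //.
- congr torus_int; apply: functional_extensionality => th.
  rewrite (phase_phase hJ) dot_torus_cons; congr phase; ring.
- by move=> z; exact: norm_phase_le.
- move=> th; apply: (continuous_phase hJ); last exact: continuous_torus_slice1.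
  apply: (continuous_opp (V := R_NormedModule)); exact: continuous_dot.
Qed.
End Uniqueness.

(** * Fourier inversion *)

Lemma freq_nz_recl (r : nat) (g : 'I_r.+1 -> Z) :
  freq_nz g = ~~ Z.eqb (g ord0) 0 || freq_nz (fun j => g (lift ord0 j)).
Proof.
apply/freq_nzP/orP => [[i hi]|[h0|/freq_nzP [j hj]]].
- case: (unliftP ord0 i) hi => [j ->|->] hi; last by left; apply/negP => /Z.eqb_spec.
  by right; apply/freq_nzP; exists j.
- by exists ord0; move/negP: h0 => h0 e; apply: h0; rewrite e.
- by exists (lift ord0 j).
Qed.

Lemma dot_recl (r : nat) (g : 'I_r.+1 -> Z) x (theta : 'I_r -> R) :
  dot g (torus_cons x theta) =
  IZR (g ord0) * x + dot (fun j => g (lift ord0 j)) theta.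
Proof.
rewrite /dot big_ord_recl /torus_cons unlift_none; congr Rplus.
by apply: eq_bigr => i _; rewrite liftK.
Qed.

Section Inversion.
Context (V : CompleteNormedModule R_AbsRing) (J : V -> V).
Hypothesis hJ : complex_structure J.

Lemma RInt_phase (m : Z) (c : V) :
  is_RInt (fun x => phase J (IZR m * x) c) 0 (2 * PI)
    (if Z.eqb m 0 then scal (2 * PI) c else zero).
Proof.
case: Z.eqb_spec => [->|m0].
  apply: (is_RInt_ext (fun _ => c)).
    by move=> x _; rewrite Rmult_0_l phase_0.
  by have := is_RInt_const 0 (2 * PI) c; rewrite Rminus_0_r.
have m1 : IZR m <> 0 by move=> /eq_IZR_R0.
pose F x := phase J (IZR m * x) (scal (- / IZR m) (J c)).
have -> : zero = minus (F (2 * PI)) (F 0).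
  have -> : F (2 * PI) = F 0.
    rewrite /F Rmult_0_r -(phase_period J 0 m); congr phase; ring.
  by rewrite minus_eq_zero.
have dF (x : R) : is_derive F x (phase J (IZR m * x) c).
  evar_last; first exact: (is_derive_phase hJ).
  rewrite (J_scal hJ) (J_J hJ) -(scal_opp_one c) !(phase_scal hJ).
  by vec_eq V; rewrite ?/one ?/opp /=; field.
apply: is_RInt_derive => x _; first exact: dF.
apply: (continuous_phase hJ); last exact: continuous_const.
by apply: (ex_derive_continuous (V := R_NormedModule)); auto_derive.
Qed.

Lemma torus_int_phase (r : nat) (g : 'I_r -> Z) (c : V) :
  torus_int (fun theta => phase J (dot g theta) c) =
  if freq_nz g then zero else scal ((2 * PI) ^ r) c.
Proof.
elim: r g c => [|r IH] g c.
  have -> : freq_nz g = false by case h: freq_nz => //; have [[]] := elimT (freq_nzP g) h.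
  by rewrite /= /dot big_ord0 phase_0; vec_eq V.
rewrite freq_nz_recl /=.
set g' := fun j => g (lift ord0 j).
apply: is_RInt_unique.
apply: (is_RInt_ext (fun x => if freq_nz g' then zero else
    scal ((2 * PI) ^ r) (phase J (IZR (g ord0) * x) c))).
  move=> x _; rewrite -IH; congr torus_int; apply: functional_extensionality => th.
  by rewrite (phase_phase hJ) dot_recl Rplus_comm.
case: (freq_nz g'); rewrite ?orbT ?orbF.
  have := is_RInt_const 0 (2 * PI) (zero : V); by rewrite scal_zero_r.
have := is_RInt_scal _ _ _ ((2 * PI) ^ r) _ (@RInt_phase (g ord0) c).
case: Z.eqb => /=; last by rewrite scal_zero_r.
by congr is_RInt; vec_eq V.
Qed.

Lemma continuous_teval (r : nat) (p : trig V r) (theta : 'I_r -> R) :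
  continuous (teval J p) theta.
Proof.
elim: p => [|m p IH] /=; first exact: continuous_const.
apply: continuous_plus => //.
by apply: (continuous_phase hJ); [exact: continuous_dot | exact: continuous_const].
Qed.

Lemma teval_periodic (r : nat) (p : trig V r) theta (m : 'I_r -> Z) :
  teval J p (fun i => theta i + 2 * PI * IZR (m i)) = teval J p theta.
Proof.
elim: p => //= q p ->; congr plus.
have [k ->] : exists k : Z, dot q.1 (fun i => theta i + 2 * PI * IZR (m i)) =
    dot q.1 theta + 2 * PI * IZR k.
  rewrite /dot; elim/big_rec2: _ => [|i x y _ [k ->]].
    by exists 0%Z; ring.
  by exists (q.1 i * m i + k)%Z; rewrite plus_IZR mult_IZR; ring.
exact: phase_period.
Qed.

Section Enumeration.
Context (r : nat).
Implicit Types alpha beta : 'I_r -> Z.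

(** An injection of the frequencies into nat: positive and negative parts turn a frequency into a
    finite function with values in a countable type. *)
Definition freq_code alpha : nat :=
  pickle [ffun i => (Z.to_nat (alpha i), Z.to_nat (- alpha i)) : nat * nat].

Lemma freq_code_inj alpha beta : freq_code alpha = freq_code beta -> alpha = beta.
Proof.
move=> /(pcan_inj pickleK) /ffunP h; apply: functional_extensionality => i.
by have := h i; rewrite !ffunE => -[]; lia.
Qed.

Definition freq_sub alpha beta : 'I_r -> Z := fun i => (alpha i - beta i)%Z.

Lemma dot_sub alpha beta theta :
  dot (freq_sub alpha beta) theta = dot alpha theta - dot beta theta.
Proof.
rewrite /dot; elim/big_rec3: _ => [|i x y z _ ->]; first by rewrite Rminus_0_r.
by rewrite /freq_sub minus_IZR; ring.
Qed.

Lemma freq_nz_sub alpha beta : freq_nz (freq_sub alpha beta) = false <-> alpha = beta.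
Proof.
split=> [/freq_nzN h|->].
  apply: functional_extensionality => i.
  by have := f_equal (fun g => g i) h; rewrite /freq_sub /freq_zero; lia.
case h: freq_nz => //; have [i] := elimT (freq_nzP _) h.
by rewrite /freq_sub; lia.
Qed.

Context (c : ('I_r -> Z) -> V).

(** Block n holds the mode of the frequency coded by n, or nothing if n codes none. Each frequency
    thus occurs in exactly one block. *)
Definition fourier_terms (n : nat) : trig V r :=
  if excluded_middle_informative (exists alpha, freq_code alpha = n) is left e
  then let alpha := proj1_sig (constructive_indefinite_description _ e) in
       [:: (alpha, c alpha)]
  else [::].

Lemma fourier_termsP n :
  fourier_terms n = [::] /\ (forall alpha, freq_code alpha <> n) \/
  exists alpha, freq_code alpha = n /\ fourier_terms n = [:: (alpha, c alpha)].
Proof.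
rewrite /fourier_terms; case: excluded_middle_informative => [e|ne].
  right; case: constructive_indefinite_description => alpha ha /=.
  by exists alpha.
by left; split=> // alpha ha; apply: ne; exists alpha.
Qed.

Lemma fourier_terms_NoDup n :
  NoDup (unzip1 (psum fourier_terms n)) /\
  (forall alpha, In alpha (unzip1 (psum fourier_terms n)) -> (freq_code alpha < n)%N).
Proof.
elim: n => [|n [IH1 IH2]] /=; first by split=> //; constructor.
have [[-> _]|[alpha [ha ->]]] := fourier_termsP n.
  rewrite cats0; split=> // a /IH2; exact: ltnW.
rewrite /unzip1 map_cat /=; split.
  apply: NoDup_app => //; first by constructor; [move=> [] | constructor].
  by move=> a /IH2 h [e|[]]; move: h; rewrite -e ha ltnn.
move=> a ha'; case: (in_app_or _ _ _ ha') => [/IH2|[<-|[]]]; first exact: ltnW.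
by rewrite ha.
Qed.

Lemma tnorm_fourier_terms kappa n :
  tnorm kappa (psum fourier_terms n) =
  \big[Rplus/0]_(alpha <- unzip1 (psum fourier_terms n))
    (exp (kappa * l1_norm alpha) * norm (c alpha)).
Proof.
have h : forall q : trig V r, (forall m, In m q -> m.2 = c m.1) ->
    tnorm kappa q = \big[Rplus/0]_(alpha <- unzip1 q)
      (exp (kappa * l1_norm alpha) * norm (c alpha)).
  elim=> [|m q IH] hq /=; first by rewrite big_nil.
  by rewrite big_cons IH ?hq //=; [left | move=> m' hm; apply: hq; right].
apply: h; elim: n => [|n IH] m /=; first by [].
move=> hm; case: (in_app_or _ _ _ hm) => {hm} [/IH //|].
have [[-> _]|[alpha [ha ->]]] := fourier_termsP n; first by [].
by move=> [<-|[]].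
Qed.

(** By orthogonality only the mode alpha contributes, and it enters the partial sums precisely after
    the block of index [freq_code alpha]. *)
Lemma torus_int_fourier_terms alpha n :
  torus_int (fun theta => phase J (- dot alpha theta)
    (teval J (psum fourier_terms n) theta)) =
  if (freq_code alpha < n)%N then scal ((2 * PI) ^ r) (c alpha) else zero.
Proof.
have cphase p theta : continuous (fun theta : 'I_r -> R =>
    phase J (- dot alpha theta) (teval J p theta)) theta.
  apply: (continuous_phase hJ); last exact: continuous_teval.
  by apply: (continuous_opp (V := R_NormedModule)); exact: continuous_dot.
have mono beta (x : V) :
    torus_int (fun theta => phase J (- dot alpha theta) (teval J [:: (beta, x)] theta)) =
    if freq_nz (freq_sub beta alpha) then zero else scal ((2 * PI) ^ r) x.
  rewrite -torus_int_phase; congr torus_int; apply: functional_extensionality => th /=.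
  by rewrite plus_zero_r (phase_phase hJ) dot_sub; congr phase; ring.
have nil0 : torus_int (fun theta : 'I_r -> R => phase J (- dot alpha theta)
    (teval J [::] theta)) = zero.
  have := mono alpha zero; rewrite (freq_nz_sub _ _).2 // scal_zero_r => <-.
  congr torus_int; apply: functional_extensionality => th /=.
  by rewrite plus_zero_r !(phase_zero hJ).
elim: n => [|n IH]; first exact: nil0.
have -> : torus_int (fun theta => phase J (- dot alpha theta)
    (teval J (psum fourier_terms n.+1) theta)) =
  plus (torus_int (fun theta => phase J (- dot alpha theta)
          (teval J (psum fourier_terms n) theta)))
       (torus_int (fun theta => phase J (- dot alpha theta)
          (teval J (fourier_terms n) theta))).
  rewrite -torus_int_plus; try exact: cphase.
  congr torus_int; apply: functional_extensionality => th /=.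
  by rewrite teval_cat (phase_plus hJ).
rewrite IH ltnS [X in _ = if X then _ else _]leq_eqVlt.
have [[-> hn]|[beta [hb ->]]] := fourier_termsP n.
  rewrite nil0 plus_zero_r; case: eqP => //= e; by have := hn alpha e.
rewrite mono; case: eqP => [e|ne] /=.
  have eb : beta = alpha by apply: freq_code_inj; rewrite hb e.
  rewrite (freq_nz_sub _ _).2 // eb e ltnn; exact: plus_zero_l.
case hz: freq_nz; first by rewrite plus_zero_r.
by case: ne; move/freq_nz_sub: hz => <-; rewrite hb.
Qed.
End Enumeration.

(** The summable series converges uniformly to a continuous periodic s with the same coefficients as
    f; uniqueness applied to f - s gives f = s. *)
Lemma fourier_inversion (r : nat) (f : ('I_r -> R) -> V) (c : ('I_r -> Z) -> V) kappa N :
  0 <= kappa ->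
  (forall theta : 'I_r -> R, continuous f theta) ->
  (forall (theta : 'I_r -> R) (m : 'I_r -> Z),
     f (fun i => theta i + 2 * PI * IZR (m i)) = f theta) ->
  (forall alpha : 'I_r -> Z,
     torus_int (fun theta => phase J (- dot alpha theta) (f theta)) =
     scal ((2 * PI) ^ r) (c alpha)) ->
  (forall l, NoDup l -> \big[Rplus/0]_(alpha <- l)
     (exp (kappa * l1_norm alpha) * norm (c alpha)) <= N) ->
  exists p : nat -> trig V r,
    (forall n, tnorm kappa (psum p n) <= N) /\ tsum J p f.
Proof.
move=> k0 cf per coefs hN; exists (fourier_terms c).
have tN n : tnorm kappa (psum (fourier_terms c) n) <= N.
  by rewrite tnorm_fourier_terms; apply: hN; have [] := fourier_terms_NoDup c n.
split=> //; have [s hs] := tsum_exists hJ k0 tN.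
suff -> : f = s by [].
have cs (theta : 'I_r -> R) : continuous s theta.
  apply: continuous_uniform_limit => e e0.
  have [n0 /(_ n0 (leqnn _)) h] := hs e e0.
  exists (teval J (psum (fourier_terms c) n0)) => //; exact: continuous_teval.
have cphase (g : ('I_r -> R) -> V) alpha : (forall theta : 'I_r -> R, continuous g theta) ->
    forall theta : 'I_r -> R, continuous (fun theta => phase J (- dot alpha theta) (g theta)) theta.
  move=> cg theta; apply: (continuous_phase hJ) => //.
  by apply: (continuous_opp (V := R_NormedModule)); exact: continuous_dot.
have pers theta (m : 'I_r -> Z) : s (fun i => theta i + 2 * PI * IZR (m i)) = s theta.
  apply: norm_close_eq => e e0.
  have [n0 /(_ n0 (leqnn _)) h] := hs (e / 2) ltac:(lra).
  have h1 := h theta; have := h (fun i => theta i + 2 * PI * IZR (m i)).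
  rewrite teval_periodic => h2.
  have := norm_dist_triangle (teval J (psum (fourier_terms c) n0) theta)
    (s (fun i => theta i + 2 * PI * IZR (m i))) (s theta).
  rewrite (norm_minusC (teval J _ theta) (s theta)); vlra.
have coefss alpha : torus_int (fun theta => phase J (- dot alpha theta) (s theta)) =
    scal ((2 * PI) ^ r) (c alpha).
  have P : 0 <= (2 * PI) ^ r by apply: pow_le; exact: PI2_ge0.
  apply: norm_close_eq => e e0.
  have q0 : 0 < e / (1 + (2 * PI) ^ r) by apply: Rdiv_lt_0_compat; lra.
  have [n0 h0] := hs _ q0.
  (* The partial sum must be both uniformly close to s and long enough to contain the mode alpha. *)
  have h := h0 (maxn n0 (freq_code alpha).+1) (leq_maxl _ _).
  have := torus_int_fourier_terms c alpha (maxn n0 (freq_code alpha).+1).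
  rewrite leq_max ltnSn orbT => <-.
  rewrite -torus_int_minus; try exact: cphase; last first.
    by apply: cphase => th; exact: continuous_teval.
  apply: (Rle_trans _ ((2 * PI) ^ r * (e / (1 + (2 * PI) ^ r)))); last first.
    apply: (Rmult_le_reg_r (1 + (2 * PI) ^ r)); first lra.
    have -> : (2 * PI) ^ r * (e / (1 + (2 * PI) ^ r)) * (1 + (2 * PI) ^ r) =
      (2 * PI) ^ r * e by field; lra.
    nra.
  apply: norm_torus_int_le => theta.
    apply: continuous_minus; apply: cphase => // th; exact: continuous_teval.
  rewrite -(phase_minus hJ); apply: Rle_trans (h theta).
  exact: norm_phase_le.
apply: functional_extensionality => theta; apply: minus_eq0.
apply: (fourier_unique hJ (f := fun theta => minus (f theta) (s theta))).
- by move=> th; apply: continuous_minus.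
- by move=> th m; rewrite per pers.
- move=> alpha.
  have -> : (fun th => phase J (- dot alpha th) (minus (f th) (s th))) =
    (fun th => minus (phase J (- dot alpha th) (f th)) (phase J (- dot alpha th) (s th))).
    by apply: functional_extensionality => th; exact: phase_minus.
  rewrite torus_int_minus; try exact: cphase.
  by rewrite coefs coefss minus_eq_zero.
Qed.
End Inversion.

(** * The averaging iteration *)

Section Isometry.
Context (U V : CompleteNormedModule R_AbsRing) (j : U -> V).
Hypothesis jD : forall x y, j (plus x y) = plus (j x) (j y).
Hypothesis jZ : forall (c : R) x, j (scal c x) = scal c (j x).
Hypothesis jN : forall x, norm (j x) = norm x.

Lemma isometry_minus x y : j (minus x y) = minus (j x) (j y).
Proof. by rewrite /minus jD -(scal_opp_one y) jZ scal_opp_one. Qed.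

Lemma isometry_inj x y : j x = j y -> x = y.
Proof.
move=> h; apply: minus_eq0; apply: norm_eq_zero.
by rewrite -[LHS]jN isometry_minus h minus_eq_zero norm_zero.
Qed.

Lemma isometry_zero : j zero = zero.
Proof. by have := isometry_minus zero zero; rewrite !minus_eq_zero. Qed.

Lemma isometry_continuous_Rplus phi :
  continuous_Rplus (fun t => j (phi t)) <-> continuous_Rplus phi.
Proof.
rewrite !continuous_RplusP; split=> h t e t0 e0; have [d [d0 hd]] := h t e t0 e0;
  exists d; split=> // s s0 hs; have := hd s s0 hs; by rewrite -isometry_minus jN.
Qed.

Lemma isometry_RInt phi t : continuous_Rplus phi -> 0 <= t ->
  RInt (fun s => j (phi s)) 0 t = j (RInt phi 0 t).
Proof.
move=> cphi t0; apply: is_RInt_unique; apply: (RInt_linear_map (K := 1)) => // [x|].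
  by rewrite jN Rmult_1_l; exact: Rle_refl.
by apply: ex_RInt_Rplus => //; lra.
Qed.

Lemma isometry_mean phi t : continuous_Rplus phi -> 0 < t ->
  mean (fun s => j (phi s)) t = j (mean phi t).
Proof. by move=> cphi t0; rewrite /mean isometry_RInt ?jZ //; lra. Qed.

Lemma isometry_average phi L : continuous_Rplus phi ->
  has_average phi L -> has_average (fun t => j (phi t)) (j L).
Proof.
move=> cphi /filterlim_normP h; apply/filterlim_normP => e e0.
have [B hB] := h e e0; exists (Rmax 0 B) => x hx.
have x0 := Rmax_l 0 B; have xB := Rmax_r 0 B.
by rewrite isometry_mean -?isometry_minus ?jN; [apply: hB; lra | | lra].
Qed.

(** The image of j is closed: convergence of the means in V makes the means in U Cauchy, and U is
    complete. This brings averages found in the complexification back to the operators on X. *)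
Lemma isometry_average_inv phi L : continuous_Rplus phi ->
  has_average (fun t => j (phi t)) L -> exists2 L0, has_average phi L0 & j L0 = L.
Proof.
move=> cphi hL.
have [L0 hL0] : exists L0, has_average phi L0.
  apply/(filterlim_locally_cauchy (F := Rbar_locally p_infty)) => e.
  have e0 := cond_pos e.
  have [B hB] := (filterlim_normP _ _).1 hL (e / 4) ltac:(lra).
  exists (fun x => Rmax 0 B < x); split; first by exists (Rmax 0 B).
  have x0 := Rmax_l 0 B; have xB := Rmax_r 0 B.
  move=> u v hu hv; apply: norm_compat1.
  rewrite -jN isometry_minus -!isometry_mean //; try lra.
  have h1 := hB u ltac:(lra); have h2 := hB v ltac:(lra).
  have := norm_dist_triangle L (mean (fun s => j (phi s)) v) (mean (fun s => j (phi s)) u).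
  rewrite (norm_minusC L (mean _ u)); vlra.
exists L0 => //; apply: has_average_unique hL; exact: isometry_average.
Qed.
End Isometry.

(** * The iteration in an abstract algebra embedded isometrically in a complex one *)

Section Iteration.
Context (U V : CompleteNormedModule R_AbsRing) (j : U -> V) (J : V -> V).
Hypothesis jD : forall x y, j (plus x y) = plus (j x) (j y).
Hypothesis jZ : forall (c : R) x, j (scal c x) = scal c (j x).
Hypothesis jN : forall x, norm (j x) = norm x.
Hypothesis hJ : complex_structure J.
Context (mul : U -> U -> U) (one_U : U) (B : V -> V -> V).
Hypothesis jM : forall x y, j (mul x y) = B (j x) (j y).
Hypothesis Bl : forall x y z, B (plus x y) z = plus (B x z) (B y z).
Hypothesis Br : forall x y z, B x (plus y z) = plus (B x y) (B x z).
Hypothesis Bsl : forall (c : R) x y, B (scal c x) y = scal c (B x y).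
Hypothesis Bsr : forall (c : R) x y, B x (scal c y) = scal c (B x y).
Hypothesis Bn : forall x y, norm (B x y) <= norm x * norm y.
Hypothesis BJl : forall x y, B (J x) y = J (B x y).
Hypothesis BJr : forall x y, B x (J y) = J (B x y).
Hypothesis mul1l : forall x, mul one_U x = x.
Hypothesis one_le1 : norm one_U <= 1.
Context (avg : (R -> U) -> U).
Hypothesis avgP : forall phi L, has_average phi L -> avg phi = L.
Context (r : nat) (omega : 'I_r -> R).
Context (delta K : R).
Hypothesis delta_ge0 : 0 <= delta.
Hypothesis K_ge1 : 1 <= K.
Hypothesis nonresonant : forall alpha : 'I_r -> Z, freq_nz alpha ->
  dot alpha omega <> 0 /\ / Rabs (dot alpha omega) <= K * exp (delta * l1_norm alpha).

Implicit Types phi psi : R -> U.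

Let jB := isometry_minus jD jZ.
Let cj phi := @isometry_continuous_Rplus U V j jD jZ jN phi.

Definition quasi_op (kappa N : R) phi := quasi J omega kappa N (fun t => j (phi t)).

Lemma quasi_op_continuous kappa N phi : quasi_op kappa N phi -> continuous_Rplus phi.
Proof. by move=> h; apply/cj; exact: (quasi_continuous hJ h). Qed.

Lemma quasi_op_ext kappa N phi psi : (forall t, 0 <= t -> phi t = psi t) ->
  quasi_op kappa N phi -> quasi_op kappa N psi.
Proof. by move=> e; apply: quasi_ext => t t0; rewrite e. Qed.

Lemma quasi_op_bound kappa N phi t : 0 <= kappa -> quasi_op kappa N phi -> 0 <= t ->
  norm (phi t) <= N.
Proof. by move=> k0 h t0; rewrite -jN; exact: (quasi_bound hJ k0 h). Qed.

Lemma quasi_op_const kappa x : quasi_op kappa (norm x) (fun _ => x).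
Proof. by rewrite -jN; exact: quasi_const. Qed.

Lemma quasi_op_plus kappa N1 N2 phi psi :
  quasi_op kappa N1 phi -> quasi_op kappa N2 psi ->
  quasi_op kappa (N1 + N2) (fun t => plus (phi t) (psi t)).
Proof.
move=> h1 h2; apply: quasi_ext (quasi_plus h1 h2) => t _; by rewrite jD.
Qed.

Lemma quasi_op_minus kappa N1 N2 phi psi :
  quasi_op kappa N1 phi -> quasi_op kappa N2 psi ->
  quasi_op kappa (N1 + N2) (fun t => minus (phi t) (psi t)).
Proof.
move=> h1 h2; apply: quasi_ext (quasi_minus hJ h1 h2) => t _; by rewrite jB.
Qed.

Lemma quasi_op_scal kappa N phi c : quasi_op kappa N phi ->
  quasi_op kappa (Rabs c * N) (fun t => scal c (phi t)).
Proof. by move=> h; apply: quasi_ext (quasi_scal hJ c h) => t _; rewrite jZ. Qed.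

Lemma quasi_op_mul kappa N1 N2 phi psi : 0 <= kappa ->
  quasi_op kappa N1 phi -> quasi_op kappa N2 psi ->
  quasi_op kappa (N1 * N2) (fun t => mul (phi t) (psi t)).
Proof.
move=> k0 h1 h2.
apply: (quasi_ext (f := fun t => B (j (phi t)) (j (psi t)))) => [t _|].
  by rewrite jM.
exact: (quasi_mul hJ).
Qed.

Lemma quasi_op_average kappa N phi : 0 <= kappa -> quasi_op kappa N phi ->
  has_average phi (avg phi) /\ norm (avg phi) <= N.
Proof.
move=> k0 h; have cphi := quasi_op_continuous h.
have [L hL] := quasi_average hJ nonresonant h.
have [L0 h0 _] := isometry_average_inv jD jZ jN cphi hL.
rewrite (avgP h0); split=> //; apply: (norm_average_le cphi _ h0) => t t0.
exact: (quasi_op_bound k0 h).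
Qed.

Lemma mulDl x y z : mul (plus x y) z = plus (mul x z) (mul y z).
Proof. by apply: (isometry_inj jD jZ jN); rewrite jD !jM jD Bl. Qed.

Lemma mulDr x y z : mul x (plus y z) = plus (mul x y) (mul x z).
Proof. by apply: (isometry_inj jD jZ jN); rewrite jD !jM jD Br. Qed.

Lemma mulZl (c : R) x y : mul (scal c x) y = scal c (mul x y).
Proof. by apply: (isometry_inj jD jZ jN); rewrite jZ !jM jZ Bsl. Qed.

Lemma mulZr (c : R) x y : mul x (scal c y) = scal c (mul x y).
Proof. by apply: (isometry_inj jD jZ jN); rewrite jZ !jM jZ Bsr. Qed.

Lemma mul_norm x y : norm (mul x y) <= norm x * norm y.
Proof. by rewrite -!jN jM; exact: Bn. Qed.

Let mulBl := bilinear_minus_l mulDl mulZl.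
Let mulBr := bilinear_minus_r mulDr mulZr.

Lemma has_average_mul_r phi L y : continuous_Rplus phi -> has_average phi L ->
  has_average (fun t => mul (phi t) y) (mul L y).
Proof.
move=> cphi h.
apply: (filterlim_ext_loc (fun t => mul (mean phi t) y)).
  apply: eventually_pos => t t0; rewrite /mean mulZl; congr scal.
  apply/esym/is_RInt_unique; apply: (RInt_linear_map (L := fun x => mul x y)
    (K := norm y)) => [*|*|x|]; rewrite ?mulDl ?mulZl //.
    by rewrite Rmult_comm; exact: mul_norm.
  by apply: ex_RInt_Rplus => //; lra.
exact: (filterlim_bilinear mulDl mulDr mulZl mulZr mul_norm h (filterlim_const y)).
Qed.

Definition cint phi (t : R) : U :=
  minus (RInt phi 0 t) (avg (fun s => RInt phi 0 s)).

Lemma continuous_Rplus_RInt phi : continuous_Rplus phi ->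
  continuous_Rplus (fun t => RInt phi 0 t).
Proof.
by move=> h; apply: derivable_continuous_Rplus => t; exact: RInt_Rplus_derive.
Qed.

Lemma quasi_op_cint kappa N phi : 0 <= kappa - delta ->
  quasi_op kappa N phi -> has_average phi zero ->
  [/\ quasi_op (kappa - delta) (K * N) (cint phi), has_average (cint phi) zero &
      has_average (fun t => RInt phi 0 t) (avg (fun s => RInt phi 0 s))].
Proof.
move=> k0 h a0; have cphi := quasi_op_continuous h.
have a0' : has_average (fun t => j (phi t)) zero.
  by rewrite -(isometry_zero jD jZ); exact: (isometry_average jD jZ jN).
have [m [hm qm]] := quasi_centered_integral hJ K_ge1 nonresonant k0 h a0'.
have cI := continuous_Rplus_RInt cphi.
have hm' : has_average (fun t => j (RInt phi 0 t)) m.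
  by apply: has_average_ext hm => t t0; rewrite (isometry_RInt jD jZ jN).
have [L0 h0 e0] := isometry_average_inv jD jZ jN cI hm'.
have eL := avgP h0; rewrite eL; split=> //.
  apply: quasi_ext qm => t t0.
  by rewrite /cint eL jB e0 (isometry_RInt jD jZ jN).
have := has_average_minus cI (@continuous_Rplus_const U L0) h0 (@has_average_const U L0).
by rewrite minus_eq_zero /cint eL.
Qed.

(** Linearity rests on the existence of both averages, as [avg] is specified only on functions that
    have one. It lets the difference of two iterates be estimated as a single centered integral. *)
Lemma cint_minus kappa N1 N2 phi psi t : 0 <= kappa - delta -> 0 <= t ->
  quasi_op kappa N1 phi -> quasi_op kappa N2 psi ->
  has_average phi zero -> has_average psi zero ->
  cint (fun s => minus (phi s) (psi s)) t = minus (cint phi t) (cint psi t).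
Proof.
move=> k0 t0 h1 h2 a1 a2.
have c1 := quasi_op_continuous h1; have c2 := quasi_op_continuous h2.
have [_ _ b1] := quasi_op_cint k0 h1 a1; have [_ _ b2] := quasi_op_cint k0 h2 a2.
have eI s : 0 <= s -> RInt (fun s => minus (phi s) (psi s)) 0 s =
    minus (RInt phi 0 s) (RInt psi 0 s).
  by move=> s0; rewrite RInt_minus //; apply: ex_RInt_Rplus => //; lra.
rewrite /cint eI //.
set m1 := avg (fun s => RInt phi 0 s) in b1 *; set m2 := avg (fun s => RInt psi 0 s) in b2 *.
have -> : avg (fun s => RInt (fun s => minus (phi s) (psi s)) 0 s) = minus m1 m2.
  apply: avgP; apply: (has_average_ext (f := fun s => minus (RInt phi 0 s)
    (RInt psi 0 s))) => [s s0|]; first by rewrite eI.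
  by apply: has_average_minus => //; exact: continuous_Rplus_RInt.
by vec_eq U.
Qed.

Context (a : R -> U).

Definition lam phi (t : R) : U :=
  minus (mul (a t) (phi t)) (mul (phi t) (avg (fun s => mul (a s) (phi s)))).

Fixpoint iterate (eps : R) (m : nat) : R -> U :=
  match m with
  | 0%N => fun _ => one_U
  | m'.+1 => fun t =>
      minus (plus one_U (scal eps (RInt (lam (iterate eps m')) 0 t)))
        (scal eps (avg (fun t => RInt (lam (iterate eps m')) 0 t)))
  end.

Section Lambda.
Context (kappa M : R).
Hypothesis kappa_ge0 : 0 <= kappa.
Hypothesis Qa : quasi_op kappa M a.

Lemma quasi_op_a_mul N phi : quasi_op kappa N phi ->
  [/\ quasi_op kappa (M * N) (fun t => mul (a t) (phi t)),
      has_average (fun t => mul (a t) (phi t)) (avg (fun t => mul (a t) (phi t))) &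
      norm (avg (fun t => mul (a t) (phi t))) <= M * N].
Proof.
move=> h; have h1 := quasi_op_mul kappa_ge0 Qa h.
by have [h2 h3] := quasi_op_average kappa_ge0 h1.
Qed.

Lemma quasi_op_mul_const N phi y D : 0 <= N -> norm y <= D -> quasi_op kappa N phi ->
  quasi_op kappa (N * D) (fun t => mul (phi t) y).
Proof.
move=> N0 yD h; apply: (quasi_weaken (k2 := kappa) (N2 := N * norm y)); first lra.
  exact: Rmult_le_compat_l.
by apply: quasi_op_mul => //; exact: quasi_op_const.
Qed.

(** With N = 1 + c the constant is M (1 + c) (2 + c) = N_c M: this is where N_c comes from. *)
Lemma lam_quasi N phi : 0 <= N -> quasi_op kappa N phi ->
  quasi_op kappa (M * N * (1 + N)) (lam phi).
Proof.
move=> N0 h; have [h1 _ h3] := quasi_op_a_mul h.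
have := quasi_op_minus h1 (quasi_op_mul_const N0 h3 h).
by have -> : M * N + N * (M * N) = M * N * (1 + N) by ring.
Qed.

(** The normalization of phi turns the average of the subtracted product into the average of a phi.
    Zero average is what permits the next integration. *)
Lemma lam_average N phi : quasi_op kappa N phi -> has_average phi one_U ->
  has_average (lam phi) zero.
Proof.
move=> h h0; have [h1 h2 _] := quasi_op_a_mul h.
set A := avg _ in h2.
have -> : zero = minus A (mul one_U A) by rewrite mul1l minus_eq_zero.
have cphi := quasi_op_continuous h.
apply: has_average_minus => //; [exact: quasi_op_continuous h1 | | exact: has_average_mul_r].
exact: (continuous_Rplus_bilinear mulDl mulDr mulZl mulZr mul_norm cphi
  (@continuous_Rplus_const U A)).
Qed.

Lemma lam_minus_quasi N D phi psi : 0 <= N -> 0 <= D ->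
  quasi_op kappa N phi -> quasi_op kappa N psi ->
  quasi_op kappa D (fun t => minus (phi t) (psi t)) ->
  quasi_op kappa (M * D * (1 + 2 * N)) (fun t => minus (lam phi t) (lam psi t)).
Proof.
move=> N0 D0 h1 h2 h12.
have [q1 a1 n1] := quasi_op_a_mul h1; have [q2 a2 n2] := quasi_op_a_mul h2.
have [q12 a12 n12] := quasi_op_a_mul h12.
set A1 := avg (fun t => mul (a t) (phi t)) in a1 n1.
set A2 := avg (fun t => mul (a t) (psi t)) in a2 n2.
have nA : norm (minus A1 A2) <= M * D.
  apply: Rle_trans n12; apply: Req_le; congr norm; apply/esym/avgP.
  apply: (has_average_ext (f := fun t => minus (mul (a t) (phi t)) (mul (a t) (psi t)))).
    by move=> t _; rewrite mulBr.
  by apply: has_average_minus => //; [exact: quasi_op_continuous q1 | exact: quasi_op_continuous q2].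
(* The difference is a (phi - psi) - (phi - psi) A1 - psi (A1 - A2), with three terms of norm at
   most M D, D M N and N M D. *)
have := quasi_op_minus (quasi_op_minus q12 (quasi_op_mul_const D0 n1 h12))
  (quasi_op_mul_const N0 nA h2).
have -> : M * D + D * (M * N) + N * (M * D) = M * D * (1 + 2 * N) by ring.
apply: quasi_op_ext => t _; rewrite /lam !mulBl !mulBr -/A1 -/A2.
by vec_eq U.
Qed.
End Lambda.

Section Estimates.
Context (mu M c eps x : R) (n : nat).
Hypothesis width : forall m : nat, (m <= n.+1)%N -> 0 <= mu - INR m * delta.
Hypothesis Qa : quasi_op mu M a.
Hypothesis M_gt0 : 0 < M.
Hypothesis c01 : 0 < c < 1.
Hypothesis eps_gt0 : 0 < eps.
Hypothesis x_le1 : x <= 1.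
Hypothesis epsE : eps * K * ((2 + c) * (1 + c)) * M = c * x.

Let kap (m : nat) := mu - INR m * delta.

Lemma kap_succ m : kap m - delta = kap m.+1.
Proof. by rewrite /kap S_INR; ring. Qed.

Lemma Qa_kap m : quasi_op (kap m) M a.
Proof.
apply: (quasi_weaken (k2 := mu) (N2 := M)) => //; last lra.
by have := Rmult_le_pos _ _ (pos_INR m) delta_ge0; rewrite /kap; lra.
Qed.

Lemma iterate_succ m t :
  iterate eps m.+1 t = plus one_U (scal eps (cint (lam (iterate eps m)) t)).
Proof. by rewrite /= /cint; vec_eq U. Qed.

Lemma x_ge0 : 0 <= x.
Proof.
have : 0 < eps * K * ((2 + c) * (1 + c)) * M.
  by repeat apply: Rmult_lt_0_compat; lra.
rewrite epsE; nra.
Qed.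

Lemma quasi_op_near_one kappa phi : quasi_op kappa c (fun t => minus (phi t) one_U) ->
  quasi_op kappa (1 + c) phi.
Proof.
move=> h; have := quasi_op_plus (quasi_op_const kappa one_U) h.
move=> h1; apply: (quasi_weaken (k2 := kappa) (N2 := norm one_U + c)); try lra.
by apply: quasi_op_ext h1 => t _; vec_eq U.
Qed.

(** The ball of radius c around the identity is preserved: by [epsE], one step yields a deviation of
    norm at most c x <= c, at the price of one delta of width. *)
Lemma iterate_quasi m : (m <= n.+1)%N ->
  quasi_op (kap m) c (fun t => minus (iterate eps m t) one_U) /\
  has_average (iterate eps m) one_U.
Proof.
elim: m => [|m IH] hm.
  split; last exact: has_average_const.
  apply: (quasi_weaken (k2 := kap 0) (N2 := norm (zero : U))); first lra.
    by rewrite norm_zero; lra.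
  by apply: quasi_op_ext (quasi_op_const (kap 0) zero) => t _; rewrite minus_eq_zero.
have [h0 av] := IH (ltnW hm); have h := quasi_op_near_one h0.
have k0 := width (ltnW hm); have k1 := width hm.
have hl := lam_quasi k0 (Qa_kap m) (N := 1 + c) ltac:(lra) h.
have al := lam_average k0 (Qa_kap m) h av.
have [hc ac _] := quasi_op_cint (kappa := kap m) ltac:(rewrite kap_succ; exact: k1) hl al.
rewrite kap_succ in hc.
split.
  have hs := quasi_op_scal eps hc.
  apply: (quasi_weaken (k2 := kap m.+1) _ _ (quasi_op_ext _ hs)); first lra.
    rewrite Rabs_pos_eq; last lra.
    have -> : eps * (K * (M * (1 + c) * (1 + (1 + c)))) = c * x by rewrite -epsE; ring.
    nra.
  by move=> t _; rewrite iterate_succ; vec_eq U.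
have cc := quasi_op_continuous hc.
have a1 := has_average_scal (c := eps) cc ac.
have cs : continuous_Rplus (fun t => scal eps (cint (lam (iterate eps m)) t)).
  exact: (quasi_op_continuous (quasi_op_scal eps hc)).
have := has_average_plus (@continuous_Rplus_const U one_U) cs (@has_average_const U one_U) a1.
rewrite scal_zero_r plus_zero_r; apply: has_average_ext => t _.
by rewrite iterate_succ.
Qed.

Lemma iterate_quasi_bound m : (m <= n.+1)%N -> quasi_op (kap m) (1 + c) (iterate eps m).
Proof. by move=> hm; apply: quasi_op_near_one; have [] := iterate_quasi hm. Qed.

(** Used with y = 4 for the first difference and with y = 1 + 2 (1 + c), the Lipschitz factor of
    [lam], for the later ones. Both satisfy the condition for 0 < c < 1. *)
Lemma epsK_le (y : R) : 0 <= y -> y * c <= (2 + c) * (1 + c) -> eps * K * M * y <= x.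
Proof.
move=> y0 hy; have N0 : 0 < (2 + c) * (1 + c) by nra.
apply: (Rmult_le_reg_r ((2 + c) * (1 + c))) => //.
have -> : eps * K * M * y * ((2 + c) * (1 + c)) =
  eps * K * ((2 + c) * (1 + c)) * M * y by ring.
by rewrite epsE; have := x_ge0; nra.
Qed.

(** The first difference is at most x / 2 and each later one is at most x times the previous one.
    The two functions compared by [lam] are brought to the smaller of their widths before the next
    delta is spent. *)
Lemma iterate_diff_quasi m : (m <= n)%N ->
  quasi_op (kap m.+1) (x ^ m.+1 * / 2)
    (fun t => minus (iterate eps m.+1 t) (iterate eps m t)).
Proof.
have X0 := x_ge0.
elim: m => [|m IH] hm.
  have k0 := width (m := 0) isT; have k1 := width (m := 1) isT.
  have [h0 av] := iterate_quasi (m := 0) isT.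
  (* The identity has norm at most 1, sharper than 1 + c: then [lam] has norm at most 2 M, and y = 4
     leaves the factor 1/2. *)
  have h1 : quasi_op (kap 0) 1 (iterate eps 0).
    by apply: (quasi_weaken (k2 := kap 0) (N2 := norm one_U)) => //; [lra | exact: quasi_op_const].
  have hl := lam_quasi k0 (Qa_kap 0) (N := 1) ltac:(lra) h1.
  have al := lam_average k0 (Qa_kap 0) h1 av.
  have [hc _ _] := quasi_op_cint (kappa := kap 0) ltac:(rewrite kap_succ; exact: k1) hl al.
  rewrite kap_succ in hc; have hs := quasi_op_scal eps hc.
  apply: (quasi_weaken (k2 := kap 1) _ _ (quasi_op_ext _ hs)); first lra.
    rewrite Rabs_pos_eq; last lra.
    have := epsK_le (y := 4) ltac:(lra) ltac:(nra) => h2; rewrite /=; lra.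
  by move=> t _; rewrite iterate_succ /=; vec_eq U.
have hm1 : (m <= n)%N := ltnW hm.
have k1 := width (m := m.+1) hm1; have k2 := width (m := m.+2) hm.
have h1 := iterate_quasi_bound (m := m.+1) hm1.
have av1 := (iterate_quasi (m := m.+1) hm1).2.
have av0 := (iterate_quasi (m := m) (leqW hm1)).2.
have h0 : quasi_op (kap m.+1) (1 + c) (iterate eps m).
  apply: (quasi_weaken (k2 := kap m) (N2 := 1 + c)); [|lra|exact: iterate_quasi_bound (leqW hm1)].
  by rewrite -kap_succ; lra.
have D0 : 0 <= x ^ m.+1 * / 2 by apply: Rmult_le_pos; [exact: pow_le | lra].
have hd := lam_minus_quasi k1 (Qa_kap m.+1) (N := 1 + c) ltac:(lra) D0 h1 h0 (IH hm1).
have hl1 := lam_quasi k1 (Qa_kap m.+1) (N := 1 + c) ltac:(lra) h1.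
have hl0 := lam_quasi k1 (Qa_kap m.+1) (N := 1 + c) ltac:(lra) h0.
have al1 := lam_average k1 (Qa_kap m.+1) h1 av1.
have al0 := lam_average k1 (Qa_kap m.+1) h0 av0.
have kd : 0 <= kap m.+1 - delta by rewrite kap_succ.
have ad : has_average (fun t => minus (lam (iterate eps m.+1) t) (lam (iterate eps m) t)) zero.
  rewrite -(minus_eq_zero zero).
  by apply: has_average_minus => //; [exact: quasi_op_continuous hl1 | exact: quasi_op_continuous hl0].
have [hc _ _] := quasi_op_cint kd hd ad.
rewrite kap_succ in hc; have hs := quasi_op_scal eps hc.
apply: (quasi_weaken (k2 := kap m.+2) _ _ (quasi_op_ext _ hs)); first lra.
  rewrite Rabs_pos_eq; last lra.
  have h2 := epsK_le (y := 1 + 2 * (1 + c)) ltac:(lra) ltac:(nra).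
  have -> : eps * (K * (M * (x ^ m.+1 * / 2) * (1 + 2 * (1 + c)))) =
    eps * K * M * (1 + 2 * (1 + c)) * (x ^ m.+1 * / 2) by ring.
  have -> : x ^ m.+2 * / 2 = x * (x ^ m.+1 * / 2) by rewrite /=; ring.
  exact: Rmult_le_compat_r.
move=> t t0; rewrite (cint_minus kd t0 hl1 hl0 al1 al0) !iterate_succ.
by vec_eq U.
Qed.

Lemma iterate_derive m t : (m <= n)%N -> 0 <= t ->
  is_derive_Rplus (iterate eps m.+1) t (scal eps (lam (iterate eps m) t)).
Proof.
move=> hm t0.
have hl := lam_quasi (width (leqW hm)) (Qa_kap m) (N := 1 + c) ltac:(lra)
  (iterate_quasi_bound (leqW hm)).
have d1 := RInt_Rplus_derive (quasi_op_continuous hl) t0.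
have := is_derive_Rplus_plus t0 (is_derive_Rplus_scal eps t0 d1)
  (is_derive_Rplus_const (minus one_U (scal eps (avg (fun t => RInt (lam (iterate eps m)) 0 t)))) t0).
rewrite plus_zero_r; apply: is_derive_Rplus_ext => // s _ /=.
by vec_eq U.
Qed.

Lemma iterate_estimates :
  [/\ forall t, 0 <= t -> norm (minus (iterate eps n t) one_U) <= c,
      norm (avg (fun t => mul (a t) (iterate eps n t))) <= (1 + c) * M,
      forall t, 0 <= t ->
        norm (minus (minus (iterate eps n t) (iterate eps n.+1 t))
                    (minus (iterate eps n 0) (iterate eps n.+1 0))) <= x ^ n.+1 &
      forall m t, (m <= n)%N -> 0 <= t ->
        is_derive_Rplus (iterate eps m.+1) t (scal eps (lam (iterate eps m) t))].
Proof.
have k0 := width (leqnSn n); have k1 := width (leqnn n.+1).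
split.
- move=> t t0; exact: (quasi_op_bound k0 (iterate_quasi (leqnSn n)).1 t0).
- have [_ _ h] := quasi_op_a_mul k0 (Qa_kap n) (iterate_quasi_bound (leqnSn n)).
  by rewrite Rmult_comm.
(* The values at t and at 0 each contribute half of x^(n+1). *)
- move=> t t0; have h s := quasi_op_bound (t := s) k1 (iterate_diff_quasi (leqnn n)).
  apply: (Rle_trans _ _ _ (norm_minus_le _ _)).
  rewrite (norm_minusC (iterate eps n t)) (norm_minusC (iterate eps n 0)).
  have := h t t0; have := h 0 (Rle_refl 0); vlra.
- by move=> m t hm t0; exact: iterate_derive.
Qed.
End Estimates.
End Iteration.

(** * Bounded operators and their complexification *)

Section OperatorAlgebra.
Context (k : base_field) (X : CompleteNormedModule (scalars k)).
Notation ops := (real_ops X).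

Lemma op_comp_plus_l (f g h : ops) :
  op_comp (plus f g : ops) h = plus (op_comp f h : ops) (op_comp g h : ops) :> ops.
Proof. exact: bounded_op_eq. Qed.

Lemma op_comp_plus_r (f g h : ops) :
  op_comp f (plus g h : ops) = plus (op_comp f g : ops) (op_comp f h : ops) :> ops.
Proof. by apply: bounded_op_eq => x; exact: (linear_plus _ (op_linear f)). Qed.

Lemma op_comp_scal_l (c : R) (f g : ops) :
  op_comp (scal c f : ops) g = scal c (op_comp f g : ops) :> ops.
Proof. exact: bounded_op_eq. Qed.

Lemma op_comp_scal_r (c : R) (f g : ops) :
  op_comp f (scal c g : ops) = scal c (op_comp f g : ops) :> ops.
Proof. by apply: bounded_op_eq => x; exact: (linear_scal _ (op_linear f)). Qed.

Lemma op_comp_norm (f g : ops) :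
  norm (op_comp f g : ops) <= norm (f : ops) * norm (g : ops).
Proof.
apply: op_norm_lub => [|x].
  by apply: Rmult_le_pos; exact: op_norm_ge0.
apply: (Rle_trans _ (op_norm f * (op_norm g * norm x))).
  apply: (Rle_trans _ _ _ (op_norm_bound f (g x))).
  by apply: Rmult_le_compat_l; [exact: op_norm_ge0 | exact: op_norm_bound].
by rewrite -Rmult_assoc; exact: Rle_refl.
Qed.

Lemma op_id_norm : norm (op_id X : ops) <= 1.
Proof. by apply: op_norm_lub => [|x]; [lra | rewrite Rmult_1_l; exact: Rle_refl]. Qed.

Lemma op_comp_id_l (f : bounded_op X) : op_comp (op_id X) f = f.
Proof. exact: bounded_op_eq. Qed.

Lemma time_average_eq (phi : R -> ops) L : has_average phi L -> time_average phi = L.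
Proof.
exact: (iota_filterlim_locally (V := ops) (F := Rbar_locally p_infty) (mean phi) L).
Qed.

Lemma op_derive_eq (phi : R -> ops) t (L : ops) : 0 <= t ->
  is_derive_Rplus phi t L -> op_derive phi t = L.
Proof.
move=> t0 h; apply: (iota_unique (V := ops)) => // y hy.
exact: is_derive_Rplus_unique hy h.
Qed.

Lemma Phi_iterate (a : R -> bounded_op X) eps m :
  Phi a eps m = iterate (U := ops) (@op_comp k X) (op_id X) (@time_average k X) a eps m.
Proof. by elim: m => //= m ->. Qed.
End OperatorAlgebra.

Section Complexified.
Definition op_i (Z : CompleteNormedModule C_AbsRing) (f : @real_ops ComplexField Z) :
    @real_ops ComplexField Z := op_scal (Ci : scalars ComplexField) f.

Lemma op_i_complex_structure (Z : CompleteNormedModule C_AbsRing) :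
  complex_structure (@op_i Z).
Proof.
split; rewrite /op_i.
- move=> x y; exact: (op_scalDr (k := ComplexField) (Ci : scalars ComplexField) x y).
- move=> c x; rewrite /scal /= /real_scal.
  rewrite (op_scalA (k := ComplexField)); apply/esym.
  rewrite [LHS](op_scalA (k := ComplexField)); congr op_scal.
  exact: Cmult_comm.
- move=> x; rewrite (op_scalA (k := ComplexField)).
  have -> : mult (Ci : C_Ring) Ci = opp one.
    by rewrite /mult /opp /one /= /Cmult /Copp /=; congr pair; ring.
  exact: (scal_opp_one (V := bounded_op_ModuleSpace (k := ComplexField) Z) x).
- move=> t x.
  have -> : plus (scal (cos t) x)
      (scal (sin t) (op_scal (Ci : scalars ComplexField) x : @real_ops ComplexField Z)) =
      op_scal (k := ComplexField) ((cos t, sin t) : C) x.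
    rewrite /scal /= /real_scal.
    rewrite [X in plus _ X](op_scalA (k := ComplexField)).
    apply/esym; rewrite -[RHS](op_scalDl (k := ComplexField)); congr op_scal.
    rewrite /plus /mult /= /Cplus /Cmult /=; congr pair; ring.
  apply: (Rle_trans _ _ _ (is_norm_scal (op_norm_is_norm (k := ComplexField) Z) _ _)).
  have -> : abs ((cos t, sin t) : C_AbsRing) = 1.
    rewrite /abs /= /Cmod /=; have := sin2_cos2 t; rewrite /Rsqr => h.
    by rewrite -[RHS]sqrt_1; congr sqrt; lra.
  by rewrite Rmult_1_l; exact: Rle_refl.
Qed.

Context (k : base_field) (X : CompleteNormedModule (scalars k)).
Notation ops := (real_ops X).
Notation cops := (@real_ops ComplexField (complexify X)).

Definition cplxop (f : ops) : cops := complexify_op f.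

Lemma cplxop_plus f g : cplxop (plus f g) = plus (cplxop f) (cplxop g).
Proof.
rewrite /cplxop; move: f g; case: k X => X0 f g //=.
by apply: bounded_op_eq.
Qed.

Lemma cplxop_scal (c : R) f : cplxop (scal c f) = scal c (cplxop f).
Proof.
rewrite /cplxop; move: f; case: k X => X0 f //=.
apply: bounded_op_eq => z; apply: cplx_eq => /=.
  rewrite (scal_zero_l (f (cplx_im z))) minus_zero_r; done.
rewrite (scal_zero_l (f (cplx_re z))) plus_zero_l; done.
Qed.

(** In the real case, f commutes with the rotations whose supremum defines the Taylor norm, which
    gives one inequality; the other comes from testing on vectors with zero imaginary part. *)
Lemma cplxop_norm f : norm (cplxop f) = norm f.
Proof.
rewrite /cplxop; move: f; case: k X => X0 f //=.
apply: Rle_antisym; apply: op_norm_lub; try exact: op_norm_ge0.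
  move=> z; apply: (cplx_norm_spec (cplx_op_fun f z)).2 => t.
  have lf := op_linear f.
  have -> : cplx_rot (cplx_op_fun f z) t = f (cplx_rot z t).
    by rewrite /cplx_rot (linear_plus _ lf) !(linear_scal _ lf).
  apply: (Rle_trans _ _ _ (op_norm_bound _ _)).
  by apply: Rmult_le_compat_l; [exact: op_norm_ge0 | exact: (cplx_norm_spec z).1].
move=> x.
apply: (Rle_trans _ _ _ (cplx_norm_re (cplx_op f (Cplx x zero)))).
apply: (Rle_trans _ _ _ (op_norm_bound (k := ComplexField) (cplx_op f) (Cplx x zero))).
apply: Rmult_le_compat_l; first exact: op_norm_ge0.
apply: (Rle_trans _ _ _ (cplx_norm_le _)) => /=.
by rewrite norm_zero Rplus_0_r; exact: Rle_refl.
Qed.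

Lemma cplxop_comp f g :
  cplxop (op_comp f g) = op_comp (cplxop f) (cplxop g).
Proof.
rewrite /cplxop; move: f g; case: k X => X0 f g //=.
by apply: bounded_op_eq.
Qed.

Lemma op_comp_i_l (f g : cops) : op_comp (op_i f) g = op_i (op_comp f g).
Proof. exact: bounded_op_eq. Qed.

Lemma op_comp_i_r (f g : cops) : op_comp f (op_i g) = op_i (op_comp f g).
Proof. by apply: bounded_op_eq => x; exact: (linear_scal _ (op_linear f)). Qed.

Lemma phase_op_scal t (f : cops) :
  phase (@op_i (complexify X)) (- t) f =
  op_scal (k := ComplexField) ((cos t, - sin t) : C) f.
Proof.
rewrite /phase /op_i cos_neg sin_neg /scal /= /real_scal.
rewrite [X in plus _ X](op_scalA (k := ComplexField)).
rewrite -[LHS](op_scalDl (k := ComplexField)); congr op_scal.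
by rewrite /plus /mult /= /Cplus /Cmult /=; congr pair; ring.
Qed.
End Complexified.

(** * Small divisors, decomposition of the generator, Neumann series *)

Lemma le_Lub_Rbar (E : R -> Prop) x : is_finite (Lub_Rbar E) -> E x ->
  x <= real (Lub_Rbar E).
Proof.
move=> fin Ex; have [ub _] := Lub_Rbar_correct E.
by have := ub x Ex; rewrite -{1}fin.
Qed.

(** The constant (nu / (delta e))^nu is the maximum of l^nu exp (- delta l) over l > 0, attained at
    l = nu / delta. The bound 1 <= r makes nu nonnegative. *)
Lemma small_divisors (r : nat) (omega : 'I_r -> R) cD nu delta :
  (1 <= r)%N -> diophantine omega cD nu -> 0 < delta ->
  1 <= c_I cD nu delta /\
  forall alpha : 'I_r -> Z, freq_nz alpha ->
    dot alpha omega <> 0 /\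
    / Rabs (dot alpha omega) <= c_I cD nu delta * exp (delta * l1_norm alpha).
Proof.
move=> r1 [cD0 nu_ge dioph _] d0.
have nu0 : 0 <= nu.
  have h1 : 1 <= INR r by apply: (le_INR 1); apply/leP.
  lra.
split=> [|alpha nz].
  by rewrite /c_I; case: Req_EM_T => ?; exact: Rmax_l.
have l1 := l1_norm_ge1 nz; set l := l1_norm alpha in l1 *.
have nz' := elimT (freq_nzP alpha) nz.
have := dioph alpha nz'; rewrite -/l => hd.
have p0 : 0 < Rpower l nu by exact: exp_pos.
have q0 : 0 < cD / Rpower l nu by exact: Rdiv_lt_0_compat.
split; first by move=> e0; move: hd; rewrite e0 Rabs_R0; lra.
have icD : 0 < / cD by exact: Rinv_0_lt_compat.
apply: (Rle_trans _ (/ (cD / Rpower l nu))); first exact: Rinv_le_contravar.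
have -> : / (cD / Rpower l nu) = / cD * Rpower l nu by field; lra.
have e1 : 1 <= exp (delta * l) by rewrite -exp_0; apply: exp_le; nra.
rewrite /c_I; case: Req_EM_T => [nu_eq|nu_ne] /=.
  rewrite nu_eq.
  rewrite Rpower_O; last lra.
  have := Rmax_r 1 (/ cD); nra.
have nup : 0 < nu by lra.
(* In the ratio y of l to the maximizer nu / delta, the claimed inequality becomes ln y <= y - 1. *)
set y := delta * l / nu.
have y0 : 0 < y by apply: Rdiv_lt_0_compat => //; nra.
have key : Rpower l nu <= Rpower (nu / (delta * exp 1)) nu * exp (delta * l).
  rewrite /Rpower -exp_plus; apply: exp_le.
  have -> : ln (nu / (delta * exp 1)) = ln l - ln y - 1.
    have -> : nu / (delta * exp 1) = l * / y * / exp 1.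
      by rewrite /y; field; have := exp_pos 1; lra.
    have i1 : 0 < / exp 1 by apply: Rinv_0_lt_compat; exact: exp_pos.
    have i2 : 0 < / y by exact: Rinv_0_lt_compat.
    have ll : 0 < l by lra.
    rewrite ln_mult //; last exact: Rmult_lt_0_compat.
    have ep := exp_pos 1.
    by rewrite ln_mult // (ln_Rinv y) // (ln_Rinv (exp 1)) // ln_exp; ring.
  have hy : ln y <= y - 1.
    have := exp_ineq1_le (y - 1) => h.
    rewrite -[y - 1]ln_exp; apply: ln_le => //; lra.
  have -> : delta * l = nu * y by rewrite /y; field.
  nra.
have p1 : 0 < Rpower (nu / (delta * exp 1)) nu by exact: exp_pos.
have := Rmax_r 1 (/ cD * Rpower (nu / (delta * exp 1)) nu) => h.
apply: (Rle_trans _ (/ cD * Rpower (nu / (delta * exp 1)) nu * exp (delta * l))).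
  by rewrite Rmult_assoc; apply: Rmult_le_compat_l; lra.
by apply: Rmult_le_compat_r; lra.
Qed.

Section QuasiOfSplitting.
Context (k : base_field) (X : CompleteNormedModule (scalars k)).
Context (r : nat) (omega : 'I_r -> R).
Notation ops := (real_ops X).
Notation cops := (@real_ops ComplexField (complexify X)).
Notation J := (@op_i (complexify X)).

Lemma continuous_cplxop (U : UniformSpace) (f : U -> ops) (x : U) :
  continuous f x -> continuous (fun y => cplxop (f y)) x.
Proof.
move=> /continuous_normP h; apply/continuous_normP => e e0.
have [d hd] := h e e0; exists d => y hy.
rewrite -(isometry_minus (@cplxop_plus k X) (@cplxop_scal k X)) cplxop_norm.
exact: hd.
Qed.

(** Passage from the supremum of finite sums of Fourier coefficients to blocks of modes: Fourier
    inversion is applied to the complexified torus function, which is then restricted to the line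
    omega t. *)
Lemma quasi_op_splits kappa (a : R -> bounded_op X) phis phib : 0 <= kappa ->
  splits omega kappa a phis phib ->
  quasi_op (U := ops) (V := cops) (@cplxop k X) J omega kappa
    (real (fourier_norm kappa phis) + real (exp_norm phib)) a.
Proof.
move=> k0 [[per cont fin] [cb finb] asum].
have hJ := @op_i_complex_structure (complexify X).
set N := real (fourier_norm kappa phis).
have [p [pN ps]] : exists p : nat -> trig cops r,
    (forall n, tnorm kappa (psum p n) <= N) /\
    tsum J p (fun theta => cplxop (phis theta)).
  apply: (fourier_inversion hJ (c := fun alpha => (fourier_coef phis alpha : cops))) => //.
  - by move=> theta; apply: continuous_cplxop; exact: cont.
  - by move=> theta m; rewrite per.
  - move=> alpha; rewrite /fourier_coef.
    have P : 0 < (2 * PI) ^ r by apply: pow_lt; have := PI_RGT_0; lra.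
    set I1 := torus_int _; set I2 := torus_int _.
    have -> : I1 = I2.
      congr torus_int; apply: functional_extensionality => th.
      exact: phase_op_scal.
    change (I2 = scal ((2 * PI) ^ r) (scal (/ (2 * PI) ^ r) I2)).
    by vec_eq constr:(cops); field; lra.
  - by move=> l hl; apply: (le_Lub_Rbar fin); exists l.
exists (fun t => cplxop (phis (fun i => omega i * t))), (fun t => cplxop (phib t)).
exists N, (real (exp_norm phib)); split.
- exists p; split=> // e e0; have [n0 h] := ps e e0.
  by exists n0 => n hn t _; exact: h.
- split.
    have cb' : continuous_Rplus (phib : R -> ops) by exact: continuous_on_Rplus.
    exact: (isometry_continuous_Rplus (@cplxop_plus k X) (@cplxop_scal k X)
      (@cplxop_norm k X) phib).2 cb'.
  move=> t t0; rewrite cplxop_norm.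
  have h : exp t * norm (phib t) <= real (exp_norm phib).
    by apply: (le_Lub_Rbar finb); exists t.
  have et := exp_pos t; apply: (Rmult_le_reg_l (exp t)) => //.
  rewrite (Rmult_comm (real _)) -Rmult_assoc -exp_plus Rplus_opp_r exp_0 Rmult_1_l.
  exact: h.
- exact: Rle_refl.
- by move=> t t0; rewrite asum // -cplxop_plus.
Qed.
End QuasiOfSplitting.

Lemma sequence_limit_unique (V : NormedModule R_AbsRing) (u : nat -> V) (x y : V) :
  filterlim u eventually (locally x) -> filterlim u eventually (locally y) -> x = y.
Proof. by move=> hx hy; apply: (filterlim_locally_unique u x y hx hy). Qed.

Section Neumann.
Context (k : base_field) (X : CompleteNormedModule (scalars k)).
Notation ops := (real_ops X).

Fixpoint op_pow (h : ops) (n : nat) : ops :=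
  if n is m.+1 then op_comp h (op_pow h m) else op_id X.

Lemma op_pow_comm h n : op_comp (op_pow h n) h = op_comp h (op_pow h n) :> ops.
Proof.
elim: n => [|n IH] /=; first exact: bounded_op_eq.
by rewrite -[in RHS]IH; exact: bounded_op_eq.
Qed.

Lemma op_pow_norm (h : ops) c n : norm h <= c -> norm (op_pow h n) <= c ^ n.
Proof.
move=> hc; elim: n => [|n IH] /=; first exact: op_id_norm.
apply: (Rle_trans _ _ _ (op_comp_norm _ _)).
by apply: Rmult_le_compat => //; exact: norm_ge_0.
Qed.

(** Neumann series in h = id - f: multiplied by f on either side, its partial sums telescope to id -
    h^(n+1). *)
Lemma op_inverse_exists (f : ops) c : c < 1 -> norm (minus f (op_id X : ops)) <= c ->
  exists g : bounded_op X, op_comp g f = op_id X /\ op_comp f g = op_id X.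
Proof.
move=> c1 fc; set h : ops := minus (op_id X : ops) f.
have c0 : 0 <= c := Rle_trans _ _ _ (norm_ge_0 _) fc.
have hc : norm h <= c by rewrite norm_minusC.
have cpow : ex_series (fun n => c ^ n).
  by exists (/ (1 - c)); apply: is_series_geom; rewrite Rabs_pos_eq.
have [g hg] : ex_series (op_pow h).
  by apply: (ex_series_le _ _ _ cpow) => n; exact: op_pow_norm.
have ef : f = minus (op_id X : ops) h by rewrite /h; vec_eq constr:(ops).
have pow0 : filterlim (fun n => minus (op_id X : ops) (op_pow h n.+1)) eventually
    (locally (op_id X : ops)).
  apply/filterlim_normP => e e0.
  have [n0 hn0] := pow_lt_1_zero c ltac:(rewrite Rabs_pos_eq //) e e0.
  exists n0 => n hn.
  have -> : minus (minus (op_id X : ops) (op_pow h n.+1)) (op_id X : ops) =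
    opp (op_pow h n.+1) by vec_eq constr:(ops).
  rewrite norm_opp; apply: (Rle_trans _ _ _ (op_pow_norm n.+1 hc)).
  have := hn0 n.+1 ltac:(lia); rewrite Rabs_pos_eq; last exact: pow_le.
  exact: Rlt_le.
have Bm1 := bilinear_minus_l (@op_comp_plus_l k X) (@op_comp_scal_l k X).
have Bm2 := bilinear_minus_r (@op_comp_plus_r k X) (@op_comp_scal_r k X).
have lim := @filterlim_bilinear _ _ _ _ (@op_comp_plus_l k X) (@op_comp_plus_r k X)
  (@op_comp_scal_l k X) (@op_comp_scal_r k X) (@op_comp_norm k X).
have id_r (x : ops) : op_comp x (op_id X) = x by exact: bounded_op_eq.
have id_l (x : ops) : op_comp (op_id X) x = x by exact: bounded_op_eq.
exists g; split.
- have e1 n : op_comp (sum_n (op_pow h) n : ops) f =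
      minus (op_id X : ops) (op_pow h n.+1) :> ops.
    rewrite ef; elim: n => [|n IH].
      by rewrite sum_O Bm2 !id_r /= id_l id_r.
    rewrite sum_Sn op_comp_plus_l IH Bm2 id_r op_pow_comm.
    rewrite -[op_comp h (op_pow h n.+1)]/(op_pow h n.+2); vec_eq constr:(ops).
  have l1 : filterlim (fun n => op_comp (sum_n (op_pow h) n : ops) f : ops) eventually
      (locally (op_comp g f : ops)) by apply: lim => //; exact: filterlim_const.
  apply: (sequence_limit_unique l1).
  by apply: filterlim_ext pow0 => n; rewrite e1.
- have e1 n : op_comp f (sum_n (op_pow h) n : ops) =
      minus (op_id X : ops) (op_pow h n.+1) :> ops.
    rewrite ef; elim: n => [|n IH].
      by rewrite sum_O Bm1 !id_l /= id_r.
    rewrite sum_Sn op_comp_plus_r IH Bm1 id_l.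
    rewrite -[op_comp h (op_pow h n.+1)]/(op_pow h n.+2); vec_eq constr:(ops).
  have l1 : filterlim (fun n => op_comp f (sum_n (op_pow h) n : ops) : ops) eventually
      (locally (op_comp f g : ops)) by apply: lim => //; exact: filterlim_const.
  apply: (sequence_limit_unique l1).
  by apply: filterlim_ext pow0 => n; rewrite e1.
Qed.

(** Existence of an inverse makes the choice in [op_inv] meaningful. With f x = u, the bound follows
    from |x| <= |f x - x| + |f x| <= c |x| + |u|. *)
Lemma op_inv_bound (f : ops) c (u : X) : c < 1 ->
  norm (minus f (op_id X : ops)) <= c ->
  norm (op_inv f u) <= norm u / (1 - c).
Proof.
move=> c1 fc.
have [_ e] : op_comp (op_inv f) f = op_id X /\ op_comp f (op_inv f) = op_id X.
  exact: (epsilon_spec (inhabits (op_id X)) (fun g => op_comp g f = op_id X /\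
    op_comp f g = op_id X) (op_inverse_exists c1 fc)).
set x := op_inv f u.
have fx : f x = u.
  by have := f_equal (fun g : bounded_op X => g u) e.
have h1 := op_norm_bound (minus f (op_id X : ops)) x.
have x0 := norm_ge_0 x.
have h2 : norm (minus (f x) x) <= c * norm x.
  apply: (Rle_trans _ _ _ h1); exact: Rmult_le_compat_r.
have h3 : norm x <= norm (minus (f x) x) + norm (f x).
  have := norm_minus_triangle (f x) x (zero : X).
  by rewrite !minus_zero_r norm_minus_sym.
rewrite fx in h2 h3; apply: (Rmult_le_reg_r (1 - c)); first lra.
have -> : norm u / (1 - c) * (1 - c) = norm u by field; lra.
lra.
Qed.
End Neumann.

(** * The micro-macro problem *)

Section MicroMacro.
Context (k : base_field) (X : CompleteNormedModule (scalars k)).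
Notation ops := (real_ops X).
Notation RX := (realify X).

Definition op_apply (f : ops) (x : RX) : RX := f x.

Lemma op_apply_plus_l (f g : ops) x :
  op_apply (plus f g) x = plus (op_apply f x) (op_apply g x).
Proof. by []. Qed.

Lemma op_apply_plus_r (f : ops) x y :
  op_apply f (plus x y) = plus (op_apply f x) (op_apply f y).
Proof. exact: (linear_plus _ (op_linear f)). Qed.

Lemma op_apply_scal_l (c : R) (f : ops) x :
  op_apply (scal c f) x = scal c (op_apply f x).
Proof. by []. Qed.

Lemma op_apply_scal_r (c : R) (f : ops) x :
  op_apply f (scal c x) = scal c (op_apply f x).
Proof. exact: (linear_scal _ (op_linear f)). Qed.

Lemma op_apply_norm (f : ops) x : norm (op_apply f x) <= norm f * norm x.
Proof. exact: op_norm_bound. Qed.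

Lemma is_derive_Rplus_exp (K t : R) : 0 <= t ->
  is_derive_Rplus (V := R_NormedModule) (fun s => exp (K * s)) t (K * exp (K * t)).
Proof.
move=> t0; apply: is_derive_is_derive_Rplus => //.
by auto_derive => //; ring.
Qed.

Lemma is_derive_Rplus_RInt_norm (v : R -> RX) (t : R) : continuous_Rplus v -> 0 <= t ->
  is_derive_Rplus (V := R_NormedModule)
    (fun s => RInt (fun u => norm (v (Rmax 0 u))) 0 s) t (norm (v t)).
Proof.
move=> cv t0.
have c : continuous_Rplus (V := R_CompleteNormedModule) (fun u => norm (v (Rmax 0 u))).
  by apply: continuous_Rplus_continuous; exact: continuous_Rplus_norm.
by have := RInt_Rplus_derive c t0; rewrite (Rmax_right 0 t).
Qed.

Context (a : R -> bounded_op X) (u0 : X) (eps c KA S eta : R) (n : nat).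
Context (G : R -> ops).
Hypothesis eps_gt0 : 0 < eps.
Hypothesis c_lt1 : c < 1.
Hypothesis Phi0 : norm (minus (Phi a eps n 0 : ops) (op_id X : ops)) <= c.
Hypothesis A_le : norm (macro_op a eps n : ops) <= KA.
Hypothesis a_le : forall t, 0 <= t -> norm (a t : ops) <= S.
Hypothesis dG : forall t, 0 <= t ->
  is_derive_Rplus G t (scal eps (defect a eps n t : ops)).
Hypothesis G_le : forall t, 0 <= t -> norm (minus (G t) (G 0)) <= eta.

Lemma KA_ge0 : 0 <= KA.
Proof. exact: Rle_trans (norm_ge_0 _) A_le. Qed.

Lemma S_ge0 : 0 <= S.
Proof. exact: Rle_trans (norm_ge_0 _) (a_le (Rle_refl 0)). Qed.

Lemma eta_ge0 : 0 <= eta.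
Proof. exact: Rle_trans (norm_ge_0 _) (G_le (Rle_refl 0)). Qed.

Lemma macro_bound (v w : R -> RX) t : micro_macro a u0 eps n v w -> 0 <= t ->
  norm (v t) <= norm u0 / (1 - c) * exp (KA * t).
Proof.
move=> [dv v0 _ _] t0.
have cv : continuous_Rplus v := derivable_continuous_Rplus dv.
(* The norm of v need not be differentiable, so Gronwall is used in integral form, the mean value
   inequality supplying |v s - v 0| <= KA times the integral of |v|. *)
set y := fun s => norm (v (Rmax 0 s)).
have cy (s : R) : continuous y s by exact: (continuous_Rplus_norm cv).
have yE s : 0 <= s -> y s = norm (v s) by move=> s0; rewrite /y Rmax_right.
rewrite -yE //; apply: (gronwall KA_ge0 cy t0) => s [s0 _].
have h := mean_value_Rplus (V := RX) (f := v) (f' := fun s => macro_op a eps n (v s))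
  (g := fun s => KA * RInt y 0 s) (g' := fun s => KA * norm (v s)) dv
  (fun s s0 => is_derive_Rplus_scal (V := R_NormedModule) KA s0
     (is_derive_Rplus_RInt_norm cv s0)) _ s0.
have {}h : norm (minus (v s) (v 0)) <= KA * RInt y 0 s - KA * RInt y 0 0.
  apply: h => u u0'; apply: (Rle_trans _ _ _ (op_norm_bound _ _)).
  by apply: Rmult_le_compat_r A_le; exact: norm_ge_0.
rewrite RInt_point /zero /= Rmult_0_r Rminus_0_r in h.
have h0 : norm (v 0) <= norm u0 / (1 - c).
  rewrite v0; exact: (op_inv_bound u0 c_lt1 Phi0).
have := norm_rev_triangle (v s) (v 0); rewrite yE //; vlra.
Qed.

(** [w + D v] with [D] the primitive of the defect has derivative
    [a w + D A v], in which the defect only enters through its integral. *)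
Lemma micro_bound (v w : R -> RX) t : micro_macro a u0 eps n v w -> 0 <= t ->
  norm (w t) <= eta * (norm u0 / (1 - c)) * (2 * exp (KA * t) - 1) * exp (S * t).
Proof.
move=> hmm t0; have hv s := macro_bound (t := s) hmm.
have [dv _ dw w0] := hmm.
have K0 := KA_ge0; have S0 := S_ge0; have e0 := eta_ge0.
set V0 := norm u0 / (1 - c) in hv *.
have V00 : 0 <= V0 by apply: Rdiv_le_0_compat; [exact: norm_ge_0 | lra].
have q0 s : 0 <= s -> 0 <= s / eps by move=> s0; exact: Rdiv_le_0_compat.
(* The change of time s / eps cancels the factor eps in [dG]: D is the primitive of the rescaled
   defect, vanishing at 0. *)
set D := fun s => minus (G (s / eps)) (G 0).
have dD s : 0 <= s -> is_derive_Rplus D s (defect a eps n (s / eps) : ops).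
  move=> s0.
  have := is_derive_Rplus_plus s0 (is_derive_Rplus_comp_div s0 eps_gt0 (dG (q0 s s0)))
    (is_derive_Rplus_const (opp (G 0)) s0).
  congr is_derive_Rplus.
  by vec_eq constr:(ops); field; lra.
have D_le s : 0 <= s -> norm (D s) <= eta by move=> s0; apply: G_le; exact: q0.
have cw : continuous_Rplus w := derivable_continuous_Rplus dw.
set z := fun s => plus (w s) (op_apply (D s) (v s)).
set z' := fun s => plus (op_apply (a (s / eps)) (w s))
  (op_apply (D s) (op_apply (macro_op a eps n) (v s))).
have dz s : 0 <= s -> is_derive_Rplus z s (z' s).
  move=> s0.
  have := is_derive_Rplus_plus s0 (dw s s0)
    (is_derive_Rplus_bilinear op_apply_plus_l op_apply_plus_r op_apply_scal_l
       op_apply_scal_r op_apply_norm s0 (dD s s0) (dv s s0)).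
  congr is_derive_Rplus; rewrite /z'.
  change (a (s / eps) (w s)) with (op_apply (a (s / eps)) (w s)).
  change (defect a eps n (s / eps) (v s)) with (op_apply (defect a eps n (s / eps)) (v s)).
  change (macro_op a eps n (v s)) with (op_apply (macro_op a eps n) (v s)).
  by vec_eq constr:(RX).
set y := fun s => norm (w (Rmax 0 s)).
have cy (s : R) : continuous y s by exact: (continuous_Rplus_norm cw).
have yE s : 0 <= s -> y s = norm (w s) by move=> s0; rewrite /y Rmax_right.
have dg s (s0 : 0 <= s) := is_derive_Rplus_plus (V := R_NormedModule) s0
  (is_derive_Rplus_scal (V := R_NormedModule) S s0 (is_derive_Rplus_RInt_norm cw s0))
  (is_derive_Rplus_scal (V := R_NormedModule) (eta * V0) s0 (is_derive_Rplus_exp KA s0)).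
have z_le s : 0 <= s ->
    norm (z s) <= S * RInt y 0 s + eta * V0 * (exp (KA * s) - 1).
  move=> s0.
  have z0 : z 0 = zero.
    rewrite /z w0 /D /Rdiv Rmult_0_l minus_eq_zero.
    by rewrite plus_zero_l.
  have h := mean_value_Rplus dz dg _ s0.
  have {}h := h _; rewrite z0 minus_zero_r in h.
  apply: Rle_trans (h _) _; last first.
    rewrite RInt_point Rmult_0_r exp_0 /plus /scal /= /mult /= /zero /=.
    by apply: Req_le; rewrite /y; ring.
  move=> u u0'; apply: (Rle_trans _ _ _ (norm_triangle _ _)).
  apply: Rplus_le_compat.
    apply: (Rle_trans _ _ _ (op_apply_norm _ _)).
    by apply: Rmult_le_compat_r; [exact: norm_ge_0 | apply: a_le; exact: q0].
  apply: (Rle_trans _ _ _ (op_apply_norm _ _)).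
  rewrite /scal /= /mult /= Rmult_assoc.
  apply: Rmult_le_compat; [exact: norm_ge_0 | exact: norm_ge_0 | exact: D_le |].
  apply: (Rle_trans _ _ _ (op_apply_norm _ _)).
  have -> : V0 * (KA * exp (KA * u)) = KA * (V0 * exp (KA * u)) by ring.
  apply: Rmult_le_compat; [exact: norm_ge_0 | exact: norm_ge_0 | exact: A_le |].
  exact: hv.
(* Gronwall's inequality is stated with a constant forcing term, so the forcing is frozen at its
   value at the final time t. *)
have exp_mono s : 0 <= s <= t -> exp (KA * s) <= exp (KA * t).
  by move=> hs; apply: exp_le; apply: Rmult_le_compat_l => //; lra.
rewrite -yE //; apply: (gronwall S0 cy t0) => s hs; rewrite yE; last lra.
(* Integrating D A v contributes eta V0 (exp (KA s) - 1), and undoing the correction contributes eta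
   V0 exp (KA s): together they form the factor 2 exp - 1. *)
have -> : w s = minus (z s) (op_apply (D s) (v s)) by rewrite /z; vec_eq constr:(RX).
apply: (Rle_trans _ _ _ (norm_minus_le _ _)).
have h1 := z_le s ltac:(lra).
have h2 : norm (op_apply (D s) (v s)) <= eta * (V0 * exp (KA * s)).
  apply: (Rle_trans _ _ _ (op_apply_norm _ _)).
  apply: Rmult_le_compat; [exact: norm_ge_0 | exact: norm_ge_0 | |].
    by apply: D_le; lra.
  by apply: hv; lra.
have eV : 0 <= eta * V0 by exact: Rmult_le_pos.
have h3 := Rmult_le_compat_l _ _ _ eV (exp_mono s hs).
vlra.
Qed.
End MicroMacro.

(** * Bounds for the micro-macro problem under the hypotheses on [a] and omega *)

Section Bounds.
Context (k : base_field) (X : CompleteNormedModule (scalars k)).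
Context (r : nat) (omega : 'I_r -> R) (cD nu : R).
Context (a : R -> bounded_op X) (mu M c : R) (n : nat).
Notation ops := (real_ops X).
Notation cops := (@real_ops ComplexField (complexify X)).
Hypothesis r_gt0 : (1 <= r)%N.
Hypothesis dioph : diophantine omega cD nu.
Hypothesis mu_gt0 : 0 < mu.
Hypothesis M_gt0 : 0 < M.
Hypothesis aE : in_E omega mu a.
Hypothesis aM : N_norm omega mu a <= M.
Hypothesis c01 : 0 < c < 1.

Let eps_n := eps_threshold cD nu mu M c n.
Let delta := mu / (INR n + 1).

(** [N_norm] is a value chosen by [epsilon]; since [a] has a splitting, the choice is realized by
    one, and this is the splitting put into the algebra. *)
Lemma quasi_op_a : quasi_op (U := ops) (V := cops) (@cplxop k X) (@op_i (complexify X))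
  omega mu M a.
Proof.
have [phis [phib [hs eN]]] : exists phis phib, splits omega mu a phis phib /\
    N_norm omega mu a = real (fourier_norm mu phis) + real (exp_norm phib).
  rewrite /N_norm.
  set P := fun N => exists phis phib, _.
  apply: (epsilon_spec (inhabits 0) P).
  have [phis [phib hs]] := aE.
  by exists (real (fourier_norm mu phis) + real (exp_norm phib)), phis, phib.
have mu0 : 0 <= mu by lra.
have := quasi_op_splits mu0 hs; rewrite -eN.
by apply: quasi_weaken => //; lra.
Qed.

Lemma delta_gt0 : 0 < delta.
Proof. by apply: Rdiv_lt_0_compat => //; have := pos_INR n; lra. Qed.

Lemma eps_threshold_gt0 : 0 < eps_n.
Proof.
have [K1 _] := small_divisors r_gt0 dioph delta_gt0.
apply: Rdiv_lt_0_compat; first lra.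
by apply: Rmult_lt_0_compat => //; apply: Rmult_lt_0_compat; [rewrite /delta in K1; lra | nra].
Qed.

(** [sup_norm] takes the real part of an extended supremum, which is meaningful only if finite; the
    bound by M ensures this. *)
Lemma norm_a_le t : 0 <= t -> norm (a t : ops) <= sup_norm a.
Proof.
move=> t0; apply: le_Lub_Rbar; last by exists t.
set E := fun s => _.
have [ub lub] := Lub_Rbar_correct E.
have h1 : Rbar_le (Lub_Rbar E) M.
  apply: lub => s [u [u0 ->]].
  apply: (quasi_op_bound (@cplxop_norm k X) (@op_i_complex_structure (complexify X)) _
    quasi_op_a u0); lra.
have h2 : Rbar_le (norm (a t)) (Lub_Rbar E) by apply: ub; exists t.
by move: h1 h2; case: (Lub_Rbar E).
Qed.

Lemma micro_macro_bounds eps u0 v w t : 0 < eps <= eps_n ->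
  micro_macro a u0 eps n v w -> 0 <= t ->
  norm (v t) <= exp ((1 + c) * t * M) * (norm u0 / (1 - c)) /\
  norm (w t) <= (eps / eps_n) ^ (n + 1) * exp (t * sup_norm a) *
                (2 * exp ((1 + c) * t * M) - 1) * (norm u0 / (1 - c)).
Proof.
move=> [eps0 le_eps] hmm t0.
have en0 := eps_threshold_gt0; have d0 := delta_gt0.
have [K1 nonres] := small_divisors r_gt0 dioph d0.
set K := c_I cD nu delta in K1 nonres.
set x := eps / eps_n.
have x1 : x <= 1.
  by apply: (Rmult_le_reg_r eps_n) => //; rewrite /x; field_simplify; lra.
(* The definition of the threshold, solved for its denominator with x = eps / eps_n. *)
have epsE : eps * K * ((2 + c) * (1 + c)) * M = c * x.
  rewrite /x /eps_n /eps_threshold -/delta -/K; field; repeat split; lra.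
(* Since mu = (n + 1) delta, there is width for exactly n + 1 integrations. *)
have width m : (m <= n.+1)%N -> 0 <= mu - INR m * delta.
  move=> hm; have : INR m <= INR n.+1 by apply: le_INR; apply/leP.
  rewrite S_INR => hn.
  have -> : mu = (INR n + 1) * delta by rewrite /delta; field; have := pos_INR n; lra.
  nra.
set it := iterate (U := ops) (@op_comp k X) (op_id X) (@time_average k X) a eps.
have hJ := @op_i_complex_structure (complexify X).
have [e1 e2 e3 der] : [/\ forall t, 0 <= t -> norm (minus (it n t) (op_id X : ops)) <= c,
      norm (time_average (fun t => op_comp (a t) (it n t)) : ops) <= (1 + c) * M,
      forall t, 0 <= t ->
        norm (minus (minus (it n t) (it n.+1 t)) (minus (it n 0) (it n.+1 0))) <= x ^ n.+1 &
      forall m s, (m <= n)%N -> 0 <= s -> is_derive_Rplus (it m.+1) s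
        (scal eps (lam (U := ops) (@op_comp k X) (@time_average k X) a (it m) s))].
  exact: (iterate_estimates (@cplxop_plus k X) (@cplxop_scal k X) (@cplxop_norm k X)
    hJ (@cplxop_comp k X) (@op_comp_plus_l _ _) (@op_comp_plus_r _ _)
    (@op_comp_scal_l _ _) (@op_comp_scal_r _ _) (@op_comp_norm _ _)
    (@op_comp_i_l _ _) (@op_comp_i_r _ _) (@op_comp_id_l k X) (op_id_norm X)
    (@time_average_eq k X) (Rlt_le _ _ d0) K1 nonres width quasi_op_a M_gt0 c01 eps0 x1 epsE).
(* The iterate 0 is constant and has derivative zero; the later ones are primitives of eps times
   [lam]. *)
have [L hL] : exists L : R -> ops, forall s, 0 <= s -> is_derive_Rplus (it n) s (L s).
  case En : n => [|m]; first by exists (fun _ => zero) => s; exact: is_derive_Rplus_const.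
  by eexists => s s0; apply: der => //; rewrite En.
(* The derivative of iterate n + 1 is eps times [lam] at iterate n, so the derivative of G is eps
   times the defect: G is a primitive known in closed form and already estimated by [e3]. *)
set G := fun s => minus (it n s) (it n.+1 s).
have dG s : 0 <= s -> is_derive_Rplus G s (scal eps (defect a eps n s : ops)).
  move=> s0.
  have := is_derive_Rplus_plus s0 (hL s s0)
    (is_derive_Rplus_scal (-1) s0 (der n s (leqnn n) s0)).
  have -> : defect a eps n s = minus (scal (/ eps) (L s))
      (lam (U := ops) (@op_comp k X) (@time_average k X) a (it n) s) :> ops.
    rewrite /defect /macro_op !Phi_iterate -/it.
    by rewrite (op_derive_eq s0 (hL s s0)).
  have -> : scal eps (minus (scal (/ eps) (L s))
      (lam (U := ops) (@op_comp k X) (@time_average k X) a (it n) s)) =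
    plus (L s) (scal (-1) (scal eps
      (lam (U := ops) (@op_comp k X) (@time_average k X) a (it n) s))).
    by vec_eq constr:(ops); field; lra.
  by apply: is_derive_Rplus_ext => // u _; rewrite /G; vec_eq constr:(ops).
have Phi0 : norm (minus (Phi a eps n 0 : ops) (op_id X : ops)) <= c.
  by rewrite Phi_iterate; apply: e1; lra.
have A_le : norm (macro_op a eps n : ops) <= (1 + c) * M.
  by rewrite /macro_op Phi_iterate.
have c1 : c < 1 by lra.
have eKA : (1 + c) * M * t = (1 + c) * t * M by ring.
split.
  have := macro_bound c1 Phi0 A_le hmm t0; rewrite eKA Rmult_comm; exact.
have := micro_bound eps0 c1 Phi0 A_le norm_a_le dG e3 hmm t0.
rewrite eKA -/x addn1 (Rmult_comm (sup_norm a)) => h.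
by apply: Rle_trans h _; apply: Req_le; ring.
Qed.
End Bounds.

Theorem corollary2p15
    (k : base_field) (X : CompleteNormedModule (scalars k)) (u0 : X)
    (r : nat) (omega : 'I_r -> R) (cD nu : R)
    (a : R -> bounded_op X) (mu M c : R) (n : nat) :
  (1 <= r)%N ->
  diophantine omega cD nu ->
  0 < mu ->
  0 < M ->
  in_E omega mu a ->
  N_norm omega mu a <= M ->
  0 < c < 1 ->
  let eps_n := eps_threshold cD nu mu M c n in
  (forall eps, 0 < eps <= eps_n ->
   forall v w, micro_macro a u0 eps n v w ->
   forall t, 0 <= t ->
     norm (v t) <= exp ((1 + c) * t * M) * (norm u0 / (1 - c)) /\
     norm (w t) <= (eps / eps_n) ^ (n + 1) * exp (t * sup_norm a) *
                   (2 * exp ((1 + c) * t * M) - 1) * (norm u0 / (1 - c))) /\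
  (forall T, 0 < T ->
   exists Cv Cw : R,
   forall eps, 0 < eps <= eps_n ->
   forall v w, micro_macro a u0 eps n v w ->
   forall t, 0 <= t <= T ->
     norm (v t) <= Cv /\ norm (w t) <= Cw * eps ^ (n + 1)).
Proof.
move=> r1 dioph mu0 M0 aE aM c01 eps_n.
have main := @micro_macro_bounds k X r omega cD nu a mu M c n r1 dioph mu0 M0 aE aM c01.
split=> [eps heps v w hmm t t0|T T0]; first exact: main hmm t0.
have en0 : 0 < eps_n by exact: eps_threshold_gt0 r1 dioph mu0 M0 c01.
set V0 := norm u0 / (1 - c).
have V00 : 0 <= V0 by apply: Rdiv_le_0_compat; [exact: norm_ge_0 | lra].
have S0 : 0 <= sup_norm a.
  exact: Rle_trans (norm_ge_0 _) (norm_a_le mu0 aE aM (Rle_refl 0)).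
exists (exp ((1 + c) * T * M) * V0),
  (/ eps_n ^ (n + 1) * exp (T * sup_norm a) * (2 * exp ((1 + c) * T * M) - 1) * V0).
move=> eps heps v w hmm t [t0 tT]; have [hv hw] := main eps u0 v w t heps hmm t0.
have e1 : exp ((1 + c) * t * M) <= exp ((1 + c) * T * M).
  by apply: exp_le; apply: Rmult_le_compat_r; [lra | apply: Rmult_le_compat_l; lra].
have e2 : exp (t * sup_norm a) <= exp (T * sup_norm a).
  by apply: exp_le; apply: Rmult_le_compat_r.
(* This makes the factor 2 exp - 1 nonnegative, as required to multiply the monotonicity
   inequalities. *)
have e3 : 1 <= exp ((1 + c) * t * M).
  rewrite -[X in X <= _]exp_0; apply: exp_le.
  by apply: Rmult_le_pos; [apply: Rmult_le_pos; lra | lra].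
have ep := exp_pos (t * sup_norm a).
split; first by apply: Rle_trans hv _; exact: Rmult_le_compat_r.
apply: Rle_trans hw _; rewrite -/V0 -/eps_n.
have x0 : 0 <= (eps / eps_n) ^ (n + 1).
  by apply: pow_le; apply: Rdiv_le_0_compat; lra.
have -> : / eps_n ^ (n + 1) * exp (T * sup_norm a) * (2 * exp ((1 + c) * T * M) - 1) * V0
    * eps ^ (n + 1) =
  (eps / eps_n) ^ (n + 1) * exp (T * sup_norm a) * (2 * exp ((1 + c) * T * M) - 1) * V0.
  by rewrite /Rdiv Rpow_mult_distr pow_inv; ring.
apply: Rmult_le_compat_r => //; apply: Rmult_le_compat; [|lra| |lra].
  by apply: Rmult_le_pos; lra.
by apply: Rmult_le_compat_l.
Qed.
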